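(* Let $\alpha'>0$, $\beta'>0$, $0<\eta<\frac{1}{2C_2}$ with $\eta\le 1$, and $w\ge \frac{n}{s_R^\top s_C}$. Then there exists $\gamma'>0$, namely $\gamma'=\sup_{\hat v\in\mathcal P}\min\{\xi_1,\xi_2,\xi_3,\xi_4\}$ as defined in the context from $(\alpha',\beta',\eta,w)$, such that the following holds for every $\gamma$ satisfying $0<\gamma<\gamma'$ and $$\gamma\le\min\Big\{1,\ \beta'^{-1/2},\ \Big(\tfrac{2n}{\alpha'(\mu+L)(s_R^\top s_C)}\Big)^{1/3}\Big\}.$$ Set $\beta=\beta'\gamma^2$ and let the stepsizes $\alpha_i$ satisfy $\hat\alpha=\max_i\alpha_i=\alpha'\gamma^3$ and $\hat\alpha/\bar\alpha\le w$. Then, for the iterates of CPP, $\mathbb E\|\bar x^k-x^*\|_2^2$ and $\mathbb E\,|||\Pi_R X^k|||_R^2$ converge linearly to $0$. More specifically, writing $A=A(\hat\alpha,\beta,\gamma,\eta)$, one has $\rho(A)<1$ and for all $k\ge0$ $$\mathbb E\|\bar x^k-x^*\|_2^2\le \sigma\,\bar v_1\,\rho(A)^k,\qquad \mathbb E\,|||\Pi_RX^k|||_R^2\le\sigma\,\bar v_2\,\rho(A)^k,$$ where $\bar v\in\mathbb R^5$ is the positive right eigenvector (unique up to scaling) of $A$ for the eigenvalue $\rho(A)$ and $\sigma=\max_{1\le i\le4} d^0_i/\bar v_i$.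
   Context: **Problem.** A multi-agent network with $n$ agents $\mathcal N=\{1,\dots,n\}$; $f_i:\mathbb R^p\to\mathbb R$ differentiable, each $\mu$-strongly convex and $L$-smooth ($\mu>0$): $\langle x-y,\nabla f_i(x)-\nabla f_i(y)\rangle\ge\mu\|x-y\|_2^2$ and $\|\nabla f_i(x)-\nabla f_i(y)\|_2\le L\|x-y\|_2$. $f=\frac1n\sum_i f_i$ and $x^*$ is its unique minimizer. For $X\in\mathbb R^{n\times p}$ with rows $x_i^\top$, $\nabla F(X)\in\mathbb R^{n\times p}$ has rows $\nabla f_i(x_i)^\top$. $\mathbf 1$ is the all-ones column vector, $\rho(\cdot)$ the spectral radius. **Network.** $\mathcal G=(\mathcal N,\mathcal E)$ is a strongly connected directed graph. $R,C\in\mathbb R^{n\times n}$ are nonnegative matrices supported on $\mathcal G$ ($R_{ij}>0$ or $C_{ij}>0$ implies $(i,j)\in\mathcal E$) with $R\mathbf 1=\mathbf 1$, $\mathbf 1^\top C=\mathbf 1^\top$. For a nonnegative matrix $M$, $\mathcal R_M$ is the set of $i\in\mathcal N$ such that every $j\ne i$ admits a path $j=j_0,j_1,\dots,j_m=i$ with $M_{j_{l-1}j_l}>0$ (roots of spanning trees). Assume $\mathcal R_R\cap\mathcal R_{C^\top}\ne\emptyset$. Then there are unique $s_R,s_C\in\mathbb R^n$ with $s_R^\top R=s_R^\top$, $Cs_C=s_C$, $s_R^\top\mathbf 1=s_C^\top\mathbf 1=n$; they are entrywise nonnegative and $s_R^\top s_C>0$. Put $\Pi_R=I-\frac1n\mathbf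 1s_R^\top$, $\Pi_C=I-\frac1ns_C\mathbf 1^\top$, $R_\beta=(1-\beta)I+\beta R$, $C_\gamma=(1-\gamma)I+\gamma C$. **Norms.** For a vector norm $\|\cdot\|_*$ on $\mathbb R^n$: for $A\in\mathbb R^{n\times p}$, $|||A|||_*$ is the Euclidean norm of $(\|A_{:,1}\|_*,\dots,\|A_{:,p}\|_* )$ (so $|||A|||_2$ is the Frobenius norm); for $A\in\mathbb R^{n\times n}$, $\|A\|_*$ is the induced operator norm. Throughout, $\tilde R,\tilde C\in\mathbb R^{n\times n}$ are invertible matrices and $\theta_R,\theta_C\in(0,1]$, $\delta_{R,2},\delta_{C,2}$ constants such that $\|x\|_R=\|\tilde Rx\|_2$, $\|x\|_C=\|\tilde Cx\|_2$ satisfy: $\|\Pi_RR_\beta\|_R\le1-\theta_R\beta$ and $\|\Pi_CC_\gamma\|_C\le1-\theta_C\gamma$ for all $\beta,\gamma\in[0,1]$; $\|\Pi_R\|_R=\|\Pi_C\|_C=1$; $\|R\|_R\le2$, $\|R-I\|_R\le3$, $\|C\|_C\le2$, $\|C-I\|_C\le3$; $\|x\|_2\le\|x\|_R\le\delta_{R,2}\|x\|_2$ and $\|x\|_2\le\|x\|_C\le\delta_{C,2}\|x\|_2$ for all $x\in\mathbb R^n$ (the existence of such data is asserted to follow from the network assumption). **Compression.** $\mathrm{Compress}$ is a randomized map $\mathbb R^p\to\mathbb R^p$ with $\mathbb E[\mathrm{Compress}(x)\mid x]=x$ and $\mathbb E[\|\mathrm{Compress}(x)-x\|_2^2\mid x]\le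 C_2\|x\|_2^2$, $C_2>0$; the random variables generated inside a call $\mathrm{Compress}(x)$ depend on $x$ only. On $n\times p$ matrices it acts row by row. **CPP (Compressed Push-Pull).** Given an initial $X^0\in\mathbb R^{n\times p}$, $U^0=0$, $Y^0=\nabla F(X^0)$, stepsizes $\alpha_i\ge0$, $\boldsymbol\alpha=\mathrm{diag}(\alpha_1,\dots,\alpha_n)$, and $\beta,\gamma,\eta\in(0,1]$, for $k\ge0$: $\hat X^k=U^k+\mathrm{Compress}(X^k-U^k)$, $\hat Y^k=\mathrm{Compress}(Y^k)$, $X^{k+1}=(1-\beta)X^k+\beta R\hat X^k-\boldsymbol\alpha Y^k$, $Y^{k+1}=Y^k+\gamma(C-I)\hat Y^k+\nabla F(X^{k+1})-\nabla F(X^k)$, $U^{k+1}=(1-\eta)U^k+\eta\hat X^k$. Here $X^{k+1}$ is computed before $\mathrm{Compress}(Y^k)$ is called. Put $\hat\alpha=\max_i\alpha_i$, $\bar\alpha=\frac1ns_R^\top\boldsymbol\alpha s_C$ (assumed positive), $\bar x^k=\frac1n(X^k)^\top s_R\in\mathbb R^p$. **Error vector.** $d^k\in\mathbb R^5$ is $d^k=\mathbb E\big(\|\bar x^k-x^*\|_2^2,\ |||\Pi_RX^k|||_R^2,\ |||\Pi_CY^k|||_C^2,\ |||U^k-X^k|||_2^2,\ |||Y^k|||_2^2\big)^\top$. **Matrix $A$.** With $c_1=\frac{\mu}{w}$, $c_2=\frac{2(s_R^\top s_C)L^2}{\mu n^2}$, $c_3=\frac{2\|s_R\|_2^2w}{\mu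 n^2}$, $c_4=\frac{C_2\|s_R\|_2^2}{n^2}$, $c_5=\frac{\delta_{R,2}^2}{\theta_R}$, $c_6=C_2\delta_{R,2}^2$, $c_7=\frac{L^2\delta_{C,2}^2}{\theta_C}$, $c_8=9C_2\delta_{C,2}^2$, $c_9=\frac{3L^2\|s_C\|_2^2}{n}$, $c_{10}=3L^2\|s_C\|_2^2$, $$A(\hat\alpha,\beta,\gamma,\eta)=\begin{pmatrix}1-c_1\hat\alpha&c_2\hat\alpha&c_3\hat\alpha&c_4\beta^2&0\\0&1-\theta_R\beta&0&c_6\beta^2&c_5\frac{\hat\alpha^2}{\beta}\\0&\frac{8nc_7\beta^2}{\gamma}&1-\theta_C\gamma&\frac{C_2nc_7\beta^2}{\gamma}&c_8\gamma^2+\frac{2c_7\hat\alpha^2}{\gamma}\\0&\frac{8n\beta^2}{\eta}&0&1-\eta+2C_2\eta^2+2nC_2\beta^2&\frac{2\hat\alpha^2}{\eta}\\c_{10}&c_9&3&0&0\end{pmatrix}.$$ **The threshold $\gamma'$.** $\mathcal P$ is the set of positive vectors $\hat v=(\hat v_1,\dots,\hat v_5)$ with $c_2\hat v_2+c_3\hat v_3<c_1\hat v_1$ and $c_{10}\hat v_1+c_9\hat v_2+3\hat v_3<\hat v_5$. For $\hat v\in\mathcal P$, $\xi_i$ is the minimum positive root of the polynomial $g_i$ in $\gamma$: $g_1=(-c_1\hat v_1+c_2\hat v_2+c_3\hat v_3)\alpha'\gamma^3+c_4\hat v_4\beta'^2\gamma^4$; $g_2=-\theta_R\beta'\hat v_2\gamma^2+\big(c_6\hat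 v_4\beta'^2+c_5\hat v_5\frac{\alpha'^2}{\beta'}\big)\gamma^4$; $g_3=-\theta_C\hat v_3\gamma+c_8\hat v_5\gamma^2+(8nc_7\hat v_2\beta'^2+C_2nc_7\hat v_4\beta'^2)\gamma^3+2c_7\hat v_5\alpha'^2\gamma^5$; $g_4=-(\eta-2C_2\eta^2)\hat v_4+\big(\frac{8n\beta'^2\hat v_2}{\eta}+2nC_2\beta'^2\hat v_4\big)\gamma^4+\frac{2\alpha'^2\hat v_5}{\eta}\gamma^6$. *)

(* Defs.v *)
From HB Require Import structures.
From mathcomp Require Import all_boot all_order all_algebra.
From mathcomp Require Import all_classical all_reals all_analysis.
From mathcomp Require Import complex.

Set Implicit Arguments.
Unset Strict Implicit.
Unset Printing Implicit Defensive.

Import Order.TTheory GRing.Theory Num.Theory.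
Import numFieldNormedType.Exports.

Local Open Scope classical_set_scope.
Local Open Scope ring_scope.

(** Conventions.  A point of R^p is a row vector ['rV[R]_p], so that the rows of
    an [n x p] matrix are points of R^p.  Vectors of R^n (s_R, s_C, 1, ...) are
    column vectors, except for the stepsizes, a row as [diag_mx] expects.
    Indices start at 0. *)

Section Norms.
Context {R : realType}.

Definition mxdot {m n} (A B : 'M[R]_(m, n)) : R :=
  \sum_i \sum_j A i j * B i j.

(* The canonical norm `|A| on matrices is the max norm; this is the l^2 norm. *)
Definition enorm {m n} (A : 'M[R]_(m, n)) : R := Num.sqrt (mxdot A A).

Definition wnorm {n} (T : 'M[R]_n) (x : 'cV[R]_n) : R := enorm (T *m x).

Definition opnorm {n} (N : 'cV[R]_n -> R) (A : 'M[R]_n) : R :=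
  sup [set N (A *m x) / N x | x in [set x | x != 0]].

(* |||A|||_N : the l^2 norm of the vector of the N-norms of the columns of A *)
Definition tnorm {n p} (N : 'cV[R]_n -> R) (A : 'M[R]_(n, p)) : R :=
  enorm (\row_j N (col j A)).

Definition spectral_radius {n} (A : 'M[R]_n) : R :=
  sup [set ComplexField.Normc.normc z | z in
        [set z : R[i] |
          eigenvalue (map_mx (real_complex R) A) z]].

End Norms.

Section Objective.
Context {R : realType} {p : nat}.

Definition grad (f : 'rV[R]_p -> R) (x : 'rV[R]_p) : 'rV[R]_p :=
  \row_j 'D_(delta_mx 0 j) f x.

Definition strongly_convex (mu : R) (f : 'rV[R]_p -> R) : Prop :=
  forall x y, mu * enorm (x - y) ^+ 2 <= mxdot (x - y) (grad f x - grad f y).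

Definition smooth (L : R) (f : 'rV[R]_p -> R) : Prop :=
  forall x y, enorm (grad f x - grad f y) <= L * enorm (x - y).

Definition favg {n} (f : 'I_n -> 'rV[R]_p -> R) (x : 'rV[R]_p) : R :=
  n%:R^-1 * \sum_i f i x.

Definition gradF {n} (f : 'I_n -> 'rV[R]_p -> R) (X : 'M[R]_(n, p)) :
    'M[R]_(n, p) :=
  \matrix_(i, j) grad (f i) (row i X) 0 j.

End Objective.

Section Network.
Context {R : realType} {n : nat}.

Definition strongly_connected (E : rel 'I_n) : Prop :=
  forall i j, connect E i j.

Definition spanning_roots (M : 'M[R]_n) : {set 'I_n} :=
  [set i | [forall j, (j != i) ==> connect [rel a b | 0 < M a b] j i]]%SET.

Definition ones : 'cV[R]_n := const_mx 1.

Record network_assumption (E : rel 'I_n) (Rm Cm : 'M[R]_n) : Prop := {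
  net_connected : strongly_connected E;
  net_R_ge0 : forall i j, 0 <= Rm i j;
  net_C_ge0 : forall i j, 0 <= Cm i j;
  net_support : forall i j, 0 < Rm i j \/ 0 < Cm i j -> E i j;
  net_R_stochastic : Rm *m ones = ones;
  net_C_stochastic : ones^T *m Cm = ones^T;
  net_roots : (spanning_roots Rm :&: spanning_roots Cm^T)%SET != finset.set0 }.

Definition lazy (b : R) (M : 'M[R]_n) : 'M[R]_n := (1 - b)%:M + b *: M.

Definition PiR (sR : 'cV[R]_n) : 'M[R]_n := 1%:M - n%:R^-1 *: (ones *m sR^T).

Definition PiC (sC : 'cV[R]_n) : 'M[R]_n := 1%:M - n%:R^-1 *: (sC *m ones^T).

(* T, theta and delta for one of the pairs (R, Pi_R), (C, Pi_C), written (M, Pi) *)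
Record norm_data (M Pi T : 'M[R]_n) (theta delta : R) : Prop := {
  nd_unit : T \in unitmx;
  nd_theta : 0 < theta <= 1;
  nd_contract : forall b, 0 <= b <= 1 ->
    opnorm (wnorm T) (Pi *m lazy b M) <= 1 - theta * b;
  nd_Pi : opnorm (wnorm T) Pi = 1;
  nd_M : opnorm (wnorm T) M <= 2;
  nd_MI : opnorm (wnorm T) (M - 1%:M) <= 3;
  nd_equiv : forall x, enorm x <= wnorm T x <= delta * enorm x }.

End Network.

Section Randomness.
Context {R : realType}.

(* A randomized map is presented by a random seed: the value of a call at [x] is
   [compress x z] with [z] drawn from [nu].  Measurability is joint in (x, z),
   R^p carrying its Borel sigma-algebra. *)
Record compressor {p : nat} {dZ : measure_display} {Z : measurableType dZ}
    (nu : probability Z R) (C2 : R) (compress : 'rV[R]_p -> Z -> 'rV[R]_p) :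
    Prop := {
  comp_measurable : forall j, measurable_fun setT
    (fun u : g_sigma_algebraType (@open 'rV[R]_p) * Z => compress u.1 u.2 0 j);
  comp_unbiased : forall x j,
    ('E_nu[(fun z => compress x z 0 j)%R] = (x 0 j)%:E)%E;
  comp_variance : forall x,
    ('E_nu[(fun z => enorm (compress x z - x) ^+ 2)%R] <=
       (C2 * enorm x ^+ 2)%:E)%E }.

Definition mutually_independent {d dZ : measure_display}
    {Om : measurableType d} {Z : measurableType dZ} (P : probability Om R)
    (I : eqType) (z : I -> Om -> Z) : Prop :=
  forall (s : seq I) (B : I -> set Z), uniq s ->
    (forall i, measurable (B i)) ->
    P [set om | forall i, i \in s -> B i (z i om)] =
      (\prod_(i <- s) P (z i @^-1` B i))%E.

(* One seed per elementary call: [inl (k, i)] for the call of agent [i] on row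
   [i] of X^k - U^k, [inr (k, i)] for its call on row [i] of Y^k. *)
Definition call (n : nat) := (nat * 'I_n + nat * 'I_n)%type.

(* The seeds are independent copies of [nu], so a call made at a point that is a
   function of the seeds of other calls depends on the past through that point
   only. *)
Definition iid_seeds {n : nat} {d dZ : measure_display}
    {Om : measurableType d} {Z : measurableType dZ} (P : probability Om R)
    (nu : probability Z R) (seed : call n -> {RV P >-> Z}) : Prop :=
  mutually_independent P (fun c => seed c : Om -> Z) /\
  forall c B, measurable B -> distribution P (seed c) B = nu B.

End Randomness.

Section Algorithm.
Context {R : realType} {n p : nat}.

Definition compress_mx {Z : Type} (compress : 'rV[R]_p -> Z -> 'rV[R]_p)
    (z : 'I_n -> Z) (A : 'M[R]_(n, p)) : 'M[R]_(n, p) :=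
  \matrix_(i, j) compress (row i A) (z i) 0 j.

Record is_CPP {Om Z : Type} (f : 'I_n -> 'rV[R]_p -> R) (Rm Cm : 'M[R]_n)
    (compress : 'rV[R]_p -> Z -> 'rV[R]_p) (seed : call n -> Om -> Z)
    (alpha : 'rV[R]_n) (beta gamma eta : R) (X0 : 'M[R]_(n, p))
    (X Y U Xh Yh : nat -> Om -> 'M[R]_(n, p)) : Prop := {
  cpp_X0 : forall om, X 0%N om = X0;
  cpp_U0 : forall om, U 0%N om = 0;
  cpp_Y0 : forall om, Y 0%N om = gradF f X0;
  cpp_Xh : forall k om, Xh k om = U k om +
    compress_mx compress (fun i => seed (inl (k, i)) om) (X k om - U k om);
  cpp_Yh : forall k om, Yh k om =
    compress_mx compress (fun i => seed (inr (k, i)) om) (Y k om);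
  cpp_X : forall k om, X k.+1 om =
    (1 - beta) *: X k om + beta *: (Rm *m Xh k om) - diag_mx alpha *m Y k om;
  cpp_Y : forall k om, Y k.+1 om =
    Y k om + gamma *: ((Cm - 1%:M) *m Yh k om)
      + gradF f (X k.+1 om) - gradF f (X k om);
  cpp_U : forall k om, U k.+1 om = (1 - eta) *: U k om + eta *: Xh k om }.

Definition alpha_hat (alpha : 'rV[R]_n) : R := \big[Order.max/0]_i alpha 0 i.

Definition alpha_bar (sR sC : 'cV[R]_n) (alpha : 'rV[R]_n) : R :=
  n%:R^-1 * (sR^T *m diag_mx alpha *m sC) 0 0.

(* the transpose of (1/n) X^T s_R *)
Definition xbar (sR : 'cV[R]_n) (X : 'M[R]_(n, p)) : 'rV[R]_p :=
  n%:R^-1 *: (sR^T *m X).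

Definition sq_errors (sR sC : 'cV[R]_n) (TR TC : 'M[R]_n) (xs : 'rV[R]_p)
    (X Y U : 'M[R]_(n, p)) : seq R :=
  [:: enorm (xbar sR X - xs) ^+ 2;
      tnorm (wnorm TR) (PiR sR *m X) ^+ 2;
      tnorm (wnorm TC) (PiC sC *m Y) ^+ 2;
      tnorm enorm (U - X) ^+ 2;
      tnorm enorm Y ^+ 2].

(* Extended-real valued, as finiteness of the expectations is not assumed. *)
Definition error_vector {d : measure_display} {Om : measurableType d}
    (P : probability Om R) (sR sC : 'cV[R]_n) (TR TC : 'M[R]_n) (xs : 'rV[R]_p)
    (X Y U : nat -> Om -> 'M[R]_(n, p)) (k : nat) (i : 'I_5) : \bar R :=
  ('E_P[(fun om =>
     (sq_errors sR sC TR TC xs (X k om) (Y k om) (U k om))`_i)%R])%E.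

End Algorithm.

Section Constants.
Context {R : realType}.

Record coefs := Coefs {
  c1 : R; c2 : R; c3 : R; c4 : R; c5 : R;
  c6 : R; c7 : R; c8 : R; c9 : R; c10 : R }.

Definition cpp_coefs {n : nat} (sR sC : 'cV[R]_n)
    (mu L C2 w thetaR thetaC deltaR deltaC : R) : coefs := {|
  c1 := mu / w;
  c2 := 2 * mxdot sR sC * L ^+ 2 / (mu * n%:R ^+ 2);
  c3 := 2 * enorm sR ^+ 2 * w / (mu * n%:R ^+ 2);
  c4 := C2 * enorm sR ^+ 2 / n%:R ^+ 2;
  c5 := deltaR ^+ 2 / thetaR;
  c6 := C2 * deltaR ^+ 2;
  c7 := L ^+ 2 * deltaC ^+ 2 / thetaC;
  c8 := 9 * C2 * deltaC ^+ 2;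
  c9 := 3 * L ^+ 2 * enorm sC ^+ 2 / n%:R;
  c10 := 3 * L ^+ 2 * enorm sC ^+ 2 |}.

Definition rateA (n : nat) (C2 thetaR thetaC : R) (c : coefs)
    (a b g eta : R) : 'M[R]_5 :=
  \matrix_(i, j) (nth [::] [::
    [:: 1 - c1 c * a; c2 c * a; c3 c * a; c4 c * b ^+ 2; 0];
    [:: 0; 1 - thetaR * b; 0; c6 c * b ^+ 2; c5 c * (a ^+ 2 / b)];
    [:: 0; 8 * n%:R * c7 c * b ^+ 2 / g; 1 - thetaC * g;
        C2 * n%:R * c7 c * b ^+ 2 / g;
        c8 c * g ^+ 2 + 2 * c7 c * a ^+ 2 / g];
    [:: 0; 8 * n%:R * b ^+ 2 / eta; 0;
        1 - eta + 2 * C2 * eta ^+ 2 + 2 * n%:R * C2 * b ^+ 2;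
        2 * a ^+ 2 / eta];
    [:: c10 c; c9 c; 3; 0; 0]] i)`_j.

Definition positive_vec {m : nat} (v : 'cV[R]_m) : Prop := forall i, 0 < v i 0.

Definition admissible (c : coefs) (v : 'cV[R]_5) : Prop :=
  [/\ positive_vec v,
      c2 c * v 1 0 + c3 c * v 2 0 < c1 c * v 0 0
    & c10 c * v 0 0 + c9 c * v 1 0 + 3 * v 2 0 < v 4 0].

(* The polynomials g_1, ..., g_4 in gamma; [a] and [b] are alpha' and beta'. *)
Definition g1 (c : coefs) (a b : R) (v : 'cV[R]_5) : {poly R} :=
  ((- c1 c * v 0 0 + c2 c * v 1 0 + c3 c * v 2 0) * a) *: 'X^3
  + (c4 c * v 3 0 * b ^+ 2) *: 'X^4.

Definition g2 (thetaR : R) (c : coefs) (a b : R) (v : 'cV[R]_5) : {poly R} :=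
  (- thetaR * b * v 1 0) *: 'X^2
  + (c6 c * v 3 0 * b ^+ 2 + c5 c * v 4 0 * (a ^+ 2 / b)) *: 'X^4.

Definition g3 (n : nat) (C2 thetaC : R) (c : coefs) (a b : R) (v : 'cV[R]_5) :
    {poly R} :=
  (- thetaC * v 2 0) *: 'X + (c8 c * v 4 0) *: 'X^2
  + (8 * n%:R * c7 c * v 1 0 * b ^+ 2 + C2 * n%:R * c7 c * v 3 0 * b ^+ 2)
      *: 'X^3
  + (2 * c7 c * v 4 0 * a ^+ 2) *: 'X^5.

Definition g4 (n : nat) (C2 eta : R) (a b : R) (v : 'cV[R]_5) : {poly R} :=
  (- (eta - 2 * C2 * eta ^+ 2) * v 3 0)%:P
  + (8 * n%:R * b ^+ 2 * v 1 0 / eta + 2 * n%:R * C2 * b ^+ 2 * v 3 0) *: 'X^4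
  + (2 * a ^+ 2 * v 4 0 / eta) *: 'X^6.

Definition is_min_pos_root (q : {poly R}) (x : R) : Prop :=
  [/\ 0 < x, root q x & forall y, 0 < y -> root q y -> x <= y].

(* { min(xi_1, xi_2, xi_3, xi_4) : v admissible }, whose supremum is gamma' *)
Definition threshold_set (n : nat) (C2 thetaR thetaC : R) (c : coefs)
    (eta a b : R) : set R :=
  [set m | exists v : 'cV[R]_5, exists xi1 xi2 xi3 xi4 : R,
    [/\ admissible c v,
        is_min_pos_root (g1 c a b v) xi1
      & is_min_pos_root (g2 thetaR c a b v) xi2] /\
    [/\ is_min_pos_root (g3 n C2 thetaC c a b v) xi3,
        is_min_pos_root (g4 n C2 eta a b v) xi4
      & m = Num.min (Num.min xi1 xi2) (Num.min xi3 xi4)]].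

Definition perron_vector {m : nat} (A : 'M[R]_m) (v : 'cV[R]_m) : Prop :=
  positive_vec v /\ A *m v = spectral_radius A *: v.

(* max over the first four components only *)
Definition sigma (d0 : 'I_5 -> \bar R) (v : 'cV[R]_5) : \bar R :=
  (\big[maxe/-oo]_(i < 5 | (i < 4)%N) (d0 i * ((v i 0)^-1)%:E))%E.

Definition converges_linearly_to_0 (u : nat -> \bar R) : Prop :=
  exists c q : R, [/\ 0 <= q, q < 1 &
    forall k, (`|u k| <= (c * q ^+ k)%:E)%E].

End Constants.

Arguments coefs : clear implicits.

(* Main.v *)
Require Import Defs.
From HB Require Import structures.
From mathcomp Require Import all_boot all_order all_algebra.
From mathcomp Require Import all_classical all_reals all_analysis.
From mathcomp Require Import measurable_realfun complex ring lra.

(** The five mean-square errors [d^k] satisfy [d^(k+1) <= A d^k] in their first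
    four components, while the fifth is bounded by the first three at the same
    time [k], through the last row of [A].  Since [A] is nonnegative, comparing
    [d^k] with a multiple of a positive eigenvector [v], [A v = rho v], gives
    [d^k <= sigma rho^k v] by induction ([eigenvector_domination]).  It remains
    to prove the inequality, to find [v], and to see that [rho < 1].

    The inequality.  A step of the algorithm is a deterministic step plus a
    linear image of a compression error.  The error of a call has mean zero
    conditionally on the seeds of all the other calls, hence is orthogonal in
    mean to whatever is computed without its own seed, and mean squares add up
    ([noisy_square_le]).  For [Y^(k+1)] this uses that [X^(k+1)] does not depend
    on the compression of [Y^k].  The conditioning is done by freezing: the seeds
    of the other calls generate a sigma-algebra independent of the seed of the
    call ([independent_of_past], a pi-lambda argument), so Fubini's theorem lets
    one integrate over that seed first ([ge0_integral_freeze],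
    [integral_freeze0]).  Each deterministic step is a contraction by [1 - q]
    followed by a perturbation, which convexity charges with weight [1 / q]
    ([mxdot_contractD]).  For the average the contraction is a gradient step on
    [f] with stepsize [alpha_bar], because the columns of [Y^k] have the same sums
    as those of the stacked gradients ([CPP_tracked]); its factor
    [1 - mu alpha_bar] comes from the Baillon-Haddad inequality
    ([gradient_step_contract]).  For the consensus errors it is the assumed
    contraction in the weighted norms, and for the compression error the convex
    combination with weight [eta].

    The eigenvector.  The matrix [A] is nonnegative under the bounds on [gamma]
    and irreducible; [perron_exists] produces [v] by maximizing [l] over the
    compact set of pairs [(l, x)] with [x] in the simplex and [l x <= A x].  Any
    eigenvalue with a positive eigenvector is the spectral radius
    ([spectral_radius_perron]).

    The threshold.  The first four rows of [A u - u] are the values at [gamma] of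
    the polynomials [g_i] attached to [u], and the fifth is negative for [u] in
    the set [P].  Up to a power of [gamma], [g_i] is increasing and
    starts from a negative value, so it is negative before its first positive
    root.  Hence [gamma < gamma'] provides a positive [u] with [A u < u]
    ([below_threshold]), and then [rho < 1] ([perron_lt1]).  The supremum is
    finite because the root of [g_2] is bounded uniformly in [u]
    ([g2_root_le]). *)

Set Implicit Arguments.
Unset Strict Implicit.
Unset Printing Implicit Defensive.

Import Order.TTheory GRing.Theory Num.Theory.
Import numFieldNormedType.Exports.

Local Open Scope classical_set_scope.
Local Open Scope ring_scope.

(** * Frobenius inner product and weighted norms *)

Lemma le_of_eq {d} {T : porderType d} (x y : T) : x = y -> (x <= y)%O.
Proof. by move=> ->. Qed.

Section Frobenius.
Context {R : realType}.

Lemma mxdotC {m n} (A B : 'M[R]_(m, n)) : mxdot A B = mxdot B A.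
Proof. by apply: eq_bigr => i _; apply: eq_bigr => j _; rewrite mulrC. Qed.

Lemma mxdotDl {m n} (A B C : 'M[R]_(m, n)) :
  mxdot (A + B) C = mxdot A C + mxdot B C.
Proof.
rewrite -big_split; apply: eq_bigr => i _ /=; rewrite -big_split.
by apply: eq_bigr => j _ /=; rewrite mxE mulrDl.
Qed.

Lemma mxdotZl {m n} a (A B : 'M[R]_(m, n)) : mxdot (a *: A) B = a * mxdot A B.
Proof.
rewrite /mxdot mulr_sumr; apply: eq_bigr => i _; rewrite mulr_sumr.
by apply: eq_bigr => j _; rewrite mxE mulrA.
Qed.

Lemma mxdotNl {m n} (A B : 'M[R]_(m, n)) : mxdot (- A) B = - mxdot A B.
Proof. by rewrite -scaleN1r mxdotZl mulN1r. Qed.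

Lemma mxdotDr {m n} (A B C : 'M[R]_(m, n)) :
  mxdot C (A + B) = mxdot C A + mxdot C B.
Proof. by rewrite mxdotC mxdotDl !(mxdotC C). Qed.

Lemma mxdotZr {m n} a (A B : 'M[R]_(m, n)) : mxdot A (a *: B) = a * mxdot A B.
Proof. by rewrite mxdotC mxdotZl mxdotC. Qed.

Lemma mxdotNr {m n} (A B : 'M[R]_(m, n)) : mxdot A (- B) = - mxdot A B.
Proof. by rewrite mxdotC mxdotNl mxdotC. Qed.

Definition mxdotE {m n} := (@mxdotDl m n, @mxdotDr m n, @mxdotZl m n,
  @mxdotZr m n, @mxdotNl m n, @mxdotNr m n).

Lemma mxdot_ge0 {m n} (A : 'M[R]_(m, n)) : 0 <= mxdot A A.
Proof. by do 2![apply: sumr_ge0 => ? _]; rewrite -expr2 sqr_ge0. Qed.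

Lemma enorm_sqr {m n} (A : 'M[R]_(m, n)) : enorm A ^+ 2 = mxdot A A.
Proof. by rewrite sqr_sqrtr // mxdot_ge0. Qed.

Lemma enorm_ge0 {m n} (A : 'M[R]_(m, n)) : 0 <= enorm A.
Proof. exact: sqrtr_ge0. Qed.

Lemma sqr_entry_le {m n} (A : 'M[R]_(m, n)) i j : A i j ^+ 2 <= mxdot A A.
Proof.
rewrite /mxdot (bigD1 i) //= (bigD1 j) //= -expr2 -addrA lerDl addr_ge0 //.
  by apply: sumr_ge0 => ? _; rewrite -expr2 sqr_ge0.
by do 2![apply: sumr_ge0 => ? _]; rewrite -expr2 sqr_ge0.
Qed.

Lemma mxdot_eq0 {m n} (A : 'M[R]_(m, n)) : mxdot A A <= 0 -> A = 0.
Proof.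
move=> A0; apply/matrixP => i j; rewrite mxE; apply/eqP.
by rewrite -sqrf_eq0 eq_le sqr_ge0 andbT (le_trans (sqr_entry_le A i j)).
Qed.

Lemma mxdot_gt0 {m n} (A : 'M[R]_(m, n)) : A != 0 -> 0 < mxdot A A.
Proof. by rewrite ltNge; apply: contra_neqN => /mxdot_eq0. Qed.

Lemma mxdot_CS {m n} (A B : 'M[R]_(m, n)) :
  mxdot A B ^+ 2 <= mxdot A A * mxdot B B.
Proof.
have [->|B0] := eqVneq B 0.
  by rewrite -(scale0r (0 : 'M[R]_(m, n))) !mxdotE !mul0r mulr0 expr0n.
have Bp := mxdot_gt0 B0.
(* the component of [A] orthogonal to [B], scaled to avoid a division *)
have := mxdot_ge0 (mxdot B B *: A - mxdot A B *: B).
rewrite !mxdotE (mxdotC B A) => h.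
by rewrite -subr_ge0 -(pmulr_rge0 _ Bp); apply: le_trans h _; lra.
Qed.

(** Convexity of the square: the error of a contraction by [1 - q] followed by
    a perturbation [B] is charged to [B] with weight [1 / q]. *)
Lemma mxdot_contractD {m n} (A B : 'M[R]_(m, n)) (q a : R) :
  0 < q <= 1 -> mxdot A A <= (1 - q) ^+ 2 * a ->
  mxdot (A + B) (A + B) <= (1 - q) * a + mxdot B B / q.
Proof.
move=> /andP[q0 q1]; rewrite !mxdotE (mxdotC B A).
have [->|q1'] := eqVneq q 1 => Aa.
  have A0 : A = 0.
    by apply: mxdot_eq0; apply: le_trans Aa _; rewrite subrr expr0n mul0r.
  by rewrite A0 -(scale0r (0 : 'M[R]_(m, n))) !mxdotE; lra.
have t0 : 0 < 1 - q by rewrite subr_gt0 lt_neqAle q1' q1.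
(* equality holds when [A / (1 - q) = B / q] *)
have := mxdot_ge0 (q *: A - (1 - q) *: B).
rewrite !mxdotE (mxdotC B A) => h.
have hA : mxdot A A / (1 - q) <= (1 - q) * a.
  by rewrite ler_pdivrMr //; apply: le_trans Aa _; lra.
apply: le_trans (_ : mxdot A A / (1 - q) + mxdot B B / q <= _); last by rewrite lerD2r.
have qt : 0 < q * (1 - q) by rewrite mulr_gt0.
rewrite -subr_ge0 -(pmulr_rge0 _ qt); apply: le_trans h _.
apply: le_of_eq; field.
by rewrite (gt_eqF q0) gt_eqF.
Qed.

Lemma mxdotD_le2 {m n} (A B : 'M[R]_(m, n)) :
  mxdot (A + B) (A + B) <= 2 * mxdot A A + 2 * mxdot B B.
Proof.
have := mxdot_ge0 (A - B); rewrite !mxdotE (mxdotC B A) => h; lra.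
Qed.

Lemma mxdotD_le3 {m n} (A B C : 'M[R]_(m, n)) :
  mxdot (A + B + C) (A + B + C) <=
    3 * mxdot A A + 3 * mxdot B B + 3 * mxdot C C.
Proof.
have := mxdot_ge0 (A - B); have := mxdot_ge0 (A - C); have := mxdot_ge0 (B - C).
by rewrite !mxdotE (mxdotC B A) (mxdotC C A) (mxdotC C B) => h1 h2 h3; lra.
Qed.

Lemma mxdot_tr {m n} (A B : 'M[R]_(m, n)) : mxdot A^T B^T = mxdot A B.
Proof.
rewrite /mxdot exchange_big; apply: eq_bigr => i _; apply: eq_bigr => j _.
by rewrite !mxE.
Qed.

Lemma mxdot_rows {m n} (A B : 'M[R]_(m, n)) :
  mxdot A B = \sum_i mxdot (row i A) (row i B).
Proof.
apply: eq_bigr => i _; rewrite /mxdot big_ord1.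
by apply: eq_bigr => j _; rewrite !mxE.
Qed.

Lemma mxdot_cols {m n} (A B : 'M[R]_(m, n)) :
  mxdot A B = \sum_j mxdot (col j A) (col j B).
Proof.
rewrite /mxdot exchange_big /=; apply: eq_bigr => j _; apply: eq_bigr => i _.
by rewrite big_ord1 !mxE.
Qed.

Lemma mxdot_mulmx_le {m n p} (A : 'M[R]_(m, n)) (B : 'M[R]_(n, p)) :
  mxdot (A *m B) (A *m B) <= mxdot A A * mxdot B B.
Proof.
rewrite (mxdot_rows A) mulr_suml [leLHS]mxdot_rows.
apply: ler_sum => i _; rewrite [leLHS]mxdot_cols.
rewrite (mxdot_cols B) mulr_sumr; apply: ler_sum => j _.
have -> : col j (row i (A *m B)) = const_mx (mxdot (row i A) (col j B)^T).
  apply/matrixP => a b; rewrite !mxE /mxdot big_ord1.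
  by apply: eq_bigr => k _; rewrite !mxE.
rewrite {1}/mxdot !big_ord1 !mxE -expr2; apply: le_trans (mxdot_CS _ _) _.
by rewrite mxdot_tr.
Qed.

Lemma mxdot_scale_rows_le {m n} (a : 'rV[R]_m) (ah : R) (A : 'M[R]_(m, n)) :
  (forall i, 0 <= a 0 i <= ah) ->
  mxdot (diag_mx a *m A) (diag_mx a *m A) <= ah ^+ 2 * mxdot A A.
Proof.
move=> aP; rewrite /mxdot mulr_sumr; apply: ler_sum => i _.
rewrite mulr_sumr; apply: ler_sum => j _.
rewrite mul_diag_mx !mxE mulrACA -!expr2 ler_wpM2r ?sqr_ge0 //.
by have /andP[a0 a1] := aP i; rewrite lerXn2r // nnegrE (le_trans a0).
Qed.

Lemma col_mul {m n p} (A : 'M[R]_(m, n)) (B : 'M[R]_(n, p)) j :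
  col j (A *m B) = A *m col j B.
Proof.
by apply/matrixP => i k; rewrite !mxE; apply: eq_bigr => l _; rewrite !mxE.
Qed.

(** Makes every squared error a quadratic form in the Frobenius inner product,
    so that its mean can be expanded. *)
Lemma tnorm_wnorm {n p} (T : 'M[R]_n) (A : 'M[R]_(n, p)) :
  tnorm (wnorm T) A ^+ 2 = mxdot (T *m A) (T *m A).
Proof.
rewrite enorm_sqr [RHS]mxdot_cols {1}/mxdot big_ord1.
by apply: eq_bigr => j _; rewrite mxE -expr2 enorm_sqr -col_mul.
Qed.

Lemma tnorm_enorm {n p} (A : 'M[R]_(n, p)) : tnorm enorm A ^+ 2 = mxdot A A.
Proof.
rewrite enorm_sqr [RHS]mxdot_cols {1}/mxdot big_ord1.
by apply: eq_bigr => j _; rewrite mxE -expr2 enorm_sqr.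
Qed.

(** The supremum defining [opnorm] is over a bounded set, because [T] can be
    inverted: [T A x = (T A T^-1) T x]. *)
Lemma wnorm_mul_le {n} (T A : 'M[R]_n) (x : 'cV[R]_n) : T \in unitmx ->
  wnorm T (A *m x) <= opnorm (wnorm T) A * wnorm T x.
Proof.
move=> Tu; have [->|x0] := eqVneq x 0.
  rewrite /wnorm /enorm !mulmx0 -(scale0r (0 : 'cV[R]_n)) mxdotZl mul0r sqrtr0.
  by rewrite mulr0.
have wgt0 (y : 'cV[R]_n) : y != 0 -> 0 < wnorm T y.
  move=> y0; rewrite sqrtr_gt0 mxdot_gt0 //; apply: contra_neq y0 => Ty0.
  by rewrite -(mulKmx Tu y) Ty0 mulmx0.
rewrite -ler_pdivrMr ?wgt0 //; apply: sup_upper_bound; last by exists x.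
split; first by exists (wnorm T (A *m x) / wnorm T x), x.
exists (enorm (T *m A *m invmx T)) => _ [y /= y0 <-].
rewrite ler_pdivrMr ?wgt0 // -ler_sqr ?nnegrE ?mulr_ge0 ?enorm_ge0 //.
rewrite exprMn !enorm_sqr; apply: le_trans (mxdot_mulmx_le _ _).
by rewrite -!mulmxA mulKmx.
Qed.

Lemma mxdot_opnorm_le {n p} (T A : 'M[R]_n) (X : 'M[R]_(n, p)) (b : R) :
  T \in unitmx -> opnorm (wnorm T) A <= b ->
  mxdot (T *m (A *m X)) (T *m (A *m X)) <= b ^+ 2 * mxdot (T *m X) (T *m X).
Proof.
move=> Tu Ab; rewrite !(mxdot_cols (_ *m _)) mulr_sumr; apply: ler_sum => j _.
rewrite !col_mul -!enorm_sqr -exprMn.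
have := wnorm_mul_le A (col j X) Tu; rewrite /wnorm => h.
have {}h := le_trans h (ler_wpM2r (enorm_ge0 _) Ab).
by rewrite ler_sqr ?nnegrE ?enorm_ge0 ?(le_trans _ h) ?enorm_ge0.
Qed.

End Frobenius.

(** * Gradients of strongly convex smooth functions *)

Section Convexity.
Context {R : realType} {p : nat}.
Implicit Types (f h : 'rV[R]_p -> R) (x y z v : 'rV[R]_p).

Lemma derive_grad f x v : differentiable f x -> 'D_v f x = mxdot v (grad f x).
Proof.
move=> df; rewrite deriveE // {1}(row_sum_delta v) linear_sum /mxdot big_ord1.
by apply: eq_bigr => j _; rewrite linearZ /= mxE deriveE.
Qed.

Lemma is_derive_line f x v (t : R) : differentiable f (x + t *: v) ->
  is_derive t 1 (fun s : R => f (x + s *: v)) (mxdot v (grad f (x + t *: v))).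
Proof.
move=> df; rewrite -derive_grad //.
(* the difference quotients of the restriction to the line are those of [f] *)
have E : (fun h : R => h^-1 *: (f (x + (h *: (1 : R) + t) *: v)
                          - f (x + t *: v))) =
         (fun h : R => h^-1 *: (f (h *: v + (x + t *: v)) - f (x + t *: v))).
  apply/funext => h; congr (_ *: (f _ - _)).
  by rewrite [h *: 1]mulr1 scalerDl addrCA.
apply: DeriveDef; last by rewrite /derive /= -E.
by have := @diff_derivable _ _ _ f _ v df; rewrite /derivable /= -E.
Qed.

(** The difference of [phi] and of the parabola [a s + b s^2 / 2] is
    nondecreasing. *)
Lemma ge_affine_derive (phi dphi : R -> R) (a b : R) :
  (forall t : R, is_derive t 1 phi (dphi t)) ->
  (forall t, 0 < t -> a + b * t <= dphi t) ->
  phi 0 + a + b / 2 <= phi 1.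
Proof.
move=> dphiP le_dphi.
pose psi := fun t : R => phi t - (a * t + b / 2 * t ^+ 2).
have psiD (t : R) : is_derive t 1 psi (dphi t - (a + b * t)).
  rewrite /psi; have := dphiP t => ?.
  apply: is_derive_eq; rewrite /GRing.scale /=.
  by field.
suff : psi 0 <= psi 1 by rewrite /psi; lra.
have [] : (forall t : R, t \in `]0, 1[ -> derivable psi t 1) /\
          (forall t : R, t \in `]0, 1[ -> 0 <= psi^`()%classic t).
  split => t; rewrite in_itv /= => /andP[t0 _]; have := psiD t => -[h1 h2] //.
  by rewrite derive1E h2 subr_ge0 le_dphi.
move=> h1 h2; apply: (ger0_derive1_ndecr h1 h2) => //.
apply: derivable_within_continuous => t _.
by have := psiD t => -[].
Qed.

Section Bounds.
Variables (f : 'rV[R]_p -> R) (mu L : R).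
Hypothesis f_diff : forall x, differentiable f x.

Lemma strongly_convex_lower x y : strongly_convex mu f ->
  f x + mxdot (y - x) (grad f x) + mu / 2 * mxdot (y - x) (y - x) <= f y.
Proof.
move=> fc; set v := y - x.
have := @ge_affine_derive (fun s => f (x + s *: v))
  (fun t => mxdot v (grad f (x + t *: v))) (mxdot v (grad f x))
  (mu * mxdot v v).
rewrite scale0r addr0 scale1r /v subrKC -/v => h.
have {}h := h (fun t => is_derive_line (f_diff _)).
apply: le_trans (h _); first by apply: le_of_eq; lra.
move=> t t0; have := fc (x + t *: v) x.
rewrite enorm_sqr addrAC subrr add0r !mxdotZl mxdotZr mulrCA.
rewrite ler_pM2l // !mxdotE => k; lra.
Qed.

Lemma smooth_ge0 x y : x != y -> smooth L f -> 0 <= L.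
Proof.
move=> xy fs; have := le_trans (enorm_ge0 _) (fs x y).
by rewrite pmulr_lge0 // sqrtr_gt0 mxdot_gt0 // subr_eq0.
Qed.

Lemma smooth_sqr x y : smooth L f ->
  mxdot (grad f x - grad f y) (grad f x - grad f y) <=
    L ^+ 2 * mxdot (x - y) (x - y).
Proof.
move=> fs; have := fs x y; rewrite -!enorm_sqr -exprMn => h.
by rewrite ler_sqr // nnegrE ?enorm_ge0 // (le_trans _ h) ?enorm_ge0.
Qed.

Lemma smooth_dot x y : smooth L f ->
  mxdot (x - y) (grad f x - grad f y) <= L * mxdot (x - y) (x - y).
Proof.
move=> fs; have [->|xy] := eqVneq x y.
  by rewrite !subrr -(scale0r (0 : 'rV[R]_p)) !mxdotE; lra.
have L0 := smooth_ge0 xy fs.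
have := mxdot_CS (x - y) (grad f x - grad f y) => CS.
have h := le_trans CS (ler_wpM2l (mxdot_ge0 _) (smooth_sqr x y fs)).
have [neg|pos] := leP (mxdot (x - y) (grad f x - grad f y)) 0.
  by apply: le_trans neg _; rewrite mulr_ge0 // mxdot_ge0.
rewrite -ler_sqr ?nnegrE ?mulr_ge0 ?mxdot_ge0 ?(ltW pos) //.
by apply: le_trans h _; rewrite exprMn; lra.
Qed.

Lemma smooth_upper x y : smooth L f ->
  f y <= f x + mxdot (y - x) (grad f x) + L / 2 * mxdot (y - x) (y - x).
Proof.
move=> fs; set v := y - x.
have := @ge_affine_derive (fun s => - f (x + s *: v))
  (fun t => - mxdot v (grad f (x + t *: v))) (- mxdot v (grad f x))
  (- (L * mxdot v v)).
rewrite scale0r addr0 scale1r /v subrKC -/v => h.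
suff : - f x - mxdot v (grad f x) + - (L * mxdot v v) / 2 <= - f y by lra.
apply: h => [t|t t0].
  have ? := is_derive_line (f_diff (x + t *: v)).
  exact: is_deriveN.
have := smooth_dot (x + t *: v) x fs.
rewrite addrAC subrr add0r !mxdotZl mxdotZr mulrCA.
rewrite ler_pM2l // !mxdotE => k; lra.
Qed.

(** A gradient step of length [1 / L] from a minimizer cannot decrease [f]. *)
Lemma grad_min xs : 0 < L -> smooth L f -> (forall x, f xs <= f x) ->
  grad f xs = 0.
Proof.
move=> L0 fs xmin; apply: mxdot_eq0.
have := smooth_upper xs (xs - L^-1 *: grad f xs) fs.
have := xmin (xs - L^-1 *: grad f xs).
rewrite [xs - _ - xs]addrAC subrr add0r !mxdotE => h1 h2; have {h1 h2} := le_trans h1 h2.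
set g := mxdot _ _ => k.
have gE : L / 2 * (L^-1 * (L^-1 * g)) = g / (2 * L) by field; rewrite gt_eqF.
have gE' : L^-1 * g = 2 * (g / (2 * L)) by field; rewrite gt_eqF.
move: k; rewrite opprK gE gE' => k.
by rewrite -(@pmulr_lle0 _ (2 * L)^-1) ?invr_gt0 ?mulr_gt0 //; lra.
Qed.

End Bounds.

(** The Baillon-Haddad theorem: minimize over [z] the gap between the two
    bounds; the minimum is at [z = y - (H y - H x) / l]. *)
Lemma cocoercive (h : 'rV[R]_p -> R) (H : 'rV[R]_p -> 'rV[R]_p) (l : R) x y :
  0 < l ->
  (forall x z, h x + mxdot (z - x) (H x) <= h z) ->
  (forall y z, h z <= h y + mxdot (z - y) (H y)
                    + l / 2 * mxdot (z - y) (z - y)) ->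
  mxdot (H x - H y) (H x - H y) <= l * mxdot (x - y) (H x - H y).
Proof.
move=> l0 lo up.
have gap a b : mxdot (H b - H a) (H b - H a) / (2 * l) <=
    h b - h a - mxdot (b - a) (H a).
  have := le_trans (lo a (b - l^-1 *: (H b - H a)))
                   (up b (b - l^-1 *: (H b - H a))).
  rewrite [b - _ - b]addrAC subrr add0r [b - _ - a]addrAC.
  have [d Hb] : exists d, H b = H a + d by exists (H b - H a); rewrite subrKC.
  rewrite Hb [H a + d]addrC addrK !mxdotE => k.
  have ek : l / 2 * (l^-1 * (l^-1 * mxdot d d)) = mxdot d d / (2 * l).
    by field; rewrite gt_eqF.
  have ek2 : l^-1 * mxdot d d = 2 * (mxdot d d / (2 * l)).
    by field; rewrite gt_eqF.
  by move: k; rewrite opprK ek ?mulrDr ek2; lra.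
have sqrC : mxdot (H y - H x) (H y - H x) = mxdot (H x - H y) (H x - H y).
  by rewrite -opprB mxdotNl mxdotNr opprK.
have sumE : mxdot (x - y) (H x - H y) =
    (h y - h x - mxdot (y - x) (H x)) + (h x - h y - mxdot (x - y) (H y)).
  by rewrite !mxdotE; ring.
rewrite -ler_pdivrMl // sumE; apply: le_trans (lerD (gap x y) (gap y x)).
by rewrite sqrC le_eqVlt; apply/orP; left; apply/eqP; field; rewrite gt_eqF.
Qed.

Section Step.
Variables (f : 'rV[R]_p -> R) (mu L : R).
Hypotheses (f_diff : forall x, differentiable f x) (mu_gt0 : 0 < mu).
Hypotheses (f_convex : strongly_convex mu f) (f_smooth : smooth L f).

Lemma strongly_convex_le_smooth : (0 < p)%N -> mu <= L.
Proof.
move=> p0; pose x : 'rV[R]_p := const_mx 1.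
have xp : 0 < mxdot x x.
  apply: mxdot_gt0; apply/eqP => /matrixP/(_ 0 (Ordinal p0)); rewrite !mxE.
  by move/eqP; rewrite oner_eq0.
have := f_convex x 0; rewrite enorm_sqr subr0 => le1.
have := le_trans le1 (_ : _ <= L * mxdot x x); rewrite ler_pM2r //; apply.
by have := smooth_dot x 0 f_smooth; rewrite subr0.
Qed.

(** Co-coercivity of the gradient of [f - mu / 2 |x|^2], which is convex and
    has an upper quadratic bound with constant [L - mu]. *)
Lemma strongly_convex_cocoercive x y : mu <= L ->
  mxdot (grad f x - grad f y) (grad f x - grad f y)
    + L * mu * mxdot (x - y) (x - y) <=
  (L + mu) * mxdot (x - y) (grad f x - grad f y).
Proof.
move=> muL; have fc := f_convex; have fs := f_smooth.
have := fc x y; rewrite enorm_sqr.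
have := smooth_sqr x y fs; have := smooth_dot x y fs.
move: muL; rewrite le_eqVlt => /orP[/eqP <-|muL].
- by move=> h1 h2 h3; have := ler_wpM2l (ltW mu_gt0) h3; lra.
- move=> _ _ _; have l0 : 0 < L - mu by lra.
  have := @cocoercive (fun x => f x - mu / 2 * mxdot x x)
    (fun x => grad f x - mu *: x) (L - mu) x y l0.
  have dE : grad f x - mu *: x - (grad f y - mu *: y) =
      (grad f x - grad f y) - mu *: (x - y).
    by rewrite scalerBr !opprB [_ - grad f y]addrC addrACA [- _ + _]addrC.
  rewrite dE.
  move: (x - y) (grad f x - grad f y) => d g h.
  have {h} : mxdot (g - mu *: d) (g - mu *: d) <=
             (L - mu) * mxdot d (g - mu *: d).
    apply: h => [a b|a b].
      have := strongly_convex_lower f_diff a b fc.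
      by rewrite !mxdotE (mxdotC b a); lra.
    have := smooth_upper f_diff a b fs.
    by rewrite !mxdotE (mxdotC b a); lra.
  by rewrite !mxdotE (mxdotC d g); lra.
Qed.

(** Expanding the square, the co-coercivity bound gains exactly the factor
    [(1 - a mu)^2] as long as [a <= 2 / (mu + L)]. *)
Lemma gradient_step_contract x y (a : R) : mu <= L -> 0 <= a ->
    a * (mu + L) <= 2 ->
  mxdot (x - y - a *: (grad f x - grad f y))
        (x - y - a *: (grad f x - grad f y)) <=
  (1 - a * mu) ^+ 2 * mxdot (x - y) (x - y).
Proof.
move=> muL a0 aL.
have := strongly_convex_cocoercive x y muL.
have := f_convex x y; rewrite enorm_sqr.
move: (x - y) (grad f x - grad f y) => d g h1 h2.
have h3 : mu ^+ 2 * mxdot d d <= mxdot g g.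
  have := mxdot_ge0 (g - mu *: d).
  rewrite !mxdotE (mxdotC d g); move: h1; rewrite (mxdotC d g) => h1 h.
  have := ler_wpM2l (ltW mu_gt0) h1; lra.
rewrite !mxdotE (mxdotC g d) in h1 h2 *.
have sL : 0 < mu + L by rewrite ltr_wpDr // (le_trans (ltW mu_gt0)).
rewrite -(ler_pM2l sL).
have k1 := ler_wpM2l a0 h2.
have k2 : 0 <= a * (2 - a * (mu + L)) * (mxdot g g - mu ^+ 2 * mxdot d d).
  by rewrite mulr_ge0 ?subr_ge0 // mulr_ge0 // subr_ge0.
lra.
Qed.

End Step.

Section Average.
Variables (n : nat) (f : 'I_n -> 'rV[R]_p -> R) (mu L : R).
Hypotheses (n_gt0 : (0 < n)%N) (f_diff : forall i x, differentiable (f i) x).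

Let favgE : favg f = n%:R^-1 \*: (\sum_i f i).
Proof. by apply/funext => x; rewrite /favg /= fct_sumE. Qed.

Lemma differentiable_favg x : differentiable (favg f) x.
Proof. by rewrite favgE; apply: differentiableZ; exact: differentiable_sum. Qed.

Lemma grad_favg x : grad (favg f) x = n%:R^-1 *: \sum_i grad (f i) x.
Proof.
apply/rowP => j; rewrite !mxE favgE deriveZ; last first.
  by apply: derivable_sum => i; exact: diff_derivable.
rewrite derive_sum; last by move=> i; exact: diff_derivable.
by rewrite summxE; congr (_ * _); apply: eq_bigr => i _; rewrite mxE.
Qed.

Lemma strongly_convex_favg :
  (forall i, strongly_convex mu (f i)) -> strongly_convex mu (favg f).
Proof.
move=> fc x y; rewrite !grad_favg -scalerBr mxdotZr ler_pdivlMl ?ltr0n //.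
rewrite -sumrB; have -> : mxdot (x - y) (\sum_i (grad (f i) x - grad (f i) y)) =
    \sum_i mxdot (x - y) (grad (f i) x - grad (f i) y).
  elim/big_ind2 : _ => [|A a B b <- <-|//]; last by rewrite mxdotDr.
  by rewrite -(scale0r (0 : 'rV[R]_p)) mxdotZr mul0r.
rewrite mulr_natl -[n in _ *+ n]card_ord -sumr_const.
by apply: ler_sum => i _; exact: fc.
Qed.

Lemma enormD (u v : 'rV[R]_p) : enorm (u + v) <= enorm u + enorm v.
Proof.
rewrite -ler_sqr ?nnegrE ?addr_ge0 ?enorm_ge0 // enorm_sqr !mxdotE (mxdotC v u).
rewrite sqrrD !enorm_sqr.
suff : mxdot u v <= enorm u * enorm v by lra.
have [neg|pos] := leP (mxdot u v) 0.
  by apply: le_trans neg _; rewrite mulr_ge0 // enorm_ge0.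
rewrite -ler_sqr ?nnegrE ?mulr_ge0 ?enorm_ge0 ?(ltW pos) //.
by rewrite exprMn !enorm_sqr mxdot_CS.
Qed.

Lemma smooth_favg : (forall i, smooth L (f i)) -> smooth L (favg f).
Proof.
move=> fs x y; rewrite !grad_favg -scalerBr -sumrB.
rewrite /enorm mxdotZl mxdotZr mulrA sqrtrM ?mulr_ge0 ?invr_ge0 ?ler0n //.
rewrite -expr2 sqrtr_sqr ger0_norm ?invr_ge0 ?ler0n // -!/(enorm _).
rewrite ler_pdivrMl ?ltr0n // mulr_natl -[n in _ *+ n]card_ord -sumr_const.
have tri : enorm (\sum_i (grad (f i) x - grad (f i) y)) <=
    \sum_i enorm (grad (f i) x - grad (f i) y).
  elim/big_ind2 : _ => [|A a B b ha hb|//].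
    by rewrite /enorm -(scale0r (0 : 'rV[R]_p)) mxdotZl mul0r sqrtr0.
  exact: le_trans (enormD _ _) (lerD ha hb).
by apply: le_trans tri _; apply: ler_sum => i _; exact: fs.
Qed.

End Average.
End Convexity.

(** * Stationary vectors of stochastic matrices *)

Section StationaryVector.
Context {R : realType} {n : nat}.

Lemma stochasticE (M : 'M[R]_n) :
  M *m ones = ones -> forall i, \sum_j M i j = 1.
Proof.
move=> /matrixP M1 i; have := M1 i 0; rewrite !mxE => <-.
by apply: eq_bigr => j _; rewrite mxE mulr1.
Qed.

Lemma stationaryE (M : 'M[R]_n) (s : 'cV[R]_n) :
  s^T *m M = s^T -> forall i, s i 0 = \sum_j s j 0 * M j i.
Proof.
move=> /matrixP sM i; have := sM 0 i; rewrite !mxE => <-.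
by apply: eq_bigr => j _; rewrite mxE.
Qed.

(** Mass is transported along positive entries. *)
Lemma stationary_connect_gt0 (M : 'M[R]_n) (u : 'I_n -> R) (i j : 'I_n) :
  (forall i j, 0 <= M i j) -> (forall i, 0 <= u i) ->
  (forall i, u i = \sum_j u j * M j i) ->
  connect [rel a b | 0 < M a b] i j -> 0 < u i -> 0 < u j.
Proof.
move=> M0 u0 uM /connectP [s + ->] {j}; elim: s i => //= k s IH i.
move=> /andP[ik /IH{}IH] ui; apply: IH; rewrite uM (bigD1 i) //=.
rewrite ltr_pwDl ?mulr_gt0 // sumr_ge0 // => j _.
by rewrite mulr_ge0.
Qed.

(** With [|s|] also invariant, [|s| + s] and [|s| - s] are nonnegative
    invariant vectors of disjoint supports; both would charge the root. *)
Lemma stationary_ge0 (M : 'M[R]_n) (s : 'cV[R]_n) (r : 'I_n) :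
  (forall i j, 0 <= M i j) -> M *m ones = ones ->
  s^T *m M = s^T -> 0 < (s^T *m ones) 0 0 -> r \in spanning_roots M ->
  (forall i, 0 <= s i 0) /\ 0 < s r 0.
Proof.
move=> M0 /stochasticE M1 /stationaryE sM s_sum rM.
have ge_abs i : `|s i 0| <= \sum_j `|s j 0| * M j i.
  rewrite {1}sM; apply: le_trans (ler_norm_sum _ _ _) _.
  by apply: ler_sum => j _; rewrite normrM (ger0_norm (M0 _ _)).
have absM i : `|s i 0| = \sum_j `|s j 0| * M j i.
  apply/eqP; rewrite eq_sym -subr_eq0; apply/eqP.
  have tot0 : \sum_i (\sum_j `|s j 0| * M j i - `|s i 0|) = 0.
    rewrite sumrB exchange_big /=; apply/eqP; rewrite subr_eq0; apply/eqP.
    by apply: eq_bigr => j _; rewrite -mulr_sumr M1 mulr1.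
  apply: (psumr_eq0P _ tot0) => // k _; by rewrite subr_ge0.
have r_of j : connect [rel a b | 0 < M a b] j r.
  have [->|jr] := eqVneq j r; first exact: connect0.
  by move: rM; rewrite inE => /forallP/(_ j)/implyP; apply.
pose u i := `|s i 0| + s i 0; pose v i := `|s i 0| - s i 0.
have u0 i : 0 <= u i by rewrite /u -lerBlDr sub0r -normrN ler_norm.
have v0 i : 0 <= v i by rewrite /v subr_ge0 ler_norm.
have uM i : u i = \sum_j u j * M j i.
  rewrite /u {1}absM {1}sM -big_split; apply: eq_bigr => j _.
  by rewrite mulrDl.
have vM i : v i = \sum_j v j * M j i.
  rewrite /v {1}absM {1}sM -sumrB; apply: eq_bigr => j _.
  by rewrite mulrBl.
have [j sj] : exists j, 0 < s j 0.
  apply/existsP; apply: contraLR s_sum; rewrite negb_exists => /forallP h.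
  rewrite -leNgt mxE sumr_le0 // => i _; rewrite !mxE mulr1 leNgt; exact: h.
have ur : 0 < u r.
  apply: (stationary_connect_gt0 M0 u0 uM (r_of j)).
  by rewrite /u ltr_pwDr.
have vr : v r = 0.
  have : u r * v r = 0 by rewrite mulrC -subr_sqr real_normK ?num_real // subrr.
  by move/eqP; rewrite mulf_eq0 gt_eqF //= => /eqP.
have v_eq0 i : v i = 0.
  apply/eqP; rewrite eq_le v0 andbT leNgt; apply/negP => vi.
  by have := stationary_connect_gt0 M0 v0 vM (r_of i) vi; rewrite vr ltxx.
have s0 i : 0 <= s i 0.
  by have /eqP := v_eq0 i; rewrite subr_eq0 => /eqP <-; rewrite normr_ge0.
by split=> //; move: ur; rewrite /u ger0_norm // -mulr2n pmulrn_lgt0.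
Qed.

End StationaryVector.

Section NetworkFacts.
Context {R : realType} {n : nat}.
Variables (E : rel 'I_n) (Rm Cm : 'M[R]_n) (net : network_assumption E Rm Cm).
Variables (sR sC : 'cV[R]_n).
Hypotheses (sR_eig : sR^T *m Rm = sR^T) (sC_eig : Cm *m sC = sC).
Hypotheses (sR_sum : (sR^T *m ones) 0 0 = n%:R).
Hypotheses (sC_sum : (sC^T *m ones) 0 0 = n%:R).

Lemma network_n_gt0 : (0 < n)%N.
Proof.
have /finset.set0Pn [i _] := net_roots net.
exact: leq_ltn_trans (leq0n i) (ltn_ord i).
Qed.

Lemma network_weights :
  [/\ forall i, 0 <= sR i 0, forall i, 0 <= sC i 0 & 0 < mxdot sR sC].
Proof.
have n0 : 0 < n%:R :> R by rewrite ltr0n network_n_gt0.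
have /finset.set0Pn [r] := net_roots net; rewrite finset.inE => /andP[rR rC].
have [sR0 sRr] : (forall i, 0 <= sR i 0) /\ 0 < sR r 0.
  apply: (@stationary_ge0 _ _ Rm) => //; try by case: net.
  by rewrite sR_sum.
have [sC0 sCr] : (forall i, 0 <= sC i 0) /\ 0 < sC r 0.
  apply: (@stationary_ge0 _ _ Cm^T) => //.
  - by move=> i j; rewrite mxE; case: net.
  - by rewrite -{2}[ones]trmxK -(net_C_stochastic net) trmx_mul trmxK.
  - by rewrite -trmx_mul sC_eig.
  - by rewrite sC_sum.
split=> //; rewrite /mxdot (bigD1 r) //= big_ord1 ltr_pwDl ?mulr_gt0 //.
by rewrite sumr_ge0 // => i _; rewrite big_ord1 mulr_ge0.
Qed.

Let Rm1 := stochasticE (net_R_stochastic net).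

Let Rm_le1 i j : Rm i j <= 1.
Proof.
rewrite -(Rm1 i) (bigD1 j) //= lerDl sumr_ge0 // => k _.
exact: (net_R_ge0 net).
Qed.

Lemma mxdot_stochastic_le : mxdot Rm Rm <= n%:R.
Proof.
rewrite -[n in n%:R]card_ord -sumr_const; apply: ler_sum => i _.
rewrite -(Rm1 i); apply: ler_sum => j _.
by rewrite ler_piMr // (net_R_ge0 net).
Qed.

Lemma mxdot_stochasticB1_le : mxdot (Rm - 1%:M) (Rm - 1%:M) <= 2 * n%:R.
Proof.
rewrite mulr_natr -[n in _ *+ n]card_ord -sumr_const; apply: ler_sum => i _.
have -> : (2 : R) = \sum_j (Rm i j + (i == j)%:R).
  rewrite big_split /= Rm1 (bigD1 i) //= eqxx big1 ?addr0 // => j.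
  by rewrite eq_sym => /negbTE ->.
apply: ler_sum => j _; rewrite !mxE.
have := Rm_le1 i j; have := net_R_ge0 net i j; case: (i == j) => r0 r1 /=.
  rewrite mulr1n; nra.
by rewrite mulr0n subr0 addr0 ler_piMr.
Qed.

Lemma ones_dot (s : 'cV[R]_n) : (s^T *m ones) 0 0 = n%:R ->
  s^T *m ones = n%:R%:M.
Proof. by move=> h; rewrite [LHS]mx11_scalar h. Qed.

Let nV : n%:R^-1 * n%:R = 1 :> R.
Proof. by rewrite mulVf // pnatr_eq0 -lt0n network_n_gt0. Qed.

Lemma PiR_ones : PiR sR *m ones = 0.
Proof.
rewrite mulmxBl mul1mx -scalemxAl -mulmxA (ones_dot sR_sum).
by rewrite mul_mx_scalar scalerA nV scale1r subrr.
Qed.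

Lemma PiC_sC : PiC sC *m sC = 0.
Proof.
have oC : ones^T *m sC = n%:R%:M :> 'M[R]_1.
  by rewrite -[LHS]trmxK trmx_mul trmxK (ones_dot sC_sum) tr_scalar_mx.
rewrite mulmxBl mul1mx -scalemxAl -mulmxA oC.
by rewrite mul_mx_scalar scalerA nV scale1r subrr.
Qed.

Lemma lazy_ones b : lazy b Rm *m ones = ones.
Proof.
rewrite mulmxDl mul_scalar_mx -scalemxAl (net_R_stochastic net) -scalerDl.
by rewrite subrK scale1r.
Qed.

Lemma lazy_sC b : lazy b Cm *m sC = sC.
Proof.
by rewrite mulmxDl mul_scalar_mx -scalemxAl sC_eig -scalerDl subrK scale1r.
Qed.

Lemma PiR_lazy b : PiR sR *m lazy b Rm *m PiR sR = PiR sR *m lazy b Rm.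
Proof.
rewrite [X in _ *m X = _]/PiR mulmxBr mulmx1 -scalemxAr !mulmxA.
by rewrite -[PiR sR *m _ *m ones]mulmxA lazy_ones PiR_ones mul0mx scaler0 subr0.
Qed.

Lemma PiC_lazy b : PiC sC *m lazy b Cm *m PiC sC = PiC sC *m lazy b Cm.
Proof.
rewrite [X in _ *m X = _]/PiC mulmxBr mulmx1 -scalemxAr !mulmxA.
by rewrite -[PiC sC *m _ *m sC]mulmxA lazy_sC PiC_sC mul0mx scaler0 subr0.
Qed.

Lemma stochasticB1_PiR : (Rm - 1%:M) *m PiR sR = Rm - 1%:M.
Proof.
rewrite /PiR mulmxBr mulmx1 -scalemxAr mulmxA mulmxBl (net_R_stochastic net).
by rewrite mul1mx subrr mul0mx scaler0 subr0.
Qed.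

Lemma consensusE {p} (X : 'M[R]_(n, p)) : X = PiR sR *m X + ones *m xbar sR X.
Proof.
by rewrite /xbar mulmxBl mul1mx -scalemxAl -scalemxAr mulmxA subrK.
Qed.

Lemma trackingE {p} (Y : 'M[R]_(n, p)) :
  Y = PiC sC *m Y + n%:R^-1 *: (sC *m (ones^T *m Y)).
Proof. by rewrite mulmxBl mul1mx -scalemxAl -mulmxA subrK. Qed.

End NetworkFacts.

(** * Borel measurability and square-integrable variables *)

Section BorelMeasurability.
Context {R : realType} {p : nat} {d : measure_display} {T : measurableType d}.
Variable W : T -> 'rV[R]_p.
Hypothesis W_meas : forall j, measurable_fun setT (fun t => W t 0 j).

(** An open set is the countable union of the boxes with rational centre and
    radius [1 / N.+1] it contains. *)
Lemma measurable_preimage_open (O : set 'rV[R]_p) :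
  open O -> measurable (W @^-1` O).
Proof.
move=> oO.
pose box (q : 'rV[rat]_p * nat) : set 'rV[R]_p :=
  [set x | forall j, `|ratr (q.1 0 j) - x 0 j| < q.2.+1%:R^-1].
pose good := [set q | box q `<=` O].
have -> : W @^-1` O = \bigcup_q (if q \in good then W @^-1` box q else set0).
  apply/seteqP; split => t /=; last first.
    by case=> q _; case: ifPn => // /set_mem; exact.
  move=> Ot; have := oO; rewrite openE => /(_ _ Ot) /=.
  move=> /nbhs_ballP [e /= e0 sub].
  have [N] : exists N : nat, 0 + N.+1%:R^-1 < e / 2 by apply: ltr_add_invr; lra.
  rewrite add0r => Ne.
  have N0 : 0 < N.+1%:R^-1 :> R by rewrite invr_gt0.
  have ex j : exists q : rat, `|ratr q - W t 0 j| < N.+1%:R^-1.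
    have [q] : exists q : rat, ratr q \in `]W t 0 j - N.+1%:R^-1, W t 0 j + N.+1%:R^-1[.
      by apply: rat_in_itvoo; move: N0; move: _%:R^-1 => u; lra.
    rewrite in_itv /= => qP; exists q; rewrite ltr_norml; move: qP.
    by move: _%:R^-1 => u; lra.
  have [q qP] := choice ex.
  exists (\row_j q j, N) => //.
  have gq : (\row_j q j, N) \in good.
    apply/mem_set => x /= xq; apply: sub; split => // i j.
    rewrite ord1 /ball /= -[_ - _](subrKA (ratr (q j))).
    apply: le_lt_trans (ler_normD _ _) _.
    have := qP j; have := xq j; rewrite mxE => h1 h2.
    by rewrite distrC; move: Ne h1 h2; move: _%:R^-1 => u; lra.
  by rewrite gq /= => j; rewrite mxE; exact: qP.
apply: countable_bigcupT_measurable; first exact: countableP.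
move=> q; case: ifP => // _.
have -> : W @^-1` box q =
    \bigcap_(j in [set: 'I_p])
      (fun t => `|ratr (q.1 0 j) - W t 0 j|) @^-1` `]-oo, q.2.+1%:R^-1[.
  apply/seteqP; split => t /=; first by move=> h j _ /=; rewrite in_itv /=; exact: h.
  by move=> h j; have := h j I; rewrite /= in_itv.
apply: fin_bigcap_measurable => //= j _; rewrite -[X in measurable X]setTI.
have : measurable_fun setT (fun t => `|ratr (q.1 0 j) - W t 0 j|).
  by apply: measurableT_comp => //; apply: measurable_funB.
by apply.
Qed.

Lemma measurable_fun_rV :
  measurable_fun setT (W : T -> g_sigma_algebraType (@open 'rV[R]_p)).
Proof.
apply: (@measurability _ _ T (g_sigma_algebraType (@open 'rV[R]_p)) setT W
  (@open 'rV[R]_p) erefl).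
move=> _ [B oB <-].
by rewrite setTI; exact: measurable_preimage_open.
Qed.

Lemma measurable_fun_continuous_rV (g : 'rV[R]_p -> R) :
  continuous g -> measurable_fun setT (fun t => g (W t)).
Proof.
move=> /continuousP cg; apply: (measurability _ (RGenOpens.measurableE R)).
move=> _ [_ [a [b ->] <-]]; rewrite setTI.
by apply: (@measurable_preimage_open (g @^-1` `]a, b[)); exact/cg/interval_open.
Qed.

End BorelMeasurability.

Section SquareIntegrable.
Context {R : realType} {d : measure_display} {T : measurableType d}.
Variable P : probability T R.
Implicit Types f g h : T -> R.

Definition integrable_rv f := P.-integrable setT (EFin \o f).

(** Square integrability, kept real-valued so that the means of quadratic forms
    can be computed in [R]. *)
Definition sqint f := measurable_fun setT f /\ integrable_rv (fun t => f t ^+ 2).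

Definition Ex f : R := \int[P]_t f t.

Lemma integrable_rv_meas f : integrable_rv f -> measurable_fun setT f.
Proof. by move=> /integrableP[/measurable_EFinP]. Qed.

Lemma integrable_rvD f g : integrable_rv f -> integrable_rv g ->
  integrable_rv (fun t => f t + g t).
Proof. by move=> fi gi; have := integrableD measurableT fi gi. Qed.

Lemma integrable_rvZ a f : integrable_rv f -> integrable_rv (fun t => a * f t).
Proof. by move=> fi; have := integrableZl measurableT a fi. Qed.

Lemma integrable_rv_cst a : integrable_rv (fun=> a).
Proof. exact: finite_measure_integrable_cst. Qed.

Lemma integrable_rv_sum (I : Type) (s : seq I) (f : I -> T -> R) :
  (forall i, integrable_rv (f i)) ->
  integrable_rv (fun t => \sum_(i <- s) f i t).
Proof.
move=> fi; elim: s => [|i s IH].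
  by under [X in integrable_rv X]funext do rewrite big_nil; exact: integrable_rv_cst.
by under [X in integrable_rv X]funext do rewrite big_cons; exact: integrable_rvD.
Qed.

Lemma le_integrable_rv f g : measurable_fun setT f -> integrable_rv g ->
  (forall t, `|f t| <= g t) -> integrable_rv f.
Proof.
move=> mf gi fg; apply: (le_integrable measurableT _ _ gi).
  exact/measurable_EFinP.
by move=> t _ /=; rewrite lee_fin (le_trans (fg t)) // ler_norm.
Qed.

Lemma ExD f g : integrable_rv f -> integrable_rv g ->
  Ex (fun t => f t + g t) = Ex f + Ex g.
Proof. exact: RintegralD. Qed.

Lemma ExZ a f : integrable_rv f -> Ex (fun t => a * f t) = a * Ex f.
Proof. by move=> fi; rewrite /Ex RintegralZl. Qed.

Lemma Ex_sum (I : Type) (s : seq I) (f : I -> T -> R) :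
  (forall i, integrable_rv (f i)) ->
  Ex (fun t => \sum_(i <- s) f i t) = \sum_(i <- s) Ex (f i).
Proof.
move=> fi; elim: s => [|i s IH].
  rewrite big_nil; under [X in Ex X]funext do rewrite big_nil.
  by rewrite /Ex Rintegral_cst // mul0r.
rewrite big_cons -IH -ExD //; last exact: integrable_rv_sum.
by congr Ex; apply/funext => t; rewrite big_cons.
Qed.

Lemma le_Ex f g : integrable_rv f -> integrable_rv g ->
  (forall t, f t <= g t) -> Ex f <= Ex g.
Proof. by move=> fi gi fg; apply: le_Rintegral. Qed.

Lemma Ex_ge0 f : (forall t, 0 <= f t) -> 0 <= Ex f.
Proof. by move=> f0; apply: Rintegral_ge0. Qed.

Lemma expectation_Ex f : integrable_rv f -> ('E_P[f] = (Ex f)%:E)%E.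
Proof.
move=> fi; rewrite unlock /Ex /Rintegral fineK //.
exact: integrable_fin_num.
Qed.

Lemma Ex_cst a : Ex (fun=> a) = a.
Proof.
apply: EFin_inj; rewrite -expectation_Ex; last exact: integrable_rv_cst.
exact: expectation_cst.
Qed.

Lemma sqint_dom f g : measurable_fun setT f -> integrable_rv g ->
  (forall t, f t ^+ 2 <= g t) -> sqint f.
Proof.
move=> mf gi fg; split => //.
apply: (le_integrable_rv (measurable_funX 2 mf) gi) => t.
by rewrite ger0_norm ?sqr_ge0.
Qed.

Lemma sqintM f g : sqint f -> sqint g -> integrable_rv (fun t => f t * g t).
Proof.
move=> [mf fi] [mg gi].
apply: (le_integrable_rv _ (integrable_rvD fi gi)).
  exact: measurable_funM.
(* [2 |f g| <= f^2 + g^2] *)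
move=> t; rewrite ler_norml; have := sqr_ge0 (f t + g t).
have := sqr_ge0 (f t - g t); have := sqr_ge0 (f t); have := sqr_ge0 (g t).
rewrite sqrrB sqrrD => *; lra.
Qed.

Lemma sqintD f g : sqint f -> sqint g -> sqint (fun t => f t + g t).
Proof.
move=> [mf fi] [mg gi].
apply: (sqint_dom (measurable_funD mf mg)
  (integrable_rvD (integrable_rvZ 2 fi) (integrable_rvZ 2 gi))) => t.
by have := sqr_ge0 (f t - g t); rewrite sqrrB sqrrD => h; lra.
Qed.

Lemma sqintZ a f : sqint f -> sqint (fun t => a * f t).
Proof.
move=> [mf fi]; split; first exact: measurable_funM.
by under [X in integrable_rv X]funext do rewrite exprMn; exact: integrable_rvZ.
Qed.

Lemma sqint_cst a : sqint (fun=> a).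
Proof. by split; [exact: measurable_cst | exact: integrable_rv_cst]. Qed.

Lemma sqint_sum (I : Type) (s : seq I) (f : I -> T -> R) :
  (forall i, sqint (f i)) -> sqint (fun t => \sum_(i <- s) f i t).
Proof.
move=> fi; elim: s => [|i s IH].
  by under [X in sqint X]funext do rewrite big_nil; exact: sqint_cst.
by under [X in sqint X]funext do rewrite big_cons; exact: sqintD.
Qed.

Lemma sqint_integrable f : sqint f -> integrable_rv f.
Proof.
move=> fi; have := sqintM (sqint_cst 1) fi.
by under [X in integrable_rv X]funext do rewrite mul1r.
Qed.

Definition msqint {m n} (A : T -> 'M[R]_(m, n)) :=
  forall i j, sqint (fun t => A t i j).

Lemma msqintD {m n} (A B : T -> 'M[R]_(m, n)) :
  msqint A -> msqint B -> msqint (fun t => A t + B t).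
Proof.
move=> Ai Bi i j; under [X in sqint X]funext do rewrite mxE.
exact: sqintD.
Qed.

Lemma msqintZ {m n} a (A : T -> 'M[R]_(m, n)) :
  msqint A -> msqint (fun t => a *: A t).
Proof.
move=> Ai i j; under [X in sqint X]funext do rewrite mxE.
exact: sqintZ.
Qed.

Lemma msqintN {m n} (A : T -> 'M[R]_(m, n)) :
  msqint A -> msqint (fun t => - A t).
Proof.
by move=> Ai; under [X in msqint X]funext do rewrite -scaleN1r; exact: msqintZ.
Qed.

Lemma msqint_mul {m n p} (M : 'M[R]_(m, n)) (A : T -> 'M[R]_(n, p)) :
  msqint A -> msqint (fun t => M *m A t).
Proof.
move=> Ai i j; under [X in sqint X]funext do rewrite mxE.
by apply: sqint_sum => k; exact: sqintZ.
Qed.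

Lemma msqint_cst {m n} (A : 'M[R]_(m, n)) : msqint (fun=> A).
Proof. by move=> i j; exact: sqint_cst. Qed.

Lemma integrable_mxdot {m n} (A B : T -> 'M[R]_(m, n)) :
  msqint A -> msqint B -> integrable_rv (fun t => mxdot (A t) (B t)).
Proof.
by move=> Ai Bi; do 2![apply: integrable_rv_sum => ?]; exact: sqintM.
Qed.

Lemma Ex_mxdot {m n} (A B : T -> 'M[R]_(m, n)) : msqint A -> msqint B ->
  Ex (fun t => mxdot (A t) (B t)) = \sum_i \sum_j Ex (fun t => A t i j * B t i j).
Proof.
move=> Ai Bi; rewrite Ex_sum; last first.
  by move=> i; apply: integrable_rv_sum => j; exact: sqintM.
by apply: eq_bigr => i _; rewrite Ex_sum // => j; exact: sqintM.
Qed.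

(** Pythagoras: the cross terms have mean zero. *)
Lemma Ex_mxdotD {m n} (A B : T -> 'M[R]_(m, n)) : msqint A -> msqint B ->
  Ex (fun t => mxdot (A t) (B t)) = 0 ->
  Ex (fun t => mxdot (A t + B t) (A t + B t)) =
  Ex (fun t => mxdot (A t) (A t)) + Ex (fun t => mxdot (B t) (B t)).
Proof.
move=> Ai Bi AB0.
have AA := integrable_mxdot Ai Ai; have BB := integrable_mxdot Bi Bi.
have AB := integrable_mxdot Ai Bi.
transitivity (Ex (fun t => (mxdot (A t) (A t) + mxdot (B t) (B t))
    + 2 * mxdot (A t) (B t))).
  congr Ex; apply/funext => t.
  by rewrite mxdotDl !mxdotDr (mxdotC (B t)); ring.
rewrite ExD ?ExD ?ExZ ?AB0 ?mulr0 ?addr0 //; first exact: integrable_rvD.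
exact: integrable_rvZ.
Qed.

Lemma Ex_le_lin2 f g1 g2 k1 k2 :
  integrable_rv f -> integrable_rv g1 -> integrable_rv g2 ->
  (forall t, f t <= k1 * g1 t + k2 * g2 t) ->
  Ex f <= k1 * Ex g1 + k2 * Ex g2.
Proof.
move=> fi i1 i2 h; have j1 := integrable_rvZ k1 i1; have j2 := integrable_rvZ k2 i2.
by rewrite -!ExZ // -ExD //; apply: le_Ex => //; exact: integrable_rvD.
Qed.

Lemma Ex_le_lin3 f g1 g2 g3 k1 k2 k3 :
  integrable_rv f -> integrable_rv g1 -> integrable_rv g2 -> integrable_rv g3 ->
  (forall t, f t <= k1 * g1 t + k2 * g2 t + k3 * g3 t) ->
  Ex f <= k1 * Ex g1 + k2 * Ex g2 + k3 * Ex g3.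
Proof.
move=> fi i1 i2 i3 h; have j1 := integrable_rvZ k1 i1.
have j2 := integrable_rvZ k2 i2; have j3 := integrable_rvZ k3 i3.
have j12 := integrable_rvD j1 j2.
by rewrite -!ExZ // -!ExD //; apply: le_Ex => //; exact: integrable_rvD.
Qed.

End SquareIntegrable.

(** * Independence of one seed from the others *)

Lemma measurable_EFin {d} {T : measurableType d} {R : realType} (f : T -> R) :
  measurable_fun setT f -> measurable_fun setT (fun t => (f t)%:E).
Proof. by move=> mf; exact/(measurable_EFinP _ f). Qed.

Section Freezing.
Context {R : realType} {d d' dZ : measure_display} {Om : measurableType d}
  {T : measurableType d'} {Z : measurableType dZ}.
Variables (P : probability Om R) (nu : probability Z R).
Variables (past : Om -> T) (seed : Om -> Z).
Hypotheses (past_meas : measurable_fun setT past)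
  (seed_meas : measurable_fun setT seed).
Hypothesis indep : forall A B, measurable A -> measurable B ->
  P (past @^-1` A `&` seed @^-1` B) = (P (past @^-1` A) * nu B)%E.

Let pair_meas : measurable_fun setT (fun om => (past om, seed om)).
Proof. exact: measurable_fun_pair. Qed.

Let pairM : {mfun Om >-> (T * Z)%type} :=
  HB.pack (fun om => (past om, seed om)) (isMeasurableFun.Build _ _ _ _ _ pair_meas).
Let pastM : {mfun Om >-> T} :=
  HB.pack past (isMeasurableFun.Build _ _ _ _ _ past_meas).

Let jointE X : measurable X ->
  (distribution P pastM \x nu)%E X = distribution P pairM X.
Proof. by apply: product_measure_unique => A B mA mB; rewrite -indep. Qed.

(** The pair (past, seed) has the product law, so that the seed can be
    integrated first, the past being frozen. *)
Lemma ge0_integral_freeze (g : T * Z -> \bar R) :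
  measurable_fun setT g -> (forall x, (0 <= g x)%E) ->
  (\int[P]_om g (past om, seed om) = \int[P]_om \int[nu]_z g (past om, z))%E.
Proof.
move=> mg g0.
have := ge0_integral_pushforward pair_meas P measurableT mg (fun x _ => g0 x).
rewrite preimage_setT => <-.
have <- := @eq_measure_integral _ _ R setT (distribution P pairM)
  (distribution P pastM \x nu)%E g (fun A mA _ => jointE mA).
rewrite fubini_tonelli1 //.
have F0 x : (0 <= fubini_F nu g x)%E by apply: integral_ge0.
have := ge0_integral_pushforward past_meas P measurableT
  (measurable_fun_fubini_tonelli_F g mg g0) (fun x _ => F0 x).
by rewrite preimage_setT.
Qed.

Lemma integral_freeze0 (g : T * Z -> \bar R) :
  measurable_fun setT g ->
  P.-integrable setT (fun om => g (past om, seed om)) ->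
  (forall t, (\int[nu]_z g (t, z) = 0)%E) ->
  (\int[P]_om g (past om, seed om) = 0)%E.
Proof.
move=> mg gi g0.
have gi' : (distribution P pastM \x nu)%E.-integrable setT g.
  apply/integrableP; split=> //.
  have -> := @eq_measure_integral _ _ R setT (distribution P pairM)
    (distribution P pastM \x nu)%E (fun x => `|g x|)%E (fun A mA _ => jointE mA).
  have mag : measurable_fun setT (fun x => `|g x|)%E by exact: measurableT_comp.
  have := ge0_integral_pushforward pair_meas P measurableT mag (fun x _ => abse_ge0 _).
  by rewrite preimage_setT => ->; case/integrableP : gi.
have := @integral_pushforward _ _ _ _ R _ pair_meas P setT g mg.
rewrite preimage_setT => /(_ gi measurableT) <-.
have <- := @eq_measure_integral _ _ R setT (distribution P pairM)
  (distribution P pastM \x nu)%E g (fun A mA _ => jointE mA).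
rewrite -integral12_prod_meas1 //.
by rewrite (eq_integral (cst 0%E)) ?integral0 // => t _; exact: g0.
Qed.

Section Compress.
Context {p : nat}.
Variables (C2 : R) (compress : 'rV[R]_p -> Z -> 'rV[R]_p).
Hypothesis compressP : compressor nu C2 compress.
Variable W : T -> 'rV[R]_p.
Hypothesis W_meas : forall j, measurable_fun setT (fun t => W t 0 j).

Let err (u : T * Z) : 'rV[R]_p := compress (W u.1) u.2 - W u.1.

Let err_meas j : measurable_fun setT (fun u => err u 0 j).
Proof.
have h : measurable_fun setT
    (fun u : T * Z => (W u.1 : g_sigma_algebraType (@open 'rV[R]_p), u.2)).
  apply: measurable_fun_pair => //.
  by apply: measurableT_comp (measurable_fun_rV W_meas) _.
have := measurableT_comp (comp_measurable compressP j) h => h1.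
under [X in measurable_fun _ X]funext do rewrite /err mxE [(- _ : 'rV[R]_p) _ _]mxE.
apply: measurable_funB; first exact: h1.
exact: (measurableT_comp (W_meas j)).
Qed.

Let sqr_meas : measurable_fun setT (fun u => mxdot (err u) (err u)).
Proof.
by do 2![apply: measurable_sum => ?]; rewrite ord1; apply: measurable_funM.
Qed.

Let sqr_le t : (\int[nu]_z (mxdot (err (t, z)) (err (t, z)))%:E <=
  (C2 * mxdot (W t) (W t))%:E)%E.
Proof.
have := comp_variance compressP (W t); rewrite unlock.
by under eq_integral do rewrite enorm_sqr; rewrite enorm_sqr.
Qed.

Let errP om := compress (W (past om)) (seed om) - W (past om).

Lemma compress_error_meas j : measurable_fun setT (fun om => errP om 0 j).
Proof. exact: (measurableT_comp (err_meas j) pair_meas). Qed.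

(** The variance bound of the compressor holds for each frozen value of [W]. *)
Lemma compress_error_integrable :
  integrable_rv P (fun om => mxdot (W (past om)) (W (past om))) ->
  integrable_rv P (fun om => mxdot (errP om) (errP om)) /\
  Ex P (fun om => mxdot (errP om) (errP om)) <=
    C2 * Ex P (fun om => mxdot (W (past om)) (W (past om))).
Proof.
move=> Wi.
have le1 : (\int[P]_om (mxdot (errP om) (errP om))%:E <=
    (C2 * Ex P (fun om => mxdot (W (past om)) (W (past om))))%:E)%E.
  have sm : measurable_fun setT (fun u => (mxdot (err u) (err u))%:E).
    exact: measurable_EFin sqr_meas.
  have s0 u : (0 <= (mxdot (err u) (err u))%:E)%E by rewrite lee_fin mxdot_ge0.
  have -> := ge0_integral_freeze sm s0.
  rewrite -ExZ // -expectation_Ex; last exact: integrable_rvZ.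
  rewrite unlock; apply: ge0_le_integral => //.
  - by move=> om _; apply: integral_ge0 => z _; rewrite lee_fin mxdot_ge0.
  - have := measurable_fun_fubini_tonelli_F (m2 := nu) _ sm s0 => h.
    exact: (measurableT_comp h past_meas).
  - exact: (measurable_EFin (integrable_rv_meas (integrable_rvZ C2 Wi))).
have ei : integrable_rv P (fun om => mxdot (errP om) (errP om)).
  apply/integrableP; split.
    exact: measurable_EFin (measurableT_comp sqr_meas pair_meas).
  apply: le_lt_trans (ltry (C2 * Ex P (fun om => mxdot (W (past om)) (W (past om))))).
  apply: le_trans le1; apply: le_of_eq.
  by apply: eq_integral => om _; rewrite gee0_abs ?lee_fin ?mxdot_ge0.
by split=> //; rewrite -lee_fin -expectation_Ex // unlock.
Qed.

(** For each frozen past the error has mean zero, by unbiasedness. *)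
Lemma compress_error_uncorrelated (V : T -> R) j :
  measurable_fun setT V -> sqint P (V \o past) ->
  integrable_rv P (fun om => mxdot (W (past om)) (W (past om))) ->
  Ex P (fun om => V (past om) * errP om 0 j) = 0.
Proof.
move=> mV Vi Wi; have [ei _] := compress_error_integrable Wi.
have esq : sqint P (fun om => errP om 0 j).
  by apply: sqint_dom ei _ => [|om]; [exact: compress_error_meas | exact: sqr_entry_le].
have Vei := sqintM Vi esq.
apply: EFin_inj; rewrite -expectation_Ex // unlock.
apply: (@integral_freeze0 (fun u => (V u.1 * err u 0 j)%:E)) => //.
  apply: measurable_EFin; apply: measurable_funM => //.
  exact: (measurableT_comp mV).
move=> t; rewrite /err /=.
have mt : measurable_fun setT (fun z => err (t, z) 0 j).
  exact: (measurableT_comp (err_meas j) (pair1_measurable t)).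
(* the variance bound makes the error integrable over the seed *)
have ni : integrable_rv nu (fun z => mxdot (err (t, z)) (err (t, z))).
  apply/integrableP; split.
    exact: measurable_EFin (measurableT_comp sqr_meas (pair1_measurable t)).
  apply: le_lt_trans (ltry _); apply: le_trans (sqr_le t).
  apply: le_of_eq.
  by apply: eq_integral => om _; rewrite gee0_abs ?lee_fin ?mxdot_ge0.
have ti : integrable_rv nu (fun z => err (t, z) 0 j).
  by apply/sqint_integrable/(sqint_dom mt ni) => z; exact: sqr_entry_le.
have e0 : Ex nu (fun z => err (t, z) 0 j) = 0.
  have := comp_unbiased compressP (W t) j.
  have -> : (fun z => compress (W t) z 0 j) = (fun z => err (t, z) 0 j + W t 0 j).
    by apply/funext => z; rewrite /err !mxE subrK.
  rewrite expectation_Ex; last by apply: integrable_rvD => //; exact: integrable_rv_cst.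
  rewrite ExD //; last exact: integrable_rv_cst.
  rewrite Ex_cst.
  by move=> -[] /eqP; rewrite -subr_eq0 addrK => /eqP.
have := expectation_Ex (integrable_rvZ (V t) ti).
by rewrite ExZ // e0 mulr0 unlock.
Qed.

End Compress.
End Freezing.

Section IndependentSeeds.
Context {R : realType} {d dZ : measure_display} {Om : measurableType d}
  {Z : measurableType dZ} {I : eqType}.
Variables (P : probability Om R) (z : I -> Om -> Z).
Hypotheses (z_meas : forall i, measurable_fun setT (z i))
  (z_indep : mutually_independent P z).

(** A pi-system generating the sigma-algebra of the seeds other than [c]. *)
Definition other_cylinders (c : I) : set (set Om) :=
  [set A | exists (s : seq I) (B : I -> set Z), [/\ c \notin s, forall i, measurable (B i)
     & A = [set om | forall i, i \in s -> B i (z i om)]]].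

Lemma other_cylinders_measurable c A : other_cylinders c A -> measurable A.
Proof.
move=> [s [B [_ mB ->]]].
have -> : [set om | forall i, i \in s -> B i (z i om)] =
    \big[setI/setT]_(i <- s) (z i @^-1` B i).
  elim: s => [|i s IH].
    by rewrite big_nil; apply/seteqP.
  rewrite big_cons -IH; apply/seteqP; split=> om /=.
    by move=> h; split=> [|j js]; apply: h; rewrite inE ?eqxx ?js ?orbT.
  by move=> [h1 h2] j; rewrite inE => /predU1P[->//|]; exact: h2.
apply: bigsetI_measurable => i _; rewrite -[X in measurable X]setTI.
exact: z_meas.
Qed.

Lemma other_cylinders_setI c : setI_closed (other_cylinders c).
Proof.
move=> _ _ [s1 [B1 [c1 m1 ->]]] [s2 [B2 [c2 m2 ->]]].
exists (s1 ++ s2), (fun i => (if i \in s1 then B1 i else setT) `&`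
  (if i \in s2 then B2 i else setT)); split.
- by rewrite mem_cat negb_or c1.
- by move=> i; apply: measurableI; case: ifP.
- apply/seteqP; split=> om /=.
    by move=> [h1 h2] i _; split; case: ifP => // ?; [exact: h1|exact: h2].
  move=> h; split=> i is_; have := h i; rewrite mem_cat is_ ?orbT => /(_ erefl)[];
  by [].
Qed.

Let past c : Om -> g_sigma_algebraType (other_cylinders c) := id.

Lemma other_seeds_sub c A : <<s other_cylinders c >> A -> measurable A.
Proof.
apply: smallest_sub A => [|A]; last exact: other_cylinders_measurable.
split => //; first by move=> A mA; rewrite setTD; exact: measurableC.
by move=> F mF; exact: bigcupT_measurable.
Qed.

Lemma measurable_past c : measurable_fun setT (past c).
Proof. by move=> _ A mA; rewrite setTI; exact: other_seeds_sub mA. Qed.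

Lemma measurable_other_seed c i : i != c ->
  measurable_fun setT (z i : g_sigma_algebraType (other_cylinders c) -> Z).
Proof.
move=> ic _ B mB; rewrite setTI; apply: sub_sigma_algebra.
exists [:: i], (fun=> B); split=> //; first by rewrite inE eq_sym.
apply/seteqP; split=> om /=; first by move=> h j; rewrite inE => /eqP ->.
by apply; rewrite inE.
Qed.

(** Both sides are measures in [A]; they agree on the cylinders, which are
    stable under intersection. *)
Lemma independent_of_past c A B :
  measurable (A : set (g_sigma_algebraType (other_cylinders c))) ->
  measurable B ->
  P (past c @^-1` A `&` z c @^-1` B) = (P (past c @^-1` A) * P (z c @^-1` B))%E.
Proof.
move=> mA mB.
have mzB : measurable (z c @^-1` B).
  by rewrite -[X in measurable X]setTI; exact: z_meas.
have r0 : 0 <= fine (P (z c @^-1` B)) by rewrite fine_ge0.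
have fE : P (z c @^-1` B) = (fine (P (z c @^-1` B)))%:E.
  by rewrite fineK // fin_num_measure.
suff : mrestr P mzB A = mscale (NngNum r0) P A.
  by rewrite /mrestr /mscale /= -fE muleC.
apply: (@g_sigma_algebra_measure_unique _ _ _ (other_cylinders c) _ (fun=> setT)) => //.
- exact: other_cylinders_measurable.
- by move=> _; exists [::], (fun=> setT); split=> //; apply/seteqP.
- by rewrite bigcup_const.
- exact: other_cylinders_setI.
- move=> _ [s [C [cs mC ->]]].
  rewrite /mrestr /mscale [X in _ = (X * _)%E](_ : _ = P (z c @^-1` B));
    last exact: esym fE.
  pose C' i := if i == c then B else C i.
  have mC' i : measurable (C' i) by rewrite /C'; case: ifP.
  have cE i : i \in s -> C' i = C i.
    by rewrite /C'; case: eqP => // -> h; rewrite h in cs.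
  have us : uniq (c :: undup s) by rewrite /= mem_undup cs undup_uniq.
  have := z_indep us mC'; rewrite big_cons.
  have -> : C' c = B by rewrite /C' eqxx.
  rewrite -(z_indep (undup_uniq s) mC').
  have -> : [set om | forall i, i \in undup s -> C' i (z i om)] =
      [set om | forall i, i \in s -> C i (z i om)].
    apply/seteqP; split=> om /= h i.
      by move=> is_; rewrite -cE //; apply: h; rewrite mem_undup.
    by rewrite mem_undup => is_; rewrite cE //; exact: h.
  move=> <-; congr (P _); apply/seteqP; split=> om /=.
    move=> [h hB] i; rewrite inE mem_undup => /predU1P[->|is_].
      by rewrite /C' eqxx.
    by rewrite cE //; exact: h.
  move=> h; split.
    by move=> i is_; rewrite -cE //; apply: h; rewrite inE mem_undup is_ orbT.
  by have := h c; rewrite /C' eqxx inE eqxx; apply.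
- move=> _; rewrite /mrestr /=.
  by rewrite -ge0_fin_numE // fin_num_measure //; exact: measurableI.
Qed.

End IndependentSeeds.

(** * Compression errors and measurability of the iterates *)

Section MeasurableMatrix.
Context {R : realType} {d : measure_display} {T : measurableType d}.

Definition mmeas {m n} (A : T -> 'M[R]_(m, n)) :=
  forall i j, measurable_fun setT (fun t => A t i j).

Lemma mmeasD {m n} (A B : T -> 'M[R]_(m, n)) :
  mmeas A -> mmeas B -> mmeas (fun t => A t + B t).
Proof.
move=> mA mB i j; under [X in measurable_fun _ X]funext do rewrite mxE.
exact: measurable_funD.
Qed.

Lemma mmeasZ {m n} a (A : T -> 'M[R]_(m, n)) :
  mmeas A -> mmeas (fun t => a *: A t).
Proof.
move=> mA i j; under [X in measurable_fun _ X]funext do rewrite mxE.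
exact: measurable_funM.
Qed.

Lemma mmeasN {m n} (A : T -> 'M[R]_(m, n)) : mmeas A -> mmeas (fun t => - A t).
Proof.
by move=> mA; under [X in mmeas X]funext do rewrite -scaleN1r; exact: mmeasZ.
Qed.

Lemma mmeas_mul {m n p} (M : 'M[R]_(m, n)) (A : T -> 'M[R]_(n, p)) :
  mmeas A -> mmeas (fun t => M *m A t).
Proof.
move=> mA i j; under [X in measurable_fun _ X]funext do rewrite mxE.
by apply: measurable_sum => k; exact: measurable_funM.
Qed.

Lemma mmeas_cst {m n} (A : 'M[R]_(m, n)) : mmeas (fun=> A).
Proof. by move=> i j; exact: measurable_cst. Qed.

Lemma mmeas_row {m n} (A : T -> 'M[R]_(m, n)) i :
  mmeas A -> forall j, measurable_fun setT (fun t => row i (A t) 0 j).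
Proof.
by move=> mA j; under [X in measurable_fun _ X]funext do rewrite mxE; exact: mA.
Qed.

Lemma mmeas_compress {p n} {dZ} {Z : measurableType dZ} (nu : probability Z R)
    (C2 : R) (compress : 'rV[R]_p -> Z -> 'rV[R]_p)
    (z : 'I_n -> T -> Z) (A : T -> 'M[R]_(n, p)) :
  compressor nu C2 compress ->
  (forall i, measurable_fun setT (z i)) -> mmeas A ->
  mmeas (fun t => compress_mx compress (fun i => z i t) (A t)).
Proof.
move=> cP mz mA i j; under [X in measurable_fun _ X]funext do rewrite mxE.
have h : measurable_fun setT
    (fun t : T => (row i (A t) : g_sigma_algebraType (@open 'rV[R]_p), z i t)).
  by apply: measurable_fun_pair => //; exact: measurable_fun_rV (mmeas_row i mA).
exact: (measurableT_comp (comp_measurable cP j) h).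
Qed.

Lemma mmeas_gradF {n p} (L : R) (f : 'I_n -> 'rV[R]_p -> R)
    (A : T -> 'M[R]_(n, p)) :
  (forall i, smooth L (f i)) -> mmeas A -> mmeas (fun t => gradF f (A t)).
Proof.
move=> fs mA i j; under [X in measurable_fun _ X]funext do rewrite mxE.
apply: (@measurable_fun_continuous_rV R p d T (fun t => row i (A t))
  (mmeas_row i mA) (fun x => grad (f i) x 0 j)).
move=> x; apply/cvgrPdist_lt => [|e e0]; first exact: nbhs_filter.
(* [|.|^2 <= p max^2] compares the two norms; [t < (1 + t)^2] then absorbs
   the constant [t = L^2 p] *)
pose t := L ^+ 2 * p%:R; have t0 : 0 <= t by rewrite mulr_ge0 // sqr_ge0.
pose r := e / (1 + t); have r0 : 0 < r by rewrite divr_gt0 //; lra.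
apply: (iffRL (nbhs_ballP x _)); exists r => //= y [_ xy].
rewrite -(@ltr_pXn2r _ 2) ?nnegrE ?normr_ge0 ?(ltW e0) // real_normK ?num_real //.
have := sqr_entry_le (grad (f i) x - grad (f i) y) 0 j; rewrite !mxE => h.
apply: le_lt_trans h _; apply: le_lt_trans (smooth_sqr x y (fs i)) _.
have le1 : mxdot (x - y) (x - y) <= p%:R * r ^+ 2.
  rewrite /mxdot big_ord1 mulr_natl -[p in _ *+ p]card_ord -sumr_const.
  apply: ler_sum => k _; rewrite -expr2 -real_normK ?num_real //.
  rewrite lerXn2r ?nnegrE ?normr_ge0 ?(ltW r0) //.
  by have := xy 0 k; rewrite /ball /= !mxE => /ltW.
apply: le_lt_trans (ler_wpM2l (sqr_ge0 L) le1) _.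
have -> : e = r * (1 + t) by rewrite /r divfK // gt_eqF //; lra.
have -> : L ^+ 2 * (p%:R * r ^+ 2) = t * r ^+ 2 by rewrite mulrA.
have -> : (r * (1 + t)) ^+ 2 = (1 + t) ^+ 2 * r ^+ 2 by rewrite exprMn mulrC.
by rewrite ltr_pM2r ?exprn_gt0 //; nra.
Qed.

End MeasurableMatrix.

Section CompressionError.
Context {R : realType} {n p : nat} {d dZ : measure_display}
  {Om : measurableType d} {Z : measurableType dZ}.
Variables (P : probability Om R) (nu : probability Z R) (C2 : R)
  (compress : 'rV[R]_p -> Z -> 'rV[R]_p) (seed : call n -> {RV P >-> Z}).
Hypotheses (compressP : compressor nu C2 compress)
  (seedP : iid_seeds nu seed).

Let sd (c : call n) : Om -> Z := seed c.

(** Measurability for the sigma-algebra of the seeds other than that of [c]: the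
    matrix is computed without the outcome of the call [c]. *)
Definition blind_to (c : call n) {m q} (A : Om -> 'M[R]_(m, q)) :=
  @mmeas R _ (g_sigma_algebraType (other_cylinders sd c)) m q A.

Let sd_meas c : measurable_fun setT (sd c).
Proof. by []. Qed.

Let indep c A B :
  measurable (A : set (g_sigma_algebraType (other_cylinders sd c))) ->
  measurable B -> P (A `&` sd c @^-1` B) = (P A * nu B)%E.
Proof.
case: seedP => h1 h2 mA mB; rewrite -(h2 c B mB).
exact: (independent_of_past sd_meas h1 mA mB).
Qed.

Variables (c : 'I_n -> call n) (W : Om -> 'M[R]_(n, p)).
Hypotheses (W_blind : forall i, blind_to (c i) W) (W_sq : msqint P W).

Definition compress_error om :=
  compress_mx compress (fun i => seed (c i) om) (W om) - W om.

Let err_row i om : row i (compress_error om) =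
  compress (row i (W om)) (sd (c i) om) - row i (W om).
Proof. by rewrite raddfB /=; congr (_ - _); apply/rowP => j; rewrite !mxE. Qed.

Let row_sq i : integrable_rv P (fun om => mxdot (row i (W om)) (row i (W om))).
Proof.
by apply: integrable_mxdot => a b; under [X in sqint _ X]funext do rewrite mxE.
Qed.

Let W_row i : forall j, measurable_fun setT
  (fun t : g_sigma_algebraType (other_cylinders sd (c i)) => row i (W t) 0 j).
Proof. exact: mmeas_row (@W_blind i). Qed.

Let rowP i := compress_error_integrable
  (measurable_past sd_meas (c := c i)) (sd_meas (c i)) (@indep (c i)) compressP
  (@W_row i) (row_sq i).

Lemma compress_error_sq : msqint P compress_error.
Proof.
move=> i j.
have -> : (fun om => compress_error om i j) =
    (fun om => (compress (row i (W om)) (sd (c i) om) - row i (W om)) 0 j).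
  by apply/funext => om; rewrite -err_row [RHS]mxE.
have [ei _] := rowP i; apply: sqint_dom ei _ => [|om]; last exact: sqr_entry_le.
exact: (compress_error_meas (measurable_past sd_meas (c := c i)) (sd_meas (c i))
  compressP (@W_row i)).
Qed.

Lemma compress_error_le :
  Ex P (fun om => mxdot (compress_error om) (compress_error om)) <=
  C2 * Ex P (fun om => mxdot (W om) (W om)).
Proof.
have rows (A : Om -> 'M[R]_(n, p)) : msqint P A ->
    Ex P (fun om => mxdot (A om) (A om)) =
    \sum_i Ex P (fun om => mxdot (row i (A om)) (row i (A om))).
  move=> Asq; rewrite -Ex_sum; first by congr Ex; apply/funext => om; rewrite mxdot_rows.
  move=> i; apply: integrable_mxdot => a b;
  by under [X in sqint _ X]funext do rewrite mxE.
rewrite (rows _ compress_error_sq) (rows _ W_sq) mulr_sumr.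
apply: ler_sum => i _; have [_ le1] := rowP i.
apply: le_trans le1; apply: le_of_eq.
by congr Ex; apply/funext => om; rewrite err_row.
Qed.

Lemma compress_error_orth {m} (A : Om -> 'M[R]_(m, p)) (M : 'M[R]_(m, n)) :
  (forall i, blind_to (c i) A) -> msqint P A ->
  Ex P (fun om => mxdot (A om) (M *m compress_error om)) = 0.
Proof.
move=> mA Asq.
(* moving [M] to the other side reduces to single entries of the error *)
have adj (B : 'M[R]_(m, p)) (D : 'M[R]_(n, p)) : mxdot B (M *m D) = mxdot (M^T *m B) D.
  rewrite /mxdot exchange_big [RHS]exchange_big /=; apply: eq_bigr => j _.
  under eq_bigr do rewrite mxE mulr_sumr.
  rewrite exchange_big /=; apply: eq_bigr => k _.
  by rewrite mxE mulr_suml; apply: eq_bigr => i _; rewrite mxE; ring.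
under [X in Ex _ X]funext do rewrite adj.
rewrite Ex_mxdot; [|exact: msqint_mul|exact: compress_error_sq].
rewrite big1 // => i _; rewrite big1 // => j _.
have := @compress_error_uncorrelated _ _ _ _ _ _ _ P nu _ _
  (measurable_past sd_meas (c := c i)) (sd_meas (c i)) (@indep (c i)) _ _ _
  compressP _ (@W_row i) (fun om => (M^T *m A om) i j) j.
move=> h; rewrite -[RHS](h _ _ (row_sq i)).
- by congr Ex; apply/funext => om; rewrite /= -err_row [in RHS]/row [X in _ = _ * X]mxE.
- exact: mmeas_mul (mA i) i j.
- exact: msqint_mul.
Qed.

(** The cross term vanishes, since each row of the error has mean zero given the
    seeds of the other calls. *)
Lemma noisy_square_le {m} (A : Om -> 'M[R]_(m, p)) (M : 'M[R]_(m, n)) (K : R) :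
  0 <= K -> (forall i, blind_to (c i) A) -> msqint P A ->
  (forall e : 'M[R]_(n, p), mxdot (M *m e) (M *m e) <= K * mxdot e e) ->
  Ex P (fun om => mxdot (A om + M *m compress_error om)
                        (A om + M *m compress_error om)) <=
  Ex P (fun om => mxdot (A om) (A om))
    + K * (C2 * Ex P (fun om => mxdot (W om) (W om))).
Proof.
move=> K0 mA Asq MK; have esq := compress_error_sq.
rewrite Ex_mxdotD //; [|exact: msqint_mul|exact: compress_error_orth].
rewrite lerD2l; apply: le_trans (ler_wpM2l K0 compress_error_le).
rewrite -ExZ; last exact: integrable_mxdot.
apply: le_Ex => [||om]; last exact: MK.
  by apply: integrable_mxdot; exact: msqint_mul.
by apply: integrable_rvZ; exact: integrable_mxdot.
Qed.

End CompressionError.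

(** The measurable structure on the carrier is left arbitrary: with that of [Om]
    the lemmas give random variables, with that generated by all the seeds but
    one they give independence from the remaining seed. *)
Section MeasurableIterates.
Context {R : realType} {n p : nat} {d dZ : measure_display}
  {T : measurableType d} {Z : measurableType dZ}.
Variables (nu : probability Z R) (C2 L : R)
  (compress : 'rV[R]_p -> Z -> 'rV[R]_p) (f : 'I_n -> 'rV[R]_p -> R)
  (Rm Cm : 'M[R]_n) (seed : call n -> T -> Z) (alpha : 'rV[R]_n)
  (beta gamma eta : R) (X0 : 'M[R]_(n, p))
  (X Y U Xh Yh : nat -> T -> 'M[R]_(n, p)).
Hypotheses (compressP : compressor nu C2 compress)
  (f_smooth : forall i, smooth L (f i)).
Hypothesis cpp :
  is_CPP f Rm Cm compress seed alpha beta gamma eta X0 X Y U Xh Yh.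

Lemma CPP_measurable_Xh k : (forall i, measurable_fun setT (seed (inl (k, i)))) ->
  mmeas (X k) -> mmeas (U k) -> mmeas (Xh k).
Proof.
move=> sm mX mU; rewrite (_ : Xh k = fun t => U k t +
  compress_mx compress (fun i => seed (inl (k, i)) t) (X k t - U k t)).
  apply: mmeasD => //; apply: (mmeas_compress compressP sm).
  by apply: mmeasD => //; exact: mmeasN.
by apply/funext => t; exact: (cpp_Xh cpp).
Qed.

Lemma CPP_measurable_X k : (forall i, measurable_fun setT (seed (inl (k, i)))) ->
  mmeas (X k) -> mmeas (U k) -> mmeas (Y k) -> mmeas (X k.+1).
Proof.
move=> sm mX mU mY; rewrite (_ : X k.+1 = fun t => (1 - beta) *: X k t
   + beta *: (Rm *m Xh k t) - diag_mx alpha *m Y k t).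
  apply: mmeasD; last by apply/mmeasN/mmeas_mul.
  apply: mmeasD; apply: mmeasZ => //; apply: mmeas_mul.
  exact: CPP_measurable_Xh.
by apply/funext => t; exact: (cpp_X cpp).
Qed.

Lemma CPP_measurable k :
  (forall j i, (j < k)%N -> measurable_fun setT (seed (inl (j, i)))
    /\ measurable_fun setT (seed (inr (j, i)))) ->
  [/\ mmeas (X k), mmeas (Y k) & mmeas (U k)].
Proof.
elim: k => [_|k IH sm].
  have -> : X 0%N = fun=> X0 by apply/funext => t; exact: (cpp_X0 cpp).
  have -> : Y 0%N = fun=> gradF f X0 by apply/funext => t; exact: (cpp_Y0 cpp).
  have -> : U 0%N = fun=> 0 by apply/funext => t; exact: (cpp_U0 cpp).
  by split; exact: mmeas_cst.
have [|mX mY mU] := IH; first by move=> j i jk; apply: sm; exact: ltnW.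
have smX i : measurable_fun setT (seed (inl (k, i))) by have [] := sm k i.
have smY i : measurable_fun setT (seed (inr (k, i))) by have [] := sm k i.
have mX1 := CPP_measurable_X smX mX mU mY.
have mXh := CPP_measurable_Xh smX mX mU.
split=> //.
  rewrite (_ : Y k.+1 = fun t => Y k t + gamma *: ((Cm - 1%:M) *m
      compress_mx compress (fun i => seed (inr (k, i)) t) (Y k t))
      + gradF f (X k.+1 t) - gradF f (X k t)); last first.
    by apply/funext => t; rewrite (cpp_Y cpp) (cpp_Yh cpp).
  apply: mmeasD; last by apply: mmeasN; exact: mmeas_gradF.
  apply: mmeasD; last exact: mmeas_gradF.
  apply: mmeasD => //; apply: mmeasZ; apply: mmeas_mul.
  exact: (mmeas_compress compressP smY).
rewrite (_ : U k.+1 = fun t => (1 - eta) *: U k t + eta *: Xh k t); last first.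
  by apply/funext => t; exact: (cpp_U cpp).
by apply: mmeasD; exact: mmeasZ.
Qed.

End MeasurableIterates.

(** * The recursion for the mean-square errors *)

Section StackedGradients.
Context {R : realType} {n p : nat}.
Variables (f : 'I_n -> 'rV[R]_p -> R) (L : R).
Hypothesis f_smooth : forall i, smooth L (f i).

Lemma row_gradF (X : 'M[R]_(n, p)) i : row i (gradF f X) = grad (f i) (row i X).
Proof. by apply/rowP => j; rewrite !mxE. Qed.

Lemma gradF_smooth (X X' : 'M[R]_(n, p)) :
  mxdot (gradF f X - gradF f X') (gradF f X - gradF f X') <=
  L ^+ 2 * mxdot (X - X') (X - X').
Proof.
rewrite !(mxdot_rows (_ - _)) mulr_sumr; apply: ler_sum => i _.
by rewrite !raddfB /= !row_gradF; exact: smooth_sqr.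
Qed.

Lemma ones_mulE (A : 'M[R]_(n, p)) : ones^T *m A = \sum_i row i A.
Proof.
apply/rowP => j; rewrite mxE summxE; apply: eq_bigr => i _.
by rewrite !mxE mul1r.
Qed.

Lemma ones_mul_le (A : 'M[R]_(n, p)) :
  mxdot (ones^T *m A) (ones^T *m A) <= n%:R * mxdot A A.
Proof.
apply: le_trans (mxdot_mulmx_le _ _) _; rewrite mxdot_tr ler_wpM2r ?mxdot_ge0 //.
rewrite /mxdot -[n in leRHS]card_ord -sumr_const; apply: ler_sum => i _.
by rewrite big_ord1 !mxE mulr1.
Qed.

Lemma row_ones_mul (x : 'rV[R]_p) i : row i ((ones : 'cV[R]_n) *m x) = x.
Proof. by apply/rowP => j; rewrite !mxE big_ord1 mxE mul1r. Qed.

Lemma sum_grad_consensus (x : 'rV[R]_p) : (0 < n)%N ->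
  (forall i x, differentiable (f i) x) ->
  ones^T *m gradF f (ones *m x) = n%:R *: grad (favg f) x.
Proof.
move=> n0 df; rewrite grad_favg // scalerA divff ?scale1r ?pnatr_eq0 -?lt0n //.
by rewrite ones_mulE; apply: eq_bigr => i _; rewrite row_gradF row_ones_mul.
Qed.

End StackedGradients.

Section WeightedNorm.
Context {R : realType} {n p : nat}.
Variables (M Pi T : 'M[R]_n) (theta delta : R).
Hypothesis nd : norm_data M Pi T theta delta.
Implicit Type X : 'M[R]_(n, p).

Lemma norm_data_ge X : mxdot X X <= mxdot (T *m X) (T *m X).
Proof.
rewrite !(mxdot_cols _ _) ler_sum // => j _; rewrite col_mul -!enorm_sqr.
have /andP[h _] := nd_equiv nd (col j X).
by rewrite lerXn2r // nnegrE enorm_ge0.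
Qed.

Lemma norm_data_le X : mxdot (T *m X) (T *m X) <= delta ^+ 2 * mxdot X X.
Proof.
rewrite !(mxdot_cols _ _) mulr_sumr ler_sum // => j _.
rewrite col_mul -!enorm_sqr -exprMn.
have /andP[_ h] := nd_equiv nd (col j X).
by rewrite lerXn2r // nnegrE ?enorm_ge0 // (le_trans _ h) // enorm_ge0.
Qed.

Lemma norm_data_op b X (A : 'M[R]_n) : opnorm (wnorm T) A <= b ->
  mxdot (T *m (A *m X)) (T *m (A *m X)) <= b ^+ 2 * mxdot (T *m X) (T *m X).
Proof. exact: mxdot_opnorm_le (nd_unit nd). Qed.

Lemma norm_data_Pi X :
  mxdot (T *m (Pi *m X)) (T *m (Pi *m X)) <= mxdot (T *m X) (T *m X).
Proof.
have := @norm_data_op 1 X Pi; rewrite expr1n mul1r; apply.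
by rewrite (nd_Pi nd).
Qed.

Lemma norm_data_delta_gt0 : (0 < n)%N -> 0 < delta.
Proof.
move=> n_gt0; pose x : 'cV[R]_n := const_mx 1.
have x0 : 0 < enorm x.
  rewrite sqrtr_gt0 mxdot_gt0 //.
  apply/eqP => /matrixP/(_ (Ordinal n_gt0) 0); rewrite !mxE => /eqP.
  by rewrite oner_eq0.
have /andP[h1 h2] := nd_equiv nd x.
by rewrite -(pmulr_lgt0 _ x0) (lt_le_trans x0) // (le_trans h1).
Qed.

End WeightedNorm.

(** The constants [c1], [c2], [c3] as functions of [a = alpha_hat] and
    [b = alpha_bar], which are comparable: [a / w <= b <= a t / m]. *)
Lemma average_step_arith {R : realFieldType}
    (mu w a b m s t L2 e S V G B M : R) :
  0 < mu -> 0 < w -> 0 <= a -> 0 < b -> 0 < m -> 0 <= s ->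
  0 <= L2 -> 0 <= e -> 0 <= S -> 0 <= V ->
  b <= a * t / m -> a <= w * b ->
  G <= L2 / m * S -> B <= m^-1 ^+ 2 * (a ^+ 2 * s) * V ->
  M <= 2 * (b ^+ 2 * G) + 2 * B ->
  (1 - mu * b) * e + M / (mu * b) <=
  (1 - mu / w * a) * e + 2 * t * L2 / (mu * m ^+ 2) * a * S
    + 2 * s * w / (mu * m ^+ 2) * a * V.
Proof.
move=> mu0 w0 a0 b0 m0 s0 L0 e0 S0 V0 bt aw GS BV Mle.
have mb : 0 < mu * b by rewrite mulr_gt0.
have h1 : (1 - mu * b) * e <= (1 - mu / w * a) * e.
  rewrite ler_wpM2r // lerD2l lerN2 -mulrA ler_pM2l //.
  by rewrite ler_pdivrMl.
have h2 : b ^+ 2 * G / (mu * b) <= t * L2 / (mu * m ^+ 2) * a * S.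
  have -> : b ^+ 2 * G / (mu * b) = b * G / mu by field; rewrite !gt_eqF.
  have -> : t * L2 / (mu * m ^+ 2) * a * S = (a * t / m) * (L2 / m * S) / mu.
    by field; rewrite !gt_eqF.
  rewrite ler_pM2r ?invr_gt0 //.
  apply: le_trans (ler_wpM2l (ltW b0) GS) _.
  by rewrite ler_wpM2r // mulr_ge0 // divr_ge0 // ltW.
have h3 : B / (mu * b) <= s * w / (mu * m ^+ 2) * a * V.
  rewrite ler_pdivrMr //; apply: le_trans BV _.
  have -> : s * w / (mu * m ^+ 2) * a * V * (mu * b) =
      m^-1 ^+ 2 * (a * (w * b) * s) * V by field; rewrite !gt_eqF.
  rewrite ler_wpM2r // ler_wpM2l ?sqr_ge0 // ler_wpM2r // expr2.
  exact: ler_wpM2l.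
have h4 : M / (mu * b) <= (2 * (b ^+ 2 * G) + 2 * B) / (mu * b).
  by rewrite ler_pM2r ?invr_gt0.
by move: h4; rewrite mulrDl -!(mulrA 2) => h4; lra.
Qed.

Section Recursion.
Context {R : realType} {n p : nat}.
Variables (mu L : R) (f : 'I_n -> 'rV[R]_p -> R) (xs : 'rV[R]_p).
Hypotheses (mu_gt0 : 0 < mu) (muL : mu <= L).
Hypothesis f_diff : forall i x, differentiable (f i) x.
Hypothesis f_convex : forall i, strongly_convex mu (f i).
Hypothesis f_smooth : forall i, smooth L (f i).
Hypothesis xs_min : forall x, favg f xs <= favg f x.
Variables (E : rel 'I_n) (Rm Cm : 'M[R]_n) (net : network_assumption E Rm Cm).
Variables (sR sC : 'cV[R]_n).
Hypotheses (sR_eig : sR^T *m Rm = sR^T) (sC_eig : Cm *m sC = sC).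
Hypotheses (sR_sum : (sR^T *m ones) 0 0 = n%:R).
Hypotheses (sC_sum : (sC^T *m ones) 0 0 = n%:R).
Variables (TR TC : 'M[R]_n) (thetaR thetaC deltaR deltaC : R).
Hypothesis normR : norm_data Rm (PiR sR) TR thetaR deltaR.
Hypothesis normC : norm_data Cm (PiC sC) TC thetaC deltaC.
Variables (C2 w : R) (w_gt0 : 0 < w).
Variables (alpha : 'rV[R]_n) (beta gamma eta : R).
Hypotheses (beta01 : 0 < beta <= 1) (gamma01 : 0 < gamma <= 1)
  (eta01 : 0 < eta <= 1).
Hypothesis alpha_ge0 : forall i, 0 <= alpha 0 i.
Local Notation ah := (alpha_hat alpha).
Local Notation ab := (alpha_bar sR sC alpha).
Hypotheses (ab_gt0 : 0 < ab) (ah_ab : ah / ab <= w)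
  (ah_le : ah * (mu + L) * mxdot sR sC <= 2 * n%:R).

Local Notation c := (cpp_coefs sR sC mu L C2 w thetaR thetaC deltaR deltaC).

Let n_gt0 : (0 < n)%N := network_n_gt0 net.
Let n0 : 0 < n%:R :> R. Proof. by rewrite ltr0n. Qed.

Let alpha_bounds i : 0 <= alpha 0 i <= ah.
Proof. by rewrite alpha_ge0 /alpha_hat le_bigmax. Qed.

Let ah_ge0 : 0 <= ah.
Proof. by have := alpha_bounds (Ordinal n_gt0) => /andP[]; exact: le_trans. Qed.

(** The weights [sR] and [sC] are nonnegative. *)
Lemma alpha_bar_le : ab <= ah * mxdot sR sC / n%:R.
Proof.
have [sR0 sC0 _] := network_weights net sR_eig sC_eig sR_sum sC_sum.
rewrite /alpha_bar [leRHS]mulrC ler_pM2l ?invr_gt0 // mxE /mxdot mulr_sumr.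
apply: ler_sum => i _; rewrite big_ord1 mul_mx_diag !mxE.
have /andP[a0 a1] := alpha_bounds i.
by rewrite mulrAC [leLHS]mulrC ler_wpM2r // mulr_ge0.
Qed.

Let step_le : ab * (mu + L) <= 2.
Proof.
have mL : 0 <= mu + L by have := mu_gt0; have := muL; lra.
apply: le_trans (ler_wpM2r mL alpha_bar_le) _.
by rewrite mulrAC ler_pdivrMr // mulrAC.
Qed.

Let mu_ab : 0 < mu * ab <= 1.
Proof.
apply/andP; split; first exact: mulr_gt0.
by have := step_le; have := ler_wpM2l (ltW ab_gt0) muL; lra.
Qed.

Let c_ah : ah <= w * ab. Proof. by rewrite -ler_pdivrMr. Qed.

Let grad_xs : grad (favg f) xs = 0.
Proof.
apply: (@grad_min _ _ (favg f) L) => //; first exact: differentiable_favg.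
- by apply: lt_le_trans mu_gt0 muL.
- exact: smooth_favg.
Qed.

(** Gradient tracking: the columns of [Y] have the sums of the columns of the
    stacked gradients. *)
Definition tracked (X Y : 'M[R]_(n, p)) := ones^T *m Y = ones^T *m gradF f X.

(** Gap between the average of the local gradients and the gradient at the
    average. *)
Let gap (X : 'M[R]_(n, p)) : 'rV[R]_p :=
  n%:R^-1 *: (ones^T *m (gradF f X - gradF f (ones *m xbar sR X))).

Let avg_grad X : n%:R^-1 *: (ones^T *m gradF f X) =
  grad (favg f) (xbar sR X) + gap X.
Proof.
rewrite /gap mulmxBr sum_grad_consensus // scalerBr scalerA mulVf ?gt_eqF //.
by rewrite scale1r subrKC.
Qed.

Let gap_le X : mxdot (gap X) (gap X) <=
  L ^+ 2 / n%:R * mxdot (TR *m (PiR sR *m X)) (TR *m (PiR sR *m X)).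
Proof.
rewrite /gap mxdotZl mxdotZr mulrA -expr2.
apply: le_trans (ler_wpM2l (sqr_ge0 _) (ones_mul_le _)) _.
rewrite mulrA.
have -> : n%:R^-1 ^+ 2 * n%:R = n%:R^-1 :> R by field; rewrite gt_eqF.
rewrite -mulrA mulrCA ler_pM2l ?invr_gt0 //.
apply: le_trans (gradF_smooth f_smooth _ _) _.
have -> : X - ones *m xbar sR X = PiR sR *m X.
  by rewrite {1}(consensusE sR X) addrK.
rewrite ler_wpM2l ?sqr_ge0 //.
exact: (norm_data_ge normR).
Qed.

Local Notation errR X :=
  (mxdot (TR *m (PiR sR *m X)) (TR *m (PiR sR *m X))).
Local Notation errC Y :=
  (mxdot (TC *m (PiC sC *m Y)) (TC *m (PiC sC *m Y))).

Let scaleY_le (Y : 'M[R]_(n, p)) :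
  mxdot (diag_mx alpha *m Y) (diag_mx alpha *m Y) <= ah ^+ 2 * mxdot Y Y.
Proof. exact: mxdot_scale_rows_le. Qed.

(** One inexact gradient step: the decrease is that of the exact step for
    [favg f] with stepsize [alpha_bar]; the two perturbations are the gap
    between the gradients and the consensus error of [Y]. *)
Lemma average_step (X Y : 'M[R]_(n, p)) z : tracked X Y ->
  z = xbar sR X - xs - n%:R^-1 *: (sR^T *m (diag_mx alpha *m Y)) ->
  mxdot z z <= (1 - c1 c * ah) * mxdot (xbar sR X - xs) (xbar sR X - xs)
    + c2 c * ah * errR X + c3 c * ah * errC Y.
Proof.
move=> XY zdef.
pose b := n%:R^-1 *: (sR^T *m (diag_mx alpha *m (PiC sC *m Y))).
have zE : z = xbar sR X - xs - ab *: (grad (favg f) (xbar sR X) - grad (favg f) xs)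
    + - (ab *: gap X + b).
  have YE : n%:R^-1 *: (sR^T *m (diag_mx alpha *m Y)) =
      b + ab *: (grad (favg f) (xbar sR X) + gap X).
    have {1}-> : Y = PiC sC *m Y + sC *m (grad (favg f) (xbar sR X) + gap X).
      by rewrite {1}(trackingE sC Y) XY scalemxAr avg_grad.
    rewrite mulmxDr mulmxDr scalerDr; congr (_ + _).
    rewrite !mulmxA -[_ *m sC *m _]/(_ *m _).
    by rewrite [_ *m sC]mx11_scalar mul_scalar_mx scalerA.
  rewrite zdef YE grad_xs subr0 scalerDr.
  by rewrite [b + _]addrC -[_ + _ + b]addrA opprD addrA.
have b_le : mxdot b b <= n%:R^-1 ^+ 2 * (ah ^+ 2 * mxdot sR sR) * errC Y.
  rewrite /b mxdotZl mxdotZr mulrA -expr2 -mulrA ler_wpM2l ?sqr_ge0 //.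
  rewrite mulmxA; apply: le_trans (mxdot_mulmx_le _ _) _.
  rewrite ler_pM ?mxdot_ge0 //; last exact: (norm_data_ge normC).
  rewrite -[diag_mx alpha]tr_diag_mx -trmx_mul mxdot_tr.
  exact: mxdot_scale_rows_le.
have g_le : mxdot (gap X) (gap X) <= L ^+ 2 / n%:R * errR X by exact: gap_le.
have step := @gradient_step_contract _ _ (favg f) mu L
  (differentiable_favg f_diff) mu_gt0 (strongly_convex_favg n_gt0 f_diff f_convex)
  (smooth_favg n_gt0 f_diff f_smooth) (xbar sR X) xs ab muL (ltW ab_gt0) step_le.
rewrite [ab * mu]mulrC in step.
rewrite zE; apply: le_trans (mxdot_contractD _ mu_ab step) _.
rewrite mxdotNl mxdotNr opprK.
have := mxdotD_le2 (ab *: gap X) b; rewrite mxdotZl mxdotZr [ab * (ab * _)]mulrA -expr2.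
rewrite /cpp_coefs /= enorm_sqr => M_le.
by apply: (average_step_arith (t := mxdot sR sC) mu_gt0 w_gt0 ah_ge0 ab_gt0 n0
  _ _ _ _ _ alpha_bar_le c_ah g_le b_le M_le); rewrite ?mxdot_ge0 ?sqr_ge0.
Qed.

(** [Y] is its consensus error plus [sC] times the average gradient, and the
    latter splits into the gradient at the average, which vanishes at the
    minimizer, and the gap. *)
Lemma tracked_norm_le (X Y : 'M[R]_(n, p)) : tracked X Y ->
  mxdot Y Y <= c10 c * mxdot (xbar sR X - xs) (xbar sR X - xs)
    + c9 c * errR X + 3 * errC Y.
Proof.
move=> XY.
have YE : Y = PiC sC *m Y + sC *m (grad (favg f) (xbar sR X)) + sC *m gap X.
  by rewrite -addrA -mulmxDr {1}(trackingE sC Y) XY scalemxAr avg_grad.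
rewrite [in leLHS]YE; apply: le_trans (mxdotD_le3 _ _ _) _.
have h1 : mxdot (PiC sC *m Y) (PiC sC *m Y) <= errC Y := norm_data_ge normC _.
have h2 : mxdot (sC *m grad (favg f) (xbar sR X)) (sC *m grad (favg f) (xbar sR X))
    <= mxdot sC sC * (L ^+ 2 * mxdot (xbar sR X - xs) (xbar sR X - xs)).
  apply: le_trans (mxdot_mulmx_le _ _) _; rewrite ler_wpM2l ?mxdot_ge0 //.
  have := smooth_sqr (xbar sR X) xs (smooth_favg n_gt0 f_diff f_smooth).
  by rewrite grad_xs subr0.
have h3 : mxdot (sC *m gap X) (sC *m gap X) <= mxdot sC sC * (L ^+ 2 / n%:R * errR X).
  by apply: le_trans (mxdot_mulmx_le _ _) _; rewrite ler_wpM2l ?mxdot_ge0 //.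
rewrite /cpp_coefs /= enorm_sqr.
have -> : 3 * L ^+ 2 * mxdot sC sC / n%:R * errR X =
  3 * (mxdot sC sC * (L ^+ 2 / n%:R * errR X)) by ring.
have -> : 3 * L ^+ 2 * mxdot sC sC * mxdot (xbar sR X - xs) (xbar sR X - xs) =
  3 * (mxdot sC sC * (L ^+ 2 * mxdot (xbar sR X - xs) (xbar sR X - xs))) by ring.
lra.
Qed.

(** Since [PiR R_beta = PiR R_beta PiR], the contraction acts on the consensus
    error itself. *)
Lemma consensus_step (X Y : 'M[R]_(n, p)) z :
  z = PiR sR *m (lazy beta Rm *m X) - PiR sR *m (diag_mx alpha *m Y) ->
  mxdot (TR *m z) (TR *m z) <= (1 - thetaR * beta) * errR X
    + c5 c * (ah ^+ 2 / beta) * mxdot Y Y.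
Proof.
move=> ->; have /andP[t0 t1] := nd_theta normR; have /andP[b0 b1] := beta01.
have tb : 0 < thetaR * beta <= 1 by rewrite mulr_gt0 //= mulr_ile1 // ltW.
have -> : PiR sR *m (lazy beta Rm *m X) = PiR sR *m lazy beta Rm *m (PiR sR *m X).
  by rewrite !mulmxA (PiR_lazy net sR_sum).
rewrite mulmxBr.
have op : opnorm (wnorm TR) (PiR sR *m lazy beta Rm) <= 1 - thetaR * beta.
  by apply: (nd_contract normR); rewrite b1 ltW.
have st := norm_data_op normR (PiR sR *m X) op.
apply: le_trans (mxdot_contractD _ tb st) _; rewrite lerD2l mxdotNl mxdotNr opprK.
have le1 : errR (diag_mx alpha *m Y) <= deltaR ^+ 2 * (ah ^+ 2 * mxdot Y Y).
  apply: le_trans (norm_data_Pi normR _) _.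
  apply: le_trans (norm_data_le normR _) _.
  by rewrite ler_wpM2l ?sqr_ge0.
rewrite ler_pdivrMr ?mulr_gt0 //; apply: le_trans le1 _; rewrite /cpp_coefs /=.
apply: le_of_eq; field.
by rewrite !gt_eqF.
Qed.

(** As for [X], with the change of the stacked gradients as perturbation. *)
Lemma tracking_step (Y D : 'M[R]_(n, p)) z :
  z = PiC sC *m (lazy gamma Cm *m Y) + PiC sC *m D ->
  mxdot (TC *m z) (TC *m z) <= (1 - thetaC * gamma) * errC Y
    + deltaC ^+ 2 / (thetaC * gamma) * mxdot D D.
Proof.
move=> ->; have /andP[t0 t1] := nd_theta normC; have /andP[b0 b1] := gamma01.
have tb : 0 < thetaC * gamma <= 1 by rewrite mulr_gt0 //= mulr_ile1 // ltW.
have -> : PiC sC *m (lazy gamma Cm *m Y) = PiC sC *m lazy gamma Cm *m (PiC sC *m Y).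
  by rewrite !mulmxA (PiC_lazy net sC_eig sC_sum).
rewrite mulmxDr.
have op : opnorm (wnorm TC) (PiC sC *m lazy gamma Cm) <= 1 - thetaC * gamma.
  by apply: (nd_contract normC); rewrite b1 ltW.
have st := norm_data_op normC (PiC sC *m Y) op.
apply: le_trans (mxdot_contractD _ tb st) _; rewrite lerD2l.
rewrite mulrAC ler_pM2r ?invr_gt0 ?mulr_gt0 //.
exact: le_trans (norm_data_Pi normC _) (norm_data_le normC _).
Qed.

(* the deterministic part of [X^(k+1) - X^k] *)
Local Notation move X Y := (beta *: ((Rm - 1%:M) *m X) - diag_mx alpha *m Y).

(** [R - 1] annihilates the consensus part of [X], and its rows have squared
    norm at most 2. *)
Lemma move_le (X Y : 'M[R]_(n, p)) :
  mxdot (move X Y) (move X Y) <=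
  8 * n%:R * beta ^+ 2 * errR X + 2 * ah ^+ 2 * mxdot Y Y.
Proof.
apply: le_trans (mxdotD_le2 _ _) _.
rewrite mxdotNl mxdotNr opprK mxdotZl mxdotZr.
rewrite -(stochasticB1_PiR net sR) -mulmxA.
have h1 : mxdot ((Rm - 1%:M) *m (PiR sR *m X)) ((Rm - 1%:M) *m (PiR sR *m X))
    <= 2 * n%:R * errR X.
  apply: le_trans (mxdot_mulmx_le _ _) _; rewrite ler_pM ?mxdot_ge0 //.
    exact: (mxdot_stochasticB1_le net).
  exact: (norm_data_ge normR).
have h2 := scaleY_le Y.
have h3 : beta * (beta * mxdot ((Rm - 1%:M) *m (PiR sR *m X))
   ((Rm - 1%:M) *m (PiR sR *m X))) <= beta ^+ 2 * (2 * n%:R * errR X).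
  by rewrite mulrA -expr2 ler_wpM2l ?sqr_ge0.
have h4 : 0 <= n%:R * beta ^+ 2 * errR X.
  by rewrite mulr_ge0 ?mxdot_ge0 // mulr_ge0 ?sqr_ge0 // ler0n.
lra.
Qed.

Lemma compression_step (X Y U : 'M[R]_(n, p)) z :
  z = (1 - eta) *: (U - X) - move X Y ->
  mxdot z z <= (1 - eta) * mxdot (U - X) (U - X)
    + 8 * n%:R * beta ^+ 2 / eta * errR X + 2 * ah ^+ 2 / eta * mxdot Y Y.
Proof.
move=> ->; have /andP[e0 e1] := eta01.
have st : mxdot ((1 - eta) *: (U - X)) ((1 - eta) *: (U - X)) <=
    (1 - eta) ^+ 2 * mxdot (U - X) (U - X).
  by rewrite mxdotZl mxdotZr mulrA -expr2.
apply: le_trans (mxdot_contractD _ eta01 st) _.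
rewrite mxdotNl mxdotNr opprK -addrA lerD2l ler_pdivrMr //.
apply: le_trans (move_le X Y) _; apply: le_of_eq.
by field; rewrite gt_eqF.
Qed.

Lemma average_noise (e : 'M[R]_(n, p)) :
  mxdot ((beta / n%:R) *: sR^T *m e) ((beta / n%:R) *: sR^T *m e) <=
  beta ^+ 2 * (enorm sR ^+ 2 / n%:R ^+ 2) * mxdot e e.
Proof.
apply: le_trans (mxdot_mulmx_le _ _) _; rewrite ler_wpM2r ?mxdot_ge0 //.
rewrite mxdotZl mxdotZr mxdot_tr enorm_sqr.
apply: le_of_eq.
by field; rewrite gt_eqF.
Qed.

(** [R_1 = R], so that the contraction property at [beta = 1] bounds [PiR R]. *)
Lemma consensus_noise (e : 'M[R]_(n, p)) :
  mxdot (TR *m (PiR sR *m ((beta *: Rm) *m e)))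
        (TR *m (PiR sR *m ((beta *: Rm) *m e))) <=
  beta ^+ 2 * deltaR ^+ 2 * mxdot e e.
Proof.
have /andP[t0 t1] := nd_theta normR.
rewrite -scalemxAl -!scalemxAr mxdotZl mxdotZr mulrA -expr2 -mulrA.
rewrite ler_wpM2l ?sqr_ge0 //; apply: le_trans (norm_data_le normR _).
have op : opnorm (wnorm TR) (PiR sR *m Rm) <= 1 - thetaR.
  have := nd_contract normR (b := 1); rewrite /lazy subrr scale1r.
  rewrite (_ : 0%:M = 0) ?add0r ?mulr1; last by apply/matrixP => i j; rewrite !mxE mul0rn.
  by apply; rewrite ler01 lexx.
have := norm_data_op normR e op; rewrite -[_ *m Rm *m e]mulmxA => h.
apply: le_trans h _; rewrite ler_piMl ?mxdot_ge0 // expr_le1 //; lra.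
Qed.

Lemma tracking_noise (e : 'M[R]_(n, p)) :
  mxdot (TC *m (PiC sC *m ((gamma *: (Cm - 1%:M)) *m e)))
        (TC *m (PiC sC *m ((gamma *: (Cm - 1%:M)) *m e))) <=
  gamma ^+ 2 * (9 * deltaC ^+ 2) * mxdot e e.
Proof.
rewrite -scalemxAl -!scalemxAr mxdotZl mxdotZr mulrA -expr2 -mulrA.
rewrite ler_wpM2l ?sqr_ge0 //; apply: le_trans (norm_data_Pi normC _) _.
apply: le_trans (norm_data_op normC _ (nd_MI normC)) _.
have -> : 9 * deltaC ^+ 2 * mxdot e e = 3 ^+ 2 * (deltaC ^+ 2 * mxdot e e).
  by ring.
by rewrite ler_wpM2l ?sqr_ge0 // (norm_data_le normC).
Qed.

Lemma move_noise (e : 'M[R]_(n, p)) :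
  mxdot ((beta *: Rm) *m e) ((beta *: Rm) *m e) <= n%:R * beta ^+ 2 * mxdot e e.
Proof.
rewrite -scalemxAl mxdotZl mxdotZr mulrA -expr2.
have -> : n%:R * beta ^+ 2 * mxdot e e = beta ^+ 2 * (n%:R * mxdot e e) by ring.
rewrite ler_wpM2l ?sqr_ge0 //; apply: le_trans (mxdot_mulmx_le _ _) _.
by rewrite ler_wpM2r ?mxdot_ge0 // (mxdot_stochastic_le net).
Qed.

Lemma compression_noise (e : 'M[R]_(n, p)) :
  mxdot ((eta%:M - beta *: Rm) *m e) ((eta%:M - beta *: Rm) *m e) <=
  (2 * eta ^+ 2 + 2 * n%:R * beta ^+ 2) * mxdot e e.
Proof.
rewrite mulmxBl; apply: le_trans (mxdotD_le2 _ _) _.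
rewrite mxdotNl mxdotNr opprK; have := move_noise e.
rewrite mul_scalar_mx mxdotZl mxdotZr; lra.
Qed.

Section Iterates.
Context {dO dZ : measure_display} {Om : measurableType dO}
  {Z : measurableType dZ}.
Variables (P : probability Om R) (nu : probability Z R)
  (compress : 'rV[R]_p -> Z -> 'rV[R]_p) (seed : call n -> {RV P >-> Z}).
Hypotheses (compressP : compressor nu C2 compress) (seedP : iid_seeds nu seed).
Variables (X0 : 'M[R]_(n, p)) (X Y U Xh Yh : nat -> Om -> 'M[R]_(n, p)).
Let sd (a : call n) : Om -> Z := seed a.
Hypothesis cpp :
  is_CPP f Rm Cm compress sd alpha beta gamma eta X0 X Y U Xh Yh.

Local Notation callX k := (fun i : 'I_n => inl (k, i) : call n).
Local Notation callY k := (fun i : 'I_n => inr (k, i) : call n).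
Let eX k := compress_error compress seed (callX k) (fun om => X k om - U k om).
Let eY k := compress_error compress seed (callY k) (Y k).

Let XhE k om : Xh k om = X k om + eX k om.
Proof.
by rewrite (cpp_Xh cpp) /eX /compress_error opprB [RHS]addrCA subrKC addrC.
Qed.

Let YhE k om : Yh k om = Y k om + eY k om.
Proof. by rewrite (cpp_Yh cpp) /eY /compress_error subrKC. Qed.

(** The columns of [C - 1] sum to zero, so that the communication step preserves
    the column sums of [Y]. *)
Lemma CPP_tracked k om : tracked (X k om) (Y k om).
Proof.
have C1 : ones^T *m (Cm - 1%:M) = 0.
  by rewrite mulmxBr (net_C_stochastic net) mulmx1 subrr.
elim: k => [|k IH]; first by rewrite /tracked (cpp_X0 cpp) (cpp_Y0 cpp).
rewrite /tracked (cpp_Y cpp) mulmxBr mulmxDr mulmxDr -scalemxAr mulmxA C1.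
by rewrite mul0mx scaler0 addr0 IH addrAC subrr add0r.
Qed.

Let past_blind (a : call n) k :
    (forall j i, (j < k)%N -> inl (j, i) != a /\ inr (j, i) != a) ->
  [/\ blind_to seed a (X k), blind_to seed a (Y k) & blind_to seed a (U k)].
Proof.
move=> past; apply: (@CPP_measurable R n p _ _
  (g_sigma_algebraType (other_cylinders sd a)) Z nu C2 L compress f Rm Cm sd
  alpha beta gamma eta X0 X Y U Xh Yh compressP f_smooth cpp k) => j i jk.
by have [h1 h2] := past j i jk; split; exact: measurable_other_seed.
Qed.

Let blindX k i : [/\ blind_to seed (callX k i) (X k),
  blind_to seed (callX k i) (Y k) & blind_to seed (callX k i) (U k)].
Proof.
apply: past_blind => j i' jk; split => //.
by apply/eqP => -[jk' _]; rewrite jk' ltnn in jk.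
Qed.

Let blindY k i : [/\ blind_to seed (callY k i) (X k),
  blind_to seed (callY k i) (Y k) & blind_to seed (callY k i) (X k.+1)].
Proof.
have [|mX mY mU] := @past_blind (callY k i) k.
  move=> j i' jk; split => //.
  by apply/eqP => -[jk' _]; rewrite jk' ltnn in jk.
split=> //; apply: (@CPP_measurable_X R n p _ _
  (g_sigma_algebraType (other_cylinders sd (callY k i))) Z nu C2 compress f
  Rm Cm sd alpha beta gamma eta X0 X Y U Xh Yh compressP cpp k _ mX mU mY) => i'.
exact: measurable_other_seed.
Qed.

Let blind_cW k i : blind_to seed (callX k i) (fun om => X k om - U k om).
Proof. by have [? _ ?] := blindX k i; apply: mmeasD => //; exact: mmeasN. Qed.

Let all_meas k : [/\ mmeas (X k), mmeas (Y k) & mmeas (U k)].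
Proof.
by apply: (@CPP_measurable R n p _ _ Om Z nu C2 L compress f Rm Cm sd
  alpha beta gamma eta X0 X Y U Xh Yh compressP f_smooth cpp k).
Qed.

Let msqint_cW k : msqint P (X k) -> msqint P (U k) ->
  msqint P (fun om => X k om - U k om).
Proof. by move=> ? ?; apply: msqintD => //; exact: msqintN. Qed.

Let XSE k : X k.+1 = fun om => (lazy beta Rm *m X k om - diag_mx alpha *m Y k om)
  + (beta *: Rm) *m eX k om.
Proof.
apply/funext => om; rewrite (cpp_X cpp) XhE mulmxDr scalerDr addrA.
by rewrite /lazy mulmxDl mul_scalar_mx -!scalemxAl [RHS]addrAC.
Qed.

(** Only increments of the gradients enter the recursion, and they are dominated
    by those of [X]. *)
Let gradF_diff_sq k : msqint P (X k) -> msqint P (X k.+1) ->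
  msqint P (fun om => gradF f (X k.+1 om) - gradF f (X k om)).
Proof.
move=> hX hX1 i j; have [mX _ _] := all_meas k; have [mX1 _ _] := all_meas k.+1.
have Dsq : msqint P (fun om => X k.+1 om - X k om).
  by apply: msqintD => //; exact: msqintN.
apply: (sqint_dom _ (integrable_rvZ (L ^+ 2) (integrable_mxdot Dsq Dsq))).
  have mD : mmeas (fun om => gradF f (X k.+1 om) - gradF f (X k om)).
    by apply: mmeasD; [|apply: mmeasN]; exact: (mmeas_gradF f_smooth).
  exact: mD.
move=> om; apply: le_trans (sqr_entry_le _ _ _) _.
exact: gradF_smooth.
Qed.

Lemma CPP_sqint k : [/\ msqint P (X k), msqint P (Y k) & msqint P (U k)].
Proof.
elim: k => [|k [hX hY hU]].
  have -> : X 0%N = fun=> X0 by apply/funext => t; exact: (cpp_X0 cpp).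
  have -> : Y 0%N = fun=> gradF f X0 by apply/funext => t; exact: (cpp_Y0 cpp).
  have -> : U 0%N = fun=> 0 by apply/funext => t; exact: (cpp_U0 cpp).
  by split; exact: msqint_cst.
have heX : msqint P (eX k).
  apply: (compress_error_sq compressP seedP (@blind_cW k)); exact: msqint_cW.
have heY : msqint P (eY k).
  by apply: (compress_error_sq compressP seedP) => // i; have [] := blindY k i.
have hX1 : msqint P (X k.+1).
  rewrite XSE; apply: msqintD; last exact: msqint_mul.
  by apply: msqintD; [|apply: msqintN]; exact: msqint_mul.
split=> //.
  rewrite (_ : Y k.+1 = fun om => (Y k om + gamma *: ((Cm - 1%:M) *m (Y k om + eY k om)))
      + (gradF f (X k.+1 om) - gradF f (X k om))); last first.
    by apply/funext => om; rewrite (cpp_Y cpp) YhE [RHS]addrA.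
  apply: msqintD; last exact: gradF_diff_sq.
  by apply: msqintD => //; apply: msqintZ; apply: msqint_mul; exact: msqintD.
rewrite (_ : U k.+1 = fun om => (1 - eta) *: U k om + eta *: (X k om + eX k om)).
  by apply: msqintD; apply: msqintZ => //; exact: msqintD.
by apply/funext => om; rewrite (cpp_U cpp) XhE.
Qed.

Local Notation dx k := (Ex P (fun om =>
  mxdot (xbar sR (X k om) - xs) (xbar sR (X k om) - xs))).
Local Notation dR k := (Ex P (fun om => errR (X k om))).
Local Notation dC k := (Ex P (fun om => errC (Y k om))).
Local Notation dU k := (Ex P (fun om => mxdot (X k om - U k om) (X k om - U k om))).
Local Notation dY k := (Ex P (fun om => mxdot (Y k om) (Y k om))).

Let sq_xbar k : msqint P (fun om => xbar sR (X k om) - xs).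
Proof.
have [hX _ _] := CPP_sqint k; apply: msqintD; last exact: msqint_cst.
exact/msqintZ/msqint_mul.
Qed.

Let sq_XU k : msqint P (fun om => X k om - U k om).
Proof. by have [hX _ hU] := CPP_sqint k; exact: msqint_cW. Qed.

Let int_x k := integrable_mxdot (sq_xbar k) (sq_xbar k).
Let int_U k := integrable_mxdot (sq_XU k) (sq_XU k).

Let int_R k : integrable_rv P (fun om => errR (X k om)).
Proof.
have [hX _ _] := CPP_sqint k.
by apply: integrable_mxdot; do 2!apply: msqint_mul.
Qed.

Let int_C k : integrable_rv P (fun om => errC (Y k om)).
Proof.
have [_ hY _] := CPP_sqint k.
by apply: integrable_mxdot; do 2!apply: msqint_mul.
Qed.

Let int_Y k : integrable_rv P (fun om => mxdot (Y k om) (Y k om)).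
Proof. by have [_ hY _] := CPP_sqint k; exact: integrable_mxdot. Qed.

Lemma tracked_norm_mean k : dY k <= c10 c * dx k + c9 c * dR k + 3 * dC k.
Proof.
by apply: Ex_le_lin3 => // om; apply: tracked_norm_le; exact: CPP_tracked.
Qed.

(** [sR] is invariant by [R], so that mixing moves the average only through the
    compression error. *)
Lemma average_mean k : dx k.+1 <=
  (1 - c1 c * ah) * dx k + c2 c * ah * dR k + c3 c * ah * dC k
    + c4 c * beta ^+ 2 * dU k.
Proof.
have [hX hY hU] := CPP_sqint k.
pose z om := xbar sR (X k om) - xs - n%:R^-1 *: (sR^T *m (diag_mx alpha *m Y k om)).
have xE om : xbar sR (X k.+1 om) - xs =
    z om + (beta / n%:R) *: sR^T *m eX k om.
  have RE : sR^T *m (lazy beta Rm *m X k om) = sR^T *m X k om.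
    rewrite mulmxA /lazy mulmxDr mul_mx_scalar -scalemxAr sR_eig -scalerDl.
    by rewrite subrK scale1r.
  have NE : n%:R^-1 *: (sR^T *m ((beta *: Rm) *m eX k om)) =
      (beta / n%:R) *: sR^T *m eX k om.
    by rewrite mulmxA -scalemxAr sR_eig -!scalemxAl scalerA mulrC.
  rewrite /z /xbar XSE mulmxDr mulmxBr RE scalerDr scalerBr NE.
  by rewrite addrAC; congr (_ + _); rewrite addrAC.
have zsq : msqint P z.
  apply: msqintD; first exact: sq_xbar.
  by apply/msqintN/msqintZ/msqint_mul/msqint_mul.
under [X in Ex _ X]funext do rewrite xE.
have K0 : 0 <= beta ^+ 2 * (enorm sR ^+ 2 / n%:R ^+ 2).
  by apply: mulr_ge0; rewrite ?divr_ge0 ?sqr_ge0.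
apply: le_trans (noisy_square_le compressP seedP (@blind_cW k) (sq_XU k)
  K0 _ zsq average_noise) _.
  move=> i; have [mX mY _] := blindX k i.
  apply: mmeasD.
    by apply: mmeasD; [exact/mmeasZ/mmeas_mul|exact: mmeas_cst].
  by apply/mmeasN/mmeasZ/mmeas_mul/mmeas_mul.
apply: lerD.
  apply: Ex_le_lin3 => //; first exact: integrable_mxdot.
  by move=> om; apply: (average_step (Y := Y k om)) => //; exact: CPP_tracked.
by rewrite /cpp_coefs /=; set D := Ex _ _; apply: le_of_eq; ring.
Qed.

Lemma consensus_mean k : dR k.+1 <= (1 - thetaR * beta) * dR k
    + c5 c * (ah ^+ 2 / beta) * dY k + c6 c * beta ^+ 2 * dU k.
Proof.
have [hX hY hU] := CPP_sqint k.
pose z om := PiR sR *m (lazy beta Rm *m X k om) - PiR sR *m (diag_mx alpha *m Y k om).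
have xE om : TR *m (PiR sR *m X k.+1 om) =
    TR *m z om + (TR *m (PiR sR *m (beta *: Rm))) *m eX k om.
  by rewrite /z XSE mulmxDr mulmxBr mulmxDr -!mulmxA.
have zsq : msqint P (fun om => TR *m z om).
  apply: msqint_mul; apply: msqintD; first exact/msqint_mul/msqint_mul.
  exact/msqintN/msqint_mul/msqint_mul.
under [X in Ex _ X]funext do rewrite xE.
have K0 : 0 <= beta ^+ 2 * deltaR ^+ 2 by rewrite mulr_ge0 ?sqr_ge0.
apply: le_trans (noisy_square_le compressP seedP (@blind_cW k) (sq_XU k)
  K0 _ zsq _) _.
- move=> i; have [mX mY _] := blindX k i.
  apply: mmeas_mul; apply: mmeasD; first exact/mmeas_mul/mmeas_mul.
  exact/mmeasN/mmeas_mul/mmeas_mul.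
- by move=> e; rewrite -!mulmxA; exact: consensus_noise.
apply: lerD.
  apply: Ex_le_lin2 => //; first exact: integrable_mxdot.
  by move=> om; exact: consensus_step.
by rewrite /cpp_coefs /=; set D := Ex _ _; apply: le_of_eq; ring.
Qed.

Let moveE k om : X k.+1 om - X k om =
  move (X k om) (Y k om) + (beta *: Rm) *m eX k om.
Proof.
have lE : lazy beta Rm *m X k om = beta *: ((Rm - 1%:M) *m X k om) + X k om.
  rewrite /lazy mulmxDl mul_scalar_mx mulmxBl mul1mx -scalemxAl.
  by move: (_ *m _) => m1; apply/matrixP => i j; rewrite !mxE; ring.
rewrite XSE lE; move: (beta *: _) (_ *m Y k om) (_ *m eX k om) => m1 m2 m3.
by apply/matrixP => i j; rewrite !mxE; ring.
Qed.

Let sq_move k : msqint P (fun om => move (X k om) (Y k om)).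
Proof.
have [hX hY _] := CPP_sqint k; apply: msqintD; first exact/msqintZ/msqint_mul.
exact/msqintN/msqint_mul.
Qed.

Let blind_move k i : blind_to seed (callX k i) (fun om => move (X k om) (Y k om)).
Proof.
have [mX mY _] := blindX k i; apply: mmeasD; first exact/mmeasZ/mmeas_mul.
exact/mmeasN/mmeas_mul.
Qed.

Lemma move_mean k :
  Ex P (fun om => mxdot (X k.+1 om - X k om) (X k.+1 om - X k om)) <=
  8 * n%:R * beta ^+ 2 * dR k + 2 * ah ^+ 2 * dY k
    + n%:R * beta ^+ 2 * (C2 * dU k).
Proof.
under [X in Ex _ X]funext do rewrite moveE.
have K0 : 0 <= n%:R * beta ^+ 2 by rewrite mulr_ge0 ?sqr_ge0.
apply: le_trans (noisy_square_le compressP seedP (@blind_cW k) (sq_XU k)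
  K0 (@blind_move k) (sq_move k) move_noise) _.
rewrite lerD2r; apply: Ex_le_lin2 => //; first exact: integrable_mxdot.
by move=> om; exact: move_le.
Qed.

(** Two compression errors appear: that of [Y^k] directly, and that of [X^k]
    through the change of the gradients. *)
Lemma tracking_mean k : dC k.+1 <=
  8 * n%:R * c7 c * beta ^+ 2 / gamma * dR k + (1 - thetaC * gamma) * dC k
  + C2 * n%:R * c7 c * beta ^+ 2 / gamma * dU k
  + (c8 c * gamma ^+ 2 + 2 * c7 c * ah ^+ 2 / gamma) * dY k.
Proof.
have [hX hY hU] := CPP_sqint k; have [hX1 _ _] := CPP_sqint k.+1.
have /andP[g0 g1] := gamma01; have /andP[t0 t1] := nd_theta normC.
pose D om := gradF f (X k.+1 om) - gradF f (X k om).
pose z om := PiC sC *m (lazy gamma Cm *m Y k om) + PiC sC *m D om.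
have Dsq : msqint P D by exact: gradF_diff_sq.
have yE om : TC *m (PiC sC *m Y k.+1 om) =
    TC *m z om + (TC *m (PiC sC *m (gamma *: (Cm - 1%:M)))) *m eY k om.
  have lE : lazy gamma Cm *m Y k om = Y k om + gamma *: ((Cm - 1%:M) *m Y k om).
    rewrite /lazy mulmxDl mul_scalar_mx mulmxBl mul1mx -scalemxAl.
    by move: (_ *m _) => m1; apply/matrixP => i j; rewrite !mxE; ring.
  have -> : Y k.+1 om =
      lazy gamma Cm *m Y k om + D om + (gamma *: (Cm - 1%:M)) *m eY k om.
    rewrite (cpp_Y cpp) YhE lE /D -scalemxAl mulmxDr.
    move: (_ *m Y k om) (_ *m eY k om) => m1 m2.
    by apply/matrixP => i j; rewrite !mxE; ring.
  by rewrite /z !mulmxDr -!mulmxA.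
have zsq : msqint P (fun om => TC *m z om).
  apply: msqint_mul; apply: msqintD; first exact/msqint_mul/msqint_mul.
  exact: msqint_mul.
under [X in Ex _ X]funext do rewrite yE.
have K0 : 0 <= gamma ^+ 2 * (9 * deltaC ^+ 2).
  by apply: mulr_ge0; [exact: sqr_ge0|apply: mulr_ge0; rewrite ?ler0n ?sqr_ge0].
have mYb i : blind_to seed (callY k i) (Y k) by have [] := blindY k i.
apply: le_trans (noisy_square_le compressP seedP mYb hY K0 _ zsq _) _.
- move=> i; have [mX mY mX1] := blindY k i.
  apply: mmeas_mul; apply: mmeasD; first exact/mmeas_mul/mmeas_mul.
  apply: mmeas_mul; apply: mmeasD; last apply: mmeasN; exact: (mmeas_gradF f_smooth).
- by move=> e; rewrite -!mulmxA; exact: tracking_noise.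
have step1 : Ex P (fun om => mxdot (TC *m z om) (TC *m z om)) <=
    (1 - thetaC * gamma) * dC k +
    deltaC ^+ 2 / (thetaC * gamma) * Ex P (fun om => mxdot (D om) (D om)).
  apply: Ex_le_lin2 => //; [exact: integrable_mxdot|exact: integrable_mxdot|].
  by move=> om; exact: tracking_step.
have sqM : msqint P (fun om => X k.+1 om - X k om).
  by apply: msqintD => //; exact: msqintN.
have step2 : Ex P (fun om => mxdot (D om) (D om)) <= L ^+ 2 *
    Ex P (fun om => mxdot (X k.+1 om - X k om) (X k.+1 om - X k om)).
  rewrite -ExZ; last exact: integrable_mxdot.
  apply: le_Ex; [exact: integrable_mxdot|apply/integrable_rvZ; exact: integrable_mxdot|].
  by move=> om; exact: gradF_smooth.
have step3 := le_trans step2 (ler_wpM2l (sqr_ge0 L) (move_mean k)).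
have q0 : 0 <= deltaC ^+ 2 / (thetaC * gamma).
  by rewrite divr_ge0 ?sqr_ge0 // mulr_ge0 // ltW.
have step4 := ler_wpM2l q0 step3.
apply: le_trans (lerD (le_trans step1 (lerD (lexx _) step4)) (lexx _)) _.
rewrite /cpp_coefs /=; move: (dR k) (dC k) (dU k) (dY k) => r1 r2 r3 r4.
apply: le_of_eq; field.
by rewrite !gt_eqF.
Qed.

Lemma compression_mean k : dU k.+1 <=
  8 * n%:R * beta ^+ 2 / eta * dR k
  + (1 - eta + 2 * C2 * eta ^+ 2 + 2 * n%:R * C2 * beta ^+ 2) * dU k
  + 2 * ah ^+ 2 / eta * dY k.
Proof.
have [hX hY hU] := CPP_sqint k.
pose z om := (1 - eta) *: (U k om - X k om) - move (X k om) (Y k om).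
have uE om : X k.+1 om - U k.+1 om = - (z om + (eta%:M - beta *: Rm) *m eX k om).
  have -> : X k.+1 om = X k om + (move (X k om) (Y k om) + (beta *: Rm) *m eX k om).
    by rewrite -moveE subrKC.
  rewrite (cpp_U cpp) XhE /z [(eta%:M - _) *m _]mulmxBl mul_scalar_mx.
  move: (beta *: ((Rm - 1%:M) *m X k om)) (diag_mx alpha *m Y k om)
    ((beta *: Rm) *m eX k om) (eX k om) => m1 m2 m3 m4.
  apply/matrixP => i j; rewrite !mxE; ring.
have zsq : msqint P z.
  apply: msqintD; last by apply: msqintN; exact: sq_move.
  by apply: msqintZ; apply: msqintD => //; exact: msqintN.
under [X in Ex _ X]funext do rewrite uE mxdotNl mxdotNr opprK.
have K0 : 0 <= 2 * eta ^+ 2 + 2 * n%:R * beta ^+ 2.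
  by apply: addr_ge0; rewrite mulr_ge0 ?sqr_ge0 // mulr_ge0.
apply: le_trans (noisy_square_le compressP seedP (@blind_cW k) (sq_XU k)
  K0 _ zsq compression_noise) _.
  move=> i; have [mX mY mU] := blindX k i.
  apply: mmeasD; last by apply: mmeasN; exact: blind_move.
  by apply: mmeasZ; apply: mmeasD => //; exact: mmeasN.
have step1 : Ex P (fun om => mxdot (z om) (z om)) <= (1 - eta) * dU k
    + 8 * n%:R * beta ^+ 2 / eta * dR k + 2 * ah ^+ 2 / eta * dY k.
  apply: Ex_le_lin3 => //; first exact: integrable_mxdot.
  move=> om; rewrite -[X k om - U k om]opprB mxdotNl mxdotNr opprK.
  exact: compression_step.
apply: le_trans (lerD step1 (lexx _)) _.
move: (dR k) (dU k) (dY k) => r1 r2 r3.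
apply: le_of_eq; ring.
Qed.

(** The fourth entry is the mean of [|X - U|^2], the input of the compressor; it
    is also that of [|U - X|^2]. *)
Definition mean_errors k : 'cV[R]_5 :=
  \col_i [:: dx k; dR k; dC k; dU k; dY k]`_i.

Lemma error_vectorE k i :
  error_vector P sR sC TR TC xs X Y U k i = (mean_errors k i 0)%:E.
Proof.
have EE (g h : Om -> R) : (forall om, g om = h om) -> integrable_rv P h ->
    ('E_P[g] = (Ex P h)%:E)%E.
  by move=> gh hi; rewrite -(expectation_Ex hi); congr expectation; apply/funext.
rewrite /error_vector mxE.
case: i => -[|[|[|[|[|//]]]]] ? /=; apply: EE => // om.
- by rewrite enorm_sqr.
- by rewrite tnorm_wnorm.
- by rewrite tnorm_wnorm.
- by rewrite tnorm_enorm -opprB mxdotNl mxdotNr opprK.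
- by rewrite tnorm_enorm.
Qed.

Lemma mean_errors_ge0 k i : 0 <= mean_errors k i 0.
Proof.
rewrite mxE; case: i => -[|[|[|[|[|//]]]]] ? /=;
  by apply: Ex_ge0 => om; exact: mxdot_ge0.
Qed.

Local Notation A := (rateA n C2 thetaR thetaC c ah beta gamma eta).

Let rateE k i : (A *m mean_errors k) i 0 = A i 0 * dx k + A i 1 * dR k
  + A i 2 * dC k + A i 3 * dU k + A i 4 * dY k.
Proof.
by rewrite mxE !big_ord_recl big_ord0 addr0 !addrA !mxE.
Qed.

Lemma mean_errors_step k (i : 'I_5) : (i < 4)%N ->
  mean_errors k.+1 i 0 <= (A *m mean_errors k) i 0.
Proof.
rewrite rateE 6!mxE; case: i => -[|[|[|[|//]]]] ? _ /=; rewrite ?mul0r ?addr0 ?add0r.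
- exact: average_mean.
- by rewrite addrAC; exact: consensus_mean.
- exact: tracking_mean.
- exact: compression_mean.
Qed.

Lemma mean_errors_last k : mean_errors k 4 0 <= (A *m mean_errors k) 4 0.
Proof. by rewrite rateE 6!mxE /= !mul0r !addr0; exact: tracked_norm_mean. Qed.

End Iterates.

End Recursion.

(** * Perron-Frobenius theory *)

Section PerronFrobenius.
Context {R : realType} {m : nat}.
Variable A : 'M[R]_m.+1.
Hypothesis A_ge0 : forall i j, 0 <= A i j.
Hypothesis A_irr : forall i j, connect [rel a b | 0 < A a b] i j.
Local Notation cvec := 'cV[R]_m.+1.

Local Notation B := (1%:M + A).

Let B_ge0 i j : 0 <= B i j.
Proof. by rewrite !mxE addr_ge0 // ler0n. Qed.

Let mulB_ge0 (y : cvec) : (forall i, 0 <= y i 0) -> forall i, 0 <= (B *m y) i 0.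
Proof. by move=> y0 i; rewrite mxE sumr_ge0 // => j _; rewrite mulr_ge0. Qed.

Let iterB k (y : cvec) := iter k (mulmx B) y.

Let iterB_ge0 k (y : cvec) : (forall i, 0 <= y i 0) -> forall i, 0 <= iterB k y i 0.
Proof. by move=> y0; elim: k => //= k IH; exact: mulB_ge0. Qed.

Let mulB_gt0 (y : cvec) i j : (forall i, 0 <= y i 0) -> 0 < y j 0 ->
  (i == j) || (0 < A i j) -> 0 < (B *m y) i 0.
Proof.
move=> y0 yj ij; rewrite mxE (bigD1 j) //= ltr_pwDl //; last first.
  by apply: sumr_ge0 => k _; rewrite mulr_ge0.
rewrite mulr_gt0 // !mxE; case/orP: ij => [->|Aij].
  by rewrite ltr_pwDl.
by rewrite ltr_wpDl // ler0n.
Qed.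

Let iterB_mono k l (y : cvec) i : (forall i, 0 <= y i 0) -> (k <= l)%N ->
  0 < iterB k y i 0 -> 0 < iterB l y i 0.
Proof.
move=> y0 /subnK <-; elim: (l - k)%N => //= q IH yk.
apply: (mulB_gt0 (j := i)); rewrite ?eqxx //; last exact: IH.
exact: (iterB_ge0 (q + k) y0).
Qed.

(** The support of a nonnegative vector spreads along the edges of [A], and the
    diagonal of [1 + A] keeps what has been reached. *)
Lemma iter_gt0 : exists N, forall y : cvec, (forall i, 0 <= y i 0) ->
  (exists j, 0 < y j 0) -> forall i, 0 < iter N (mulmx B) y i 0.
Proof.
have one i j : exists k, forall y : cvec, (forall i, 0 <= y i 0) -> 0 < y j 0 ->
    0 < iterB k y i 0.
  have /connectP [s + ->] := A_irr i j; elim: s i => [|l s IH] i /=.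
    by move=> _; exists 0%N.
  move=> /andP[il /IH [k kP]]; exists k.+1 => y y0 yj.
  apply: (mulB_gt0 (j := l)); [exact: iterB_ge0|exact: kP|].
  by rewrite il orbT.
have [k kP] := fin_all_exists (fun ij : 'I_m.+1 * 'I_m.+1 => one ij.1 ij.2).
exists (\max_ij k ij)%N => y y0 [j yj] i.
apply: (@iterB_mono (k (i, j))) => //; first exact: leq_bigmax.
exact: (kP (i, j)).
Qed.

Let commB (y : cvec) : B *m (A *m y) = A *m (B *m y).
Proof. by rewrite !mulmxDl !mul1mx mulmxDr. Qed.

Let iterB_A k (y : cvec) : iterB k (A *m y) = A *m iterB k y.
Proof. by elim: k => //= k ->; rewrite commB. Qed.

Let iterBB k (x y : cvec) : iterB k (x - y) = iterB k x - iterB k y.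
Proof. by elim: k => //= k ->; rewrite mulmxBr. Qed.

Let iterBZ k a (y : cvec) : iterB k (a *: y) = a *: iterB k y.
Proof. by elim: k => //= k ->; rewrite -scalemxAr. Qed.

(** On an eigenvector [(1 + A)^N] is multiplication by [(1 + r)^N]. *)
Let eigen_gt0 r (y : cvec) : 0 <= r -> A *m y = r *: y -> (forall i, 0 <= y i 0) ->
  (exists j, 0 < y j 0) -> forall i, 0 < y i 0.
Proof.
move=> r0 Ay y0 yj i; have [N /(_ y y0 yj i)] := iter_gt0.
have -> : iter N (mulmx B) y = (1 + r) ^+ N *: y.
  elim: N => [|N IH]; first by rewrite scale1r.
  by rewrite iterS IH -scalemxAr mulmxDl mul1mx Ay -{1}[y]scale1r -scalerDl
    scalerA -exprSr.
by rewrite mxE pmulr_rgt0 // exprn_gt0 // ltr_pwDl.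
Qed.

Let bound := \sum_i \sum_j A i j.

(** Pairs [(l, x)] with [x] in the simplex and [l x <= A x]; such a pair is one
    row vector, with [l] as its first entry, so that compactness in finite
    dimension applies. *)
Let collatz : set 'rV[R]_m.+2 := [set y |
  (forall i, 0 <= y 0 i) /\ \sum_i y 0 (lift ord0 i) = 1 /\
  forall i, y 0 ord0 * y 0 (lift ord0 i) <= \sum_j A i j * y 0 (lift ord0 j)].

Let coord_cont i : continuous (fun y : 'rV[R]_m.+2 => y 0 i).
Proof. exact: coord_continuous. Qed.

Let sum_cont (F : 'I_m.+1 -> 'rV[R]_m.+2 -> R) :
  (forall i, continuous (F i)) -> continuous (fun y => \sum_i F i y).
Proof. by move=> Fc; apply: continuous_big => // x; exact: add_continuous. Qed.

Let sub_cont (g h : 'rV[R]_m.+2 -> R) :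
  continuous g -> continuous h -> continuous (fun y => g y - h y).
Proof. by move=> gc hc y; exact: (cvgB (gc y) (hc y)). Qed.

Let mul_cont (g h : 'rV[R]_m.+2 -> R) :
  continuous g -> continuous h -> continuous (fun y => g y * h y).
Proof. by move=> gc hc y; exact: (cvgM (gc y) (hc y)). Qed.

Let closed_nneg (g : 'rV[R]_m.+2 -> R) :
  continuous g -> closed [set y | 0 <= g y].
Proof.
move=> gc; apply: (@preimage_closed _ _ g [set x | 0 <= x]); last exact: closed_ge.
by move=> x _; exact: gc.
Qed.

Let closed_collatz : closed collatz.
Proof.
have -> : collatz = \bigcap_i [set y | 0 <= y 0 i] `&`
   ([set y | 0 <= \sum_i y 0 (lift ord0 i) - 1] `&`
    [set y | 0 <= 1 - \sum_i y 0 (lift ord0 i)]) `&`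
   \bigcap_i [set y | 0 <= \sum_j A i j * y 0 (lift ord0 j)
                           - y 0 ord0 * y 0 (lift ord0 i)].
  apply/seteqP; split=> y /=.
    move=> [h1 [h2 h3]]; split; last by move=> i _ /=; rewrite subr_ge0.
    by split; [move=> i _; exact: h1|rewrite h2 subrr].
  move=> [[h1 [h2 h2']] h3]; split; first by move=> i; exact: h1.
  split; last by move=> i; rewrite -subr_ge0; exact: h3.
  by apply/eqP; rewrite eq_le -subr_ge0 h2' -subr_ge0 h2.
have sc : continuous (fun y : 'rV[R]_m.+2 => \sum_i y 0 (lift ord0 i)).
  by apply: sum_cont => i; exact: coord_cont.
apply: closedI; first apply: closedI.
- by apply: closed_bigI => i _; apply: closed_nneg; exact: coord_cont.
- have cc : continuous (fun _ : 'rV[R]_m.+2 => 1 : R) by move=> y; exact: cst_continuous.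
  by apply: closedI; apply: closed_nneg; apply: sub_cont.
- apply: closed_bigI => i _; apply: closed_nneg; apply: sub_cont.
    apply: sum_cont => j; apply: mul_cont => // y; exact: cst_continuous.
  exact: mul_cont.
Qed.

Let collatz_le y : collatz y -> forall i, y 0 i <= 1 + bound.
Proof.
move=> [y0 [y1 yA]]; have yi i : y 0 (lift ord0 i) <= 1.
  by rewrite -y1 (bigD1 i) //= lerDl sumr_ge0 // => k _; exact: y0.
have b0 : 0 <= bound by do 2![apply: sumr_ge0 => ? _].
move=> i; case: (unliftP ord0 i) => [j|] ->.
  by rewrite (le_trans (yi j)) // lerDl.
suff : y 0 ord0 <= bound by move=> h; rewrite (le_trans h) // lerDr.
rewrite -[leLHS]mulr1 -y1 mulr_sumr; apply: ler_sum => k _.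
apply: le_trans (yA k) _; apply: ler_sum => j _.
by rewrite ler_piMr.
Qed.

Let compact_collatz : compact collatz.
Proof.
apply: bounded_closed_compact closed_collatz.
exists (1 + bound); split; first exact: num_real.
move=> M ltM y cy; rewrite /= /Num.Def.normr /=.
have M0 : 0 <= M.
  have [y0 _] := cy; apply: le_trans (ltW ltM).
  exact: le_trans (y0 ord0) (collatz_le cy ord0).
rewrite mx_normrE; apply: bigmax_le => // -[i j] _ /=; rewrite ord1.
have [y0 _] := cy; rewrite ger0_norm //.
exact: le_trans (collatz_le cy j) (ltW ltM).
Qed.

Let uniform : 'rV[R]_m.+2 :=
  \row_i (if i == ord0 then 0 else m.+1%:R^-1).

Let collatz_uniform : collatz uniform.
Proof.
split; first by move=> i; rewrite mxE; case: ifP.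
split.
  under eq_bigr do rewrite mxE /=.
  by rewrite sumr_const card_ord -[LHS]mulr_natr mulVf // pnatr_eq0.
move=> i; rewrite !mxE eqxx mul0r sumr_ge0 // => j _.
by rewrite mxE /= mulr_ge0.
Qed.

(** Collatz-Wielandt: at a pair with the largest [l], equality holds, since
    otherwise [(1 + A)^N] would turn [l x <= A x] into a strict inequality. *)
Lemma perron_exists : exists r v,
  [/\ 0 <= r, positive_vec v & A *m v = r *: v].
Proof.
have ne : collatz !=set0 by exists uniform; exact: collatz_uniform.
have ct : {within collatz, continuous (fun y : 'rV[R]_m.+2 => y 0 ord0)}.
  exact/continuous_subspaceT/coord_cont.
have [y /set_mem cy ymax] := EVT_max_rV ne compact_collatz ct.
have {ymax}ymax z : collatz z -> z 0 ord0 <= y 0 ord0.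
  by move=> cz; apply: ymax; exact/mem_set.
have [y0 [y1 yA]] := cy.
pose r := y 0 ord0; pose x : 'cV[R]_m.+1 := \col_i y 0 (lift ord0 i).
have x0 i : 0 <= x i 0 by rewrite mxE.
have xj : exists j, 0 < x j 0.
  apply/existsP; apply: contraPT y1; rewrite negb_exists => /forallP h.
  rewrite big1 => [/esym/eqP|i _]; first by rewrite oner_eq0.
  by apply/eqP; rewrite eq_le y0 andbT leNgt; have := h i; rewrite mxE.
have Ax i : 0 <= (A *m x - r *: x) i 0.
  rewrite !mxE subr_ge0; have := yA i; congr (_ <= _).
  by apply: eq_bigr => j _; rewrite mxE.
have [Axr|Axr] := eqVneq (A *m x) (r *: x).
  exists r, x; split; [exact: y0| |exact: Axr] => i.
  by apply: (eigen_gt0 _ Axr) => //; exact: y0.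
exfalso; have [N NP] := iter_gt0.
have xN : forall i, 0 < iterB N x i 0 by exact: NP.
have gapN : forall i, 0 < (A *m iterB N x - r *: iterB N x) i 0.
  rewrite -iterB_A -iterBZ -iterBB; apply: NP => //.
  apply/existsP; apply: contra_neqT Axr; rewrite negb_exists => /forallP h.
  apply/matrixP => i j; rewrite ord1; apply/eqP; rewrite -subr_eq0.
  have := h i; rewrite -leNgt => hi; rewrite eq_le; apply/andP; split.
    by move: hi; rewrite !mxE.
  by have := Ax i; rewrite !mxE.
move: (iterB N x) xN gapN => z z0 gapz.
(* by how much [l] can be raised at [z] *)
pose e := \big[Order.min/1]_i ((A *m z - r *: z) i 0 / z i 0).
have e0 : 0 < e.
  by rewrite /e; apply: lt_bigmin => // i _; rewrite divr_gt0.
have ez i : (r + e) * z i 0 <= (A *m z) i 0.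
  have : e <= (A *m z - r *: z) i 0 / z i 0 by exact: bigmin_le_cond.
  rewrite ler_pdivlMr // mulrDl -lerBrDl => h.
  by apply: le_trans h _; rewrite !mxE.
pose t := \sum_i z i 0.
have t0 : 0 < t by rewrite /t (bigD1 ord0) //= ltr_pwDl // sumr_ge0 // => i _; exact: ltW.
pose y' : 'rV[R]_m.+2 := \row_i (if unlift ord0 i is Some j then t^-1 * z j 0 else r + e).
have y'0 : y' 0 ord0 = r + e by rewrite mxE unlift_none.
have y'i i : y' 0 (lift ord0 i) = t^-1 * z i 0 by rewrite mxE liftK.
have := ymax y'; rewrite y'0 -/r gerDl leNgt e0 => /(_ _)/negP; apply => //.
split; [|split].
- move=> i; case: (unliftP ord0 i) => [j|] ->; rewrite ?y'0 ?y'i.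
    by rewrite mulr_ge0 // ?invr_ge0 ltW.
  by apply: addr_ge0; [exact: y0|exact: ltW].
- by under eq_bigr do rewrite y'i; rewrite -mulr_sumr mulVf // gt_eqF.
- move=> i; rewrite y'0 y'i; under eq_bigr do rewrite y'i mulrCA.
  rewrite -mulr_sumr mulrCA ler_pM2l ?invr_gt0 //.
  by apply: le_trans (ez i) _; rewrite mxE.
Qed.

(** With [t] the least value of [v / u], the vector [v - t u] is nonnegative and
    vanishes somewhere; a nonzero eigenvector of this kind would be positive. *)
Lemma perron_unique r (u v : cvec) : 0 <= r -> positive_vec u ->
  A *m u = r *: u -> A *m v = r *: v -> exists t : R, v = t *: u.
Proof.
move=> r0 u0 Au Av.
have [i0 _ i0P] := @arg_minP _ _ _ ord0 xpredT (fun i => v i 0 / u i 0) isT.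
pose t := v i0 0 / u i0 0; exists t; apply/eqP; rewrite -subr_eq0; apply/eqP.
set d := v - t *: u.
have d0 i : 0 <= d i 0.
  by rewrite !mxE subr_ge0 -ler_pdivlMr //; exact: i0P.
have di0 : d i0 0 = 0 by rewrite !mxE divfK ?subrr // gt_eqF.
have Ad : A *m d = r *: d.
  by rewrite mulmxBr Av -scalemxAr Au scalerBr !scalerA mulrC.
apply/matrixP => i j; rewrite ord1 [RHS]mxE.
apply/eqP; rewrite eq_le d0 andbT leNgt; apply/negP => di.
have := eigen_gt0 r0 Ad d0 (ex_intro _ i di) i0.
by rewrite di0 ltxx.
Qed.

End PerronFrobenius.

Section SpectralRadius.
Context {R : realType} {m : nat}.
Variables (A : 'M[R]_m.+1) (r : R) (v : 'cV[R]_m.+1).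
Hypothesis A_ge0 : forall i j, 0 <= A i j.
Hypotheses (r_ge0 : 0 <= r) (v_gt0 : positive_vec v) (Av : A *m v = r *: v).

Local Notation norm := ComplexField.Normc.normc.

Let norm_ge0 (z : R[i]) : 0 <= norm z.
Proof. by case: z => a b; rewrite /= sqrtr_ge0. Qed.

Let norm_real (a : R) : norm (real_complex R a) = `|a|.
Proof. by rewrite /= expr0n /= addr0 sqrtr_sqr. Qed.

Let norm_sum (I : Type) (s : seq I) (F : I -> R[i]) :
  norm (\sum_(i <- s) F i) <= \sum_(i <- s) norm (F i).
Proof.
elim: s => [|i s IH]; first by rewrite !big_nil ComplexField.Normc.normc0.
rewrite !big_cons; apply: le_trans (le_normcD _ _) _.
by rewrite lerD2l.
Qed.

(** Pair the moduli of a left eigenvector with [v]. *)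
Let eigenvalue_le (z : R[i]) :
  eigenvalue (map_mx (real_complex R) A) z -> norm z <= r.
Proof.
move=> /eigenvalueP [u uA u0].
have le1 j : norm z * norm (u 0 j) <= \sum_i norm (u 0 i) * A i j.
  have : norm z * norm (u 0 j) = norm ((u *m map_mx (real_complex R) A) 0 j).
    by rewrite uA mxE ComplexField.Normc.normcM.
  move=> ->; rewrite mxE; apply: le_trans (norm_sum _ _) _.
  apply: ler_sum => i _.
  by rewrite ComplexField.Normc.normcM mxE norm_real ger0_norm.
pose S := \sum_j norm (u 0 j) * v j 0.
have S0 : 0 < S.
  have [j uj] : exists j, u 0 j != 0.
    apply/existsP; apply: contra_neqT u0; rewrite negb_exists => /forallP h.
    by apply/rowP => j; have := h j; rewrite negbK mxE => /eqP.
  rewrite /S (bigD1 j) //= ltr_pwDl //; last first.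
    by apply: sumr_ge0 => k _; rewrite mulr_ge0 // ltW.
  rewrite mulr_gt0 // lt_neqAle norm_ge0 andbT eq_sym.
  by apply: contra_neq uj; exact: ComplexField.Normc.eq0_normc.
rewrite -(ler_pM2r S0) mulr_sumr.
apply: le_trans (_ : \sum_j (\sum_i norm (u 0 i) * A i j) * v j 0 <= _).
  by apply: ler_sum => j _; rewrite mulrA ler_wpM2r // ltW.
under eq_bigr do rewrite mulr_suml.
rewrite exchange_big mulr_sumr /=; apply: ler_sum => i _.
have /matrixP/(_ i 0) := Av; rewrite !mxE => AvE.
by under eq_bigr do rewrite -mulrA; rewrite -mulr_sumr AvE mulrCA.
Qed.

(** [eigenvalue] asks for a left eigenvector, obtained from the right one through
    the determinant. *)
Let eigenvalue_r : eigenvalue (map_mx (real_complex R) A) (real_complex R r).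
Proof.
have : \det (A - r%:M)^T == 0.
  apply/det0P; exists v^T.
    apply/eqP => /matrixP/(_ 0 ord0); rewrite !mxE => v0.
    by have := v_gt0 ord0; rewrite v0 ltxx.
  by rewrite -trmx_mul mulmxBl Av mul_scalar_mx subrr trmx0.
rewrite det_tr => /det0P [u u0 uA]; apply/eigenvalueP.
exists (map_mx (real_complex R) u).
  rewrite -map_mxM -map_mxZ; congr map_mx.
  by apply/eqP; rewrite -subr_eq0 -mul_mx_scalar -mulmxBr uA.
apply: contra_neq u0 => /matrixP u0; apply/rowP => j.
by have := u0 0 j; rewrite !mxE => -[].
Qed.

Lemma spectral_radius_perron : spectral_radius A = r.
Proof.
have ub : ubound [set norm z | z in
    [set z | eigenvalue (map_mx (real_complex R) A) z]] r.
  by move=> _ [z zA <-]; exact: eigenvalue_le.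
have mem : [set norm z | z in
    [set z | eigenvalue (map_mx (real_complex R) A) z]] r.
  by exists (real_complex R r); [exact: eigenvalue_r|rewrite norm_real ger0_norm].
apply/eqP; rewrite eq_le; apply/andP; split.
  by apply: ge_sup => //; exists r.
by apply: ub_le_sup => //; exists r.
Qed.

(** Look at an index where [v / u] is largest. *)
Lemma perron_lt1 (u : 'cV[R]_m.+1) : positive_vec u ->
  (forall i, (A *m u) i 0 < u i 0) -> r < 1.
Proof.
move=> u0 Au.
have [i0 _ i0P] := @arg_maxP _ _ _ ord0 xpredT (fun i => v i 0 / u i 0) isT.
pose t := v i0 0 / u i0 0; have t0 : 0 < t by rewrite divr_gt0.
have vt : v i0 0 = t * u i0 0 by rewrite divfK // gt_eqF.
have le_t j : v j 0 <= t * u j 0 by rewrite -ler_pdivrMr //; exact: i0P.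
have /matrixP/(_ i0 0) := Av; rewrite [RHS]mxE => rv.
rewrite -(ltr_pM2r (v_gt0 i0)) mul1r -rv.
apply: le_lt_trans (_ : t * (A *m u) i0 0 < _); last first.
  by rewrite vt ltr_pM2l.
rewrite !mxE mulr_sumr; apply: ler_sum => j _.
by rewrite mulrCA ler_wpM2l.
Qed.

End SpectralRadius.

(** * The threshold and the rate matrix *)

Section Bracket.
Context {R : realType}.

(** All four polynomials [g_i] are, up to a power of the variable, of this form,
    which increases from [- K] on the positive reals. *)
Definition bracket (K e1 e2 e4 e6 x : R) :=
  - K + e1 * x + e2 * x ^+ 2 + e4 * x ^+ 4 + e6 * x ^+ 6.

Definition bracket_signs (K e1 e2 e4 e6 : R) :=
  [/\ 0 < K, 0 <= e1, 0 <= e2, 0 <= e4 & 0 <= e6] /\ 0 < e1 + e2 + e4 + e6.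

Variables (q : {poly R}) (k : nat) (K e1 e2 e4 e6 : R).
Hypothesis signs : bracket_signs K e1 e2 e4 e6.
Let K_gt0 : 0 < K. Proof. by case: signs => -[]. Qed.
Let e1_ge0 : 0 <= e1. Proof. by case: signs => -[]. Qed.
Let e2_ge0 : 0 <= e2. Proof. by case: signs => -[]. Qed.
Let e4_ge0 : 0 <= e4. Proof. by case: signs => -[]. Qed.
Let e6_ge0 : 0 <= e6. Proof. by case: signs => -[]. Qed.
Let e_gt0 : 0 < e1 + e2 + e4 + e6. Proof. by case: signs. Qed.
Hypothesis qE : forall x, q.[x] = x ^+ k * bracket K e1 e2 e4 e6 x.

Let bracket_incr x y : 0 < x -> x < y ->
  bracket K e1 e2 e4 e6 x < bracket K e1 e2 e4 e6 y.
Proof.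
move=> x0 xy; have y0 := lt_trans x0 xy.
have lt_exp j : (0 < j)%N -> 0 < y ^+ j - x ^+ j.
  by move=> j0; rewrite subr_gt0 ltr_pXn2r // nnegrE ltW.
rewrite -subr_gt0.
have -> : bracket K e1 e2 e4 e6 y - bracket K e1 e2 e4 e6 x =
    e1 * (y ^+ 1 - x ^+ 1) + e2 * (y ^+ 2 - x ^+ 2) + e4 * (y ^+ 4 - x ^+ 4)
    + e6 * (y ^+ 6 - x ^+ 6) by rewrite /bracket; ring.
have [d1 d2 d4 d6] := And4 (lt_exp 1%N isT) (lt_exp 2%N isT) (lt_exp 4%N isT)
  (lt_exp 6%N isT).
have h1 := mulr_ge0 e1_ge0 (ltW d1); have h2 := mulr_ge0 e2_ge0 (ltW d2).
have h4 := mulr_ge0 e4_ge0 (ltW d4); have h6 := mulr_ge0 e6_ge0 (ltW d6).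
rewrite lt_neqAle !addr_ge0 // andbT eq_sym; apply/eqP => s0.
have z1 : e1 * (y ^+ 1 - x ^+ 1) = 0 by lra.
have z2 : e2 * (y ^+ 2 - x ^+ 2) = 0 by lra.
have z4 : e4 * (y ^+ 4 - x ^+ 4) = 0 by lra.
have z6 : e6 * (y ^+ 6 - x ^+ 6) = 0 by lra.
have zero (e d : R) : e * d = 0 -> 0 < d -> e = 0.
  by move=> /eqP; rewrite mulf_eq0 => /orP[/eqP //|/eqP ->]; rewrite ltxx.
have := e_gt0; rewrite (@zero _ _ z1 d1) (@zero _ _ z2 d2) (@zero _ _ z4 d4).
by rewrite (@zero _ _ z6 d6) !addr0 ltxx.
Qed.

Let root_bracket x : 0 < x -> root q x = (bracket K e1 e2 e4 e6 x == 0).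
Proof.
by move=> x0; rewrite rootE qE mulf_eq0 expf_eq0 (gt_eqF x0) andbF.
Qed.

Lemma min_pos_root_lt x y : is_min_pos_root q x -> 0 < y -> y < x -> q.[y] < 0.
Proof.
move=> [x0 rx _] y0 yx; rewrite qE pmulr_rlt0 ?exprn_gt0 //.
by rewrite -(eqP (_ : bracket K e1 e2 e4 e6 x == 0)) ?bracket_incr // -root_bracket.
Qed.

Lemma min_pos_root_exists : exists x, is_min_pos_root q x.
Proof.
pose h : {poly R} := (- K)%:P + e1 *: 'X + e2 *: 'X^2 + e4 *: 'X^4 + e6 *: 'X^6.
have hE x : h.[x] = bracket K e1 e2 e4 e6 x by rewrite /h /bracket !hornerE; ring.
(* [T >= 1], so that the bracket at [T] is at least [S T - K = S] *)
pose S := e1 + e2 + e4 + e6; pose T := 1 + K / S.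
have T1 : 1 <= T by rewrite lerDl divr_ge0 // ltW.
have T0 : 0 <= T by apply: le_trans T1.
have hT : 0 <= h.[T].
  have leT j : (0 < j)%N -> T <= T ^+ j by move=> j0; rewrite ler_eXnr.
  rewrite hE /bracket -addrA -addrA -addrA.
  have : S * T <= e1 * T + (e2 * T ^+ 2 + (e4 * T ^+ 4 + e6 * T ^+ 6)).
    rewrite /S !mulrDl -!addrA !lerD ?ler_wpM2l ?leT //.
  have -> : S * T = S + K by rewrite /T mulrDr mulr1 mulrCA divff ?mulr1 ?gt_eqF.
  by have := e_gt0; rewrite -/S; lra.
have [|x /andP[x0 _] rx] := @poly_ivt R h 0 T T0.
  by rewrite hT andbT hE /bracket !expr0n /= !mulr0 !addr0 oppr_le0 ltW.
exists x; have bx : bracket K e1 e2 e4 e6 x = 0 by rewrite -hE; apply/eqP.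
have {}x0 : 0 < x.
  rewrite lt_neqAle x0 andbT; apply/eqP => x00; move: bx.
  rewrite -x00 /bracket !expr0n /= !mulr0 !addr0 => /eqP.
  by rewrite oppr_eq0 gt_eqF.
split=> //; first by rewrite root_bracket // bx.
move=> y y0; rewrite root_bracket // => /eqP by_; rewrite leNgt; apply/negP => yx.
by have := bracket_incr y0 yx; rewrite bx by_ ltxx.
Qed.

End Bracket.

Section Threshold.
Context {R : realType}.
Variables (n : nat) (C2 thetaR thetaC : R) (c : coefs R) (eta a b : R).
Hypotheses (n_gt0 : (0 < n)%N) (C2_gt0 : 0 < C2) (thetaR_gt0 : 0 < thetaR)
  (thetaC_gt0 : 0 < thetaC).
Hypothesis c_gt0 : [/\ 0 < c1 c, 0 < c2 c, 0 < c3 c, 0 < c4 c & 0 < c5 c] /\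
  [/\ 0 < c6 c, 0 < c7 c, 0 < c8 c, 0 < c9 c & 0 < c10 c].
Hypotheses (a_gt0 : 0 < a) (b_gt0 : 0 < b) (eta_gt0 : 0 < eta)
  (eta_lt : 0 < eta - 2 * C2 * eta ^+ 2).

Let n0 : 0 < n%:R :> R. Proof. by rewrite ltr0n. Qed.

Section Polynomials.
Variable v : 'cV[R]_5.

Lemma g1E x : (g1 c a b v).[x] = x ^+ 3 * bracket
  ((c1 c * v 0 0 - c2 c * v 1 0 - c3 c * v 2 0) * a) (c4 c * v 3 0 * b ^+ 2)
  0 0 0 x.
Proof. by rewrite /g1 /bracket !(hornerD, hornerZ, hornerXn, hornerX, hornerC); ring. Qed.

Lemma g2E x : (g2 thetaR c a b v).[x] = x ^+ 2 * bracket (thetaR * b * v 1 0) 0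
  (c6 c * v 3 0 * b ^+ 2 + c5 c * v 4 0 * (a ^+ 2 / b)) 0 0 x.
Proof. by rewrite /g2 /bracket !(hornerD, hornerZ, hornerXn, hornerX, hornerC); ring. Qed.

Lemma g3E x : (g3 n C2 thetaC c a b v).[x] = x ^+ 1 * bracket
  (thetaC * v 2 0) (c8 c * v 4 0)
  (8 * n%:R * c7 c * v 1 0 * b ^+ 2 + C2 * n%:R * c7 c * v 3 0 * b ^+ 2)
  (2 * c7 c * v 4 0 * a ^+ 2) 0 x.
Proof. by rewrite /g3 /bracket !(hornerD, hornerZ, hornerXn, hornerX, hornerC); ring. Qed.

Lemma g4E x : (g4 n C2 eta a b v).[x] = x ^+ 0 * bracket
  ((eta - 2 * C2 * eta ^+ 2) * v 3 0) 0 0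
  (8 * n%:R * b ^+ 2 * v 1 0 / eta + 2 * n%:R * C2 * b ^+ 2 * v 3 0)
  (2 * a ^+ 2 * v 4 0 / eta) x.
Proof. by rewrite /g4 /bracket !(hornerD, hornerZ, hornerXn, hornerX, hornerC); ring. Qed.

End Polynomials.
Local Notation Xi := (threshold_set n C2 thetaR thetaC c eta a b).

Section Signs.
Variable v : 'cV[R]_5.
Hypothesis v_adm : admissible c v.

Let v_gt0 i : 0 < v i 0. Proof. by case: v_adm. Qed.

Lemma g1_signs : bracket_signs ((c1 c * v 0 0 - c2 c * v 1 0 - c3 c * v 2 0) * a)
  (c4 c * v 3 0 * b ^+ 2) 0 0 0.
Proof.
case: c_gt0 v_adm => -[p1 p2 p3 p4 p5] [p6 p7 p8 p9 p10] [_ h _].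
have m : 0 < c4 c * v 3 0 * b ^+ 2 by rewrite !mulr_gt0 ?exprn_gt0.
by split; [split; rewrite ?(ltW m) //; apply: mulr_gt0 => //; lra|rewrite !addr0].
Qed.

Lemma g2_signs : bracket_signs (thetaR * b * v 1 0) 0
  (c6 c * v 3 0 * b ^+ 2 + c5 c * v 4 0 * (a ^+ 2 / b)) 0 0.
Proof.
case: c_gt0 => -[p1 p2 p3 p4 p5] [p6 p7 p8 p9 p10].
have m : 0 < c6 c * v 3 0 * b ^+ 2 + c5 c * v 4 0 * (a ^+ 2 / b).
  by rewrite addr_gt0 ?mulr_gt0 ?exprn_gt0 ?invr_gt0.
by split; [split; rewrite ?(ltW m) ?mulr_gt0|rewrite add0r !addr0].
Qed.

Lemma g3_signs : bracket_signs (thetaC * v 2 0) (c8 c * v 4 0)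
  (8 * n%:R * c7 c * v 1 0 * b ^+ 2 + C2 * n%:R * c7 c * v 3 0 * b ^+ 2)
  (2 * c7 c * v 4 0 * a ^+ 2) 0.
Proof.
case: c_gt0 => -[p1 p2 p3 p4 p5] [p6 p7 p8 p9 p10].
have m1 : 0 < c8 c * v 4 0 by rewrite mulr_gt0.
have m2 : 0 < 8 * n%:R * c7 c * v 1 0 * b ^+ 2 + C2 * n%:R * c7 c * v 3 0 * b ^+ 2.
  by rewrite addr_gt0 ?mulr_gt0 ?exprn_gt0.
have m4 : 0 < 2 * c7 c * v 4 0 * a ^+ 2 by rewrite !mulr_gt0 ?exprn_gt0.
split; [split=> //; [exact: mulr_gt0|exact: ltW|exact: ltW|exact: ltW]|].
by rewrite addr0; apply: addr_gt0 => //; apply: addr_gt0.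
Qed.

Lemma g4_signs : bracket_signs ((eta - 2 * C2 * eta ^+ 2) * v 3 0) 0 0
  (8 * n%:R * b ^+ 2 * v 1 0 / eta + 2 * n%:R * C2 * b ^+ 2 * v 3 0)
  (2 * a ^+ 2 * v 4 0 / eta).
Proof.
have m4 : 0 < 8 * n%:R * b ^+ 2 * v 1 0 / eta + 2 * n%:R * C2 * b ^+ 2 * v 3 0.
  by rewrite addr_gt0 ?mulr_gt0 ?exprn_gt0 ?invr_gt0.
have m6 : 0 < 2 * a ^+ 2 * v 4 0 / eta.
  by rewrite !mulr_gt0 ?exprn_gt0 ?invr_gt0.
split; [split=> //; [exact: mulr_gt0|exact: ltW|exact: ltW]|].
by rewrite !add0r; exact: addr_gt0.
Qed.

Lemma g_roots_exist : exists xi1 xi2 xi3 xi4 : R,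
  [/\ is_min_pos_root (g1 c a b v) xi1, is_min_pos_root (g2 thetaR c a b v) xi2,
      is_min_pos_root (g3 n C2 thetaC c a b v) xi3
    & is_min_pos_root (g4 n C2 eta a b v) xi4].
Proof.
have [x1 h1] := min_pos_root_exists g1_signs (g1E v).
have [x2 h2] := min_pos_root_exists g2_signs (g2E v).
have [x3 h3] := min_pos_root_exists g3_signs (g3E v).
have [x4 h4] := min_pos_root_exists g4_signs (g4E v).
by exists x1, x2, x3, x4.
Qed.

(** [g_2] alone bounds the threshold: [v_4] exceeds [c9 v_1]. *)
Lemma g2_root_le x : is_min_pos_root (g2 thetaR c a b v) x ->
  x ^+ 2 <= thetaR * b / (c5 c * c9 c * (a ^+ 2 / b)).
Proof.
case: c_gt0 v_adm => -[p1 p2 p3 p4 p5] [p6 p7 p8 p9 p10] [_ _ h] [x0 + _].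
rewrite rootE g2E mulf_eq0 expf_eq0 (gt_eqF x0) andbF /= /bracket => /eqP e.
have ab0 : 0 < a ^+ 2 / b by rewrite divr_gt0 ?exprn_gt0.
have den : 0 < c5 c * c9 c * (a ^+ 2 / b) by do 2!apply: mulr_gt0 => //.
rewrite ler_pdivlMr //.
suff : x ^+ 2 * (c5 c * c9 c * (a ^+ 2 / b)) * v 1 0 <= thetaR * b * v 1 0.
  by rewrite ler_pM2r.
have x2 : 0 < x ^+ 2 by rewrite exprn_gt0.
have le1 : c5 c * (a ^+ 2 / b) * x ^+ 2 * (c9 c * v 1 0) <=
    c5 c * (a ^+ 2 / b) * x ^+ 2 * v 4 0.
  apply: ler_wpM2l; first by apply: ltW; do 2!apply: mulr_gt0 => //.
  have := mulr_gt0 p10 (v_gt0 0); have := v_gt0 2; lra.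
have le2 : 0 <= c6 c * v 3 0 * b ^+ 2 * x ^+ 2.
  by apply: ltW; do 3!apply: mulr_gt0 => //; rewrite exprn_gt0.
lra.
Qed.

(** The first four rows of [A v - v] are the values at [g] of [g_1], ..., [g_4];
    the last one is the second condition of admissibility. *)
Lemma rate_lt xi1 xi2 xi3 xi4 g :
  is_min_pos_root (g1 c a b v) xi1 -> is_min_pos_root (g2 thetaR c a b v) xi2 ->
  is_min_pos_root (g3 n C2 thetaC c a b v) xi3 ->
  is_min_pos_root (g4 n C2 eta a b v) xi4 ->
  0 < g -> g < Num.min (Num.min xi1 xi2) (Num.min xi3 xi4) ->
  forall i, (rateA n C2 thetaR thetaC c (a * g ^+ 3) (b * g ^+ 2) g eta *m v) i 0
    < v i 0.
Proof.
move=> r1 r2 r3 r4 g0; rewrite !lt_min => /andP[/andP[l1 l2] /andP[l3 l4]].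
have n1 := min_pos_root_lt g1_signs (g1E v) r1 g0 l1.
have n2 := min_pos_root_lt g2_signs (g2E v) r2 g0 l2.
have n3 := min_pos_root_lt g3_signs (g3E v) r3 g0 l3.
have n4 := min_pos_root_lt g4_signs (g4E v) r4 g0 l4.
have [_ _ n5] := v_adm.
move=> i; rewrite mxE !big_ord_recl big_ord0 addr0 !mxE -subr_lt0.
move: n1 n2 n3 n4; rewrite g1E g2E g3E g4E /bracket.
have -> : lift ord0 ord0 = 1 :> 'I_5 by exact/val_inj.
have -> : lift ord0 (lift ord0 ord0) = 2 :> 'I_5 by exact/val_inj.
have -> : lift ord0 (lift ord0 (lift ord0 ord0)) = 3 :> 'I_5 by exact/val_inj.
have -> : lift ord0 (lift ord0 (lift ord0 (lift ord0 ord0))) = 4 :> 'I_5.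
  exact/val_inj.
have -> : ord0 = 0 :> 'I_5 by exact/val_inj.
case: i => -[|[|[|[|[|//]]]]] i5 /= n1 n2 n3 n4.
- have -> : Ordinal i5 = 0 by exact/val_inj.
  by apply: le_lt_trans n1; apply: le_of_eq; ring.
- have -> : Ordinal i5 = 1 by exact/val_inj.
  apply: le_lt_trans n2; apply: le_of_eq; field.
  by rewrite !gt_eqF.
- have -> : Ordinal i5 = 2 by exact/val_inj.
  apply: le_lt_trans n3; apply: le_of_eq; field.
  by rewrite !gt_eqF.
- have -> : Ordinal i5 = 3 by exact/val_inj.
  apply: le_lt_trans n4; apply: le_of_eq; field.
  by rewrite !gt_eqF.
- have -> : Ordinal i5 = 4 by exact/val_inj.
  by move: n5; lra.
Qed.

End Signs.

(** The first entry is taken large compared with the next two, then the last one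
    large compared with the others. *)
Lemma admissible_exists : exists v, admissible c v.
Proof.
case: c_gt0 => -[p1 p2 p3 p4 p5] [p6 p7 p8 p9 p10].
pose v0 := (c2 c + c3 c) / c1 c + 1.
have v00 : 0 < v0 by rewrite addr_gt0 ?divr_gt0 ?addr_gt0.
exists (\col_i [:: v0; 1; 1; 1; c10 c * v0 + c9 c + 4]`_i); split.
- move=> i; rewrite mxE; case: i => -[|[|[|[|[|//]]]]] ? //=.
  by rewrite !addr_gt0 ?mulr_gt0.
- rewrite !mxE /= !mulr1 /v0 mulrDr mulr1 mulrCA divff ?gt_eqF // mulr1.
  by rewrite ltrDl.
- by rewrite !mxE /=; lra.
Qed.

Lemma threshold_gt0 m : Xi m -> 0 < m.
Proof.
move=> [v [x1 [x2 [x3 [x4 [[_ [h1 _ _] [h2 _ _]] [[h3 _ _] [h4 _ _] ->]]]]]]].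
by rewrite !lt_min h1 h2 h3 h4.
Qed.

Lemma threshold_has_sup : has_sup Xi.
Proof.
split.
  have [v va] := admissible_exists.
  have [x1 [x2 [x3 [x4 [h1 h2 h3 h4]]]]] := g_roots_exist va.
  exists (Num.min (Num.min x1 x2) (Num.min x3 x4)).
  by exists v, x1, x2, x3, x4.
pose K := thetaR * b / (c5 c * c9 c * (a ^+ 2 / b)).
have K0 : 0 <= K.
  case: c_gt0 => -[_ _ _ _ p5] [_ _ _ p9 _].
  apply: divr_ge0; apply: ltW; first exact: mulr_gt0.
  by do 2!apply: mulr_gt0 => //; rewrite ?exprn_gt0 ?invr_gt0.
exists (1 + K) => _ [v [x1 [x2 [x3 [x4 [[va _ h2] [_ _ ->]]]]]]].
rewrite !ge_min; apply/orP; left; apply/orP; right.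
have := g2_root_le va h2; rewrite -/K => xK.
rewrite -(@ler_pXn2r _ 2) ?nnegrE //; first nra.
  by case: h2 => /ltW.
by rewrite addr_ge0.
Qed.

Lemma sup_threshold_gt0 : 0 < sup Xi.
Proof.
have hs := threshold_has_sup; have [[m mXi] _] := hs.
have ub := sup_upper_bound hs.
exact: lt_le_trans (threshold_gt0 mXi) (ub _ mXi).
Qed.

Lemma below_threshold g : 0 < g -> g < sup Xi -> exists v, positive_vec v /\
  forall i, (rateA n C2 thetaR thetaC c (a * g ^+ 3) (b * g ^+ 2) g eta *m v) i 0
    < v i 0.
Proof.
move=> g0 /(sup_gt threshold_has_sup.1) [m].
move=> [v [x1 [x2 [x3 [x4 [[va h1 h2] [h3 h4 ->]]]]]]] gm.
by exists v; split; [case: va|exact: rate_lt h1 h2 h3 h4 g0 gm].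
Qed.

End Threshold.

Ltac positivity := repeat first [assumption | exact: ltr01 | apply: mulr_gt0
  | apply: addr_gt0 | apply: exprn_gt0 | rewrite invr_gt0 | rewrite ltr0n].

Section RateMatrix.
Context {R : realType}.
Variables (n : nat) (C2 thetaR thetaC : R) (c : coefs R) (a b g eta : R).
Hypotheses (n_gt0 : (0 < n)%N) (C2_gt0 : 0 < C2).
Hypothesis c_gt0 : [/\ 0 < c1 c, 0 < c2 c, 0 < c3 c, 0 < c4 c & 0 < c5 c] /\
  [/\ 0 < c6 c, 0 < c7 c, 0 < c8 c, 0 < c9 c & 0 < c10 c].
Hypotheses (a_gt0 : 0 < a) (b_gt0 : 0 < b) (g_gt0 : 0 < g) (eta_gt0 : 0 < eta)
  (eta_le1 : eta <= 1).
Hypotheses (diag1 : c1 c * a <= 1) (diag2 : thetaR * b <= 1)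
  (diag3 : thetaC * g <= 1).

Local Notation A := (rateA n C2 thetaR thetaC c a b g eta).

Let n0 : 0 < n%:R :> R. Proof. by rewrite ltr0n. Qed.

Lemma rateA_ge0 i j : 0 <= A i j.
Proof.
case: c_gt0 => -[p1 p2 p3 p4 p5] [p6 p7 p8 p9 p10].
rewrite mxE; case: i => -[|[|[|[|[|//]]]]] ?; case: j => -[|[|[|[|[|//]]]]] ? //=;
  rewrite ?subr_ge0 // ?(ltW p9) ?(ltW p10) //.
all: try by apply: ltW; positivity.
by apply: addr_ge0; [apply: addr_ge0; rewrite ?subr_ge0 //|]; apply: ltW; positivity.
Qed.

(** Every index leads to the second one, and the second one to every index. *)
Lemma rateA_irreducible i j : connect [rel x y | 0 < A x y] i j.
Proof.
case: c_gt0 => -[p1 p2 p3 p4 p5] [p6 p7 p8 p9 p10].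
have e01 : 0 < A 0 1 by rewrite mxE /=; positivity.
have e13 : 0 < A 1 3 by rewrite mxE /=; positivity.
have e14 : 0 < A 1 4 by rewrite mxE /=; positivity.
have e21 : 0 < A 2 1 by rewrite mxE /=; positivity.
have e31 : 0 < A 3 1 by rewrite mxE /=; positivity.
have e41 : 0 < A 4 1 by rewrite mxE /=; positivity.
have e40 : 0 < A 4 0 by rewrite mxE /=; positivity.
have e42 : 0 < A 4 2 by rewrite mxE.
have to1 : connect [rel x y | 0 < A x y] i 1.
  case: i => -[|[|[|[|[|//]]]]] i5.
  - by apply: connect1; rewrite /= (_ : Ordinal i5 = 0) //; exact/val_inj.
  - by rewrite (_ : Ordinal i5 = 1) ?connect0 //; exact/val_inj.
  - by apply: connect1; rewrite /= (_ : Ordinal i5 = 2) //; exact/val_inj.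
  - by apply: connect1; rewrite /= (_ : Ordinal i5 = 3) //; exact/val_inj.
  - by apply: connect1; rewrite /= (_ : Ordinal i5 = 4) //; exact/val_inj.
apply: connect_trans to1 _.
have c14 : connect [rel x y | 0 < A x y] 1 4 by exact: connect1.
case: j => -[|[|[|[|[|//]]]]] i5.
- apply: connect_trans c14 (connect1 _).
  by rewrite /= (_ : Ordinal i5 = 0) //; exact/val_inj.
- by rewrite (_ : Ordinal i5 = 1) ?connect0 //; exact/val_inj.
- apply: connect_trans c14 (connect1 _).
  by rewrite /= (_ : Ordinal i5 = 2) //; exact/val_inj.
- by apply: connect1; rewrite /= (_ : Ordinal i5 = 3) //; exact/val_inj.
- by apply: connect1; rewrite /= (_ : Ordinal i5 = 4) //; exact/val_inj.
Qed.

End RateMatrix.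

(** * Linear convergence *)

Section Domination.
Context {R : realType}.
Variables (A : 'M[R]_5) (v : 'cV[R]_5) (r s : R) (e : nat -> 'cV[R]_5).
Hypotheses (A_ge0 : forall i j, 0 <= A i j) (v_gt0 : positive_vec v).
Hypotheses (Av : A *m v = r *: v) (r01 : 0 <= r <= 1) (s_ge0 : 0 <= s).
Hypothesis A44 : A 4 4 = 0.
Hypothesis e_step : forall k (i : 'I_5), (i < 4)%N ->
  e k.+1 i 0 <= (A *m e k) i 0.
Hypothesis e_last : forall k, e k 4 0 <= (A *m e k) 4 0.
Hypothesis e_init : forall i : 'I_5, (i < 4)%N -> e 0%N i 0 <= s * v i 0.

(** The last component is bounded through the other four at the same time, since
    [(A e)_4] does not involve [e_4]; the bound then has a factor [r <= 1] to
    spare. *)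
Lemma eigenvector_domination k i : e k i 0 <= s * r ^+ k * v i 0.
Proof.
have /andP[r0 r1] := r01.
have AvE j : \sum_l A j l * v l 0 = r * v j 0.
  by have /matrixP/(_ j 0) := Av; rewrite !mxE.
have sr0 j : 0 <= s * r ^+ j by rewrite mulr_ge0 ?exprn_ge0.
have last j : (forall l : 'I_5, (l < 4)%N -> e j l 0 <= s * r ^+ j * v l 0) ->
    e j 4 0 <= s * r ^+ j * v 4 0.
  move=> ej; apply: le_trans (e_last j) _.
  apply: le_trans (_ : s * r ^+ j * (r * v 4 0) <= _); last first.
    by rewrite ler_wpM2l // ler_piMl // ltW.
  rewrite -AvE mxE mulr_sumr; apply: ler_sum => l _; rewrite mulrCA.
  have [l4|] := ltnP l 4; first by rewrite ler_wpM2l ?ej.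
  move=> l4; have -> : l = 4.
    by apply/val_inj/eqP; rewrite eqn_leq l4 andbT -ltnS ltn_ord.
  by rewrite A44 !mul0r.
have split_le j : (forall l : 'I_5, (l < 4)%N -> e j l 0 <= s * r ^+ j * v l 0) ->
    forall l, e j l 0 <= s * r ^+ j * v l 0.
  move=> ej l; have [l4|l4] := ltnP l 4; first exact: ej.
  have -> : l = 4 by apply/val_inj/eqP; rewrite eqn_leq l4 andbT -ltnS ltn_ord.
  exact: last.
elim: k i => [|k IH]; apply: split_le => l l4.
  by rewrite expr0 mulr1 e_init.
apply: le_trans (e_step k l4) _.
rewrite exprSr mulrA -[_ * r * _]mulrA -AvE mxE mulr_sumr.
by apply: ler_sum => j _; rewrite mulrCA ler_wpM2l.
Qed.

End Domination.

Theorem theorem7 (R : realType) (n p : nat) (p_gt0 : (0 < p)%N)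
  (* objective *)
  (mu L : R) (f : 'I_n -> 'rV[R]_p -> R) (xs : 'rV[R]_p)
  (mu_gt0 : 0 < mu)
  (f_diff : forall i x, differentiable (f i) x)
  (f_convex : forall i, strongly_convex mu (f i))
  (f_smooth : forall i, smooth L (f i))
  (xs_min : forall x, favg f xs <= favg f x)
  (* network *)
  (E : rel 'I_n) (Rm Cm : 'M[R]_n) (net : network_assumption E Rm Cm)
  (sR sC : 'cV[R]_n)
  (sR_eig : sR^T *m Rm = sR^T) (sC_eig : Cm *m sC = sC)
  (sR_sum : (sR^T *m ones) 0 0 = n%:R) (sC_sum : (sC^T *m ones) 0 0 = n%:R)
  (* norms *)
  (TR TC : 'M[R]_n) (thetaR thetaC deltaR deltaC : R)
  (normR : norm_data Rm (PiR sR) TR thetaR deltaR)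
  (normC : norm_data Cm (PiC sC) TC thetaC deltaC)
  (* compression *)
  (dO dZ : measure_display) (Om : measurableType dO) (Z : measurableType dZ)
  (P : probability Om R) (nu : probability Z R)
  (C2 : R) (C2_gt0 : 0 < C2) (compress : 'rV[R]_p -> Z -> 'rV[R]_p)
  (compressP : compressor nu C2 compress)
  (seed : call n -> {RV P >-> Z}) (seedP : iid_seeds nu seed)
  (* parameters *)
  (alpha' beta' eta w : R)
  (alpha'_gt0 : 0 < alpha') (beta'_gt0 : 0 < beta')
  (eta_gt0 : 0 < eta) (eta_lt : eta < (2 * C2)^-1) (eta_le1 : eta <= 1)
  (w_ge : n%:R / mxdot sR sC <= w) :
  let c := cpp_coefs sR sC mu L C2 w thetaR thetaC deltaR deltaC in
  let Xi := threshold_set n C2 thetaR thetaC c eta alpha' beta' in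
  exists gamma' : R,
    [/\ has_sup Xi, gamma' = sup Xi, 0 < gamma' &
    forall gamma : R, 0 < gamma -> gamma < gamma' ->
    gamma <= Num.min 1 (Num.min (beta' `^ (- 2^-1))
      ((2 * n%:R / (alpha' * (mu + L) * mxdot sR sC)) `^ 3^-1)) ->
    forall (alpha : 'rV[R]_n) (X0 : 'M[R]_(n, p))
      (X Y U Xh Yh : nat -> Om -> 'M[R]_(n, p)),
    let beta := beta' * gamma ^+ 2 in
    (forall i, 0 <= alpha 0 i) ->
    alpha_hat alpha = alpha' * gamma ^+ 3 ->
    0 < alpha_bar sR sC alpha ->
    alpha_hat alpha / alpha_bar sR sC alpha <= w ->
    is_CPP f Rm Cm compress seed alpha beta gamma eta X0 X Y U Xh Yh ->
    let d := error_vector P sR sC TR TC xs X Y U in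
    let A := rateA n C2 thetaR thetaC c (alpha_hat alpha) beta gamma eta in
    let rho := spectral_radius A in
    [/\ converges_linearly_to_0 (fun k => d k 0),
        converges_linearly_to_0 (fun k => d k 1),
        rho < 1,
        (exists v, perron_vector A v /\
           forall v', perron_vector A v' -> exists t : R, v' = t *: v)
      & forall v, perron_vector A v -> forall k : nat,
          (d k 0%R <= sigma (d 0%N) v * (v 0%R 0%R * rho ^+ k)%:E)%E /\
          (d k 1%R <= sigma (d 0%N) v * (v 1%R 0%R * rho ^+ k)%:E)%E]].

Proof.
have n_gt0 := network_n_gt0 net.
have [sR0 sC0 sRC] := network_weights net sR_eig sC_eig sR_sum sC_sum.
have muL : mu <= L.
  exact: (strongly_convex_le_smooth (f_convex (Ordinal n_gt0))
    (f_smooth (Ordinal n_gt0)) p_gt0).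
have L_gt0 : 0 < L by exact: lt_le_trans mu_gt0 muL.
have n0 : 0 < n%:R :> R by rewrite ltr0n.
have w_gt0 : 0 < w by apply: lt_le_trans w_ge; rewrite divr_gt0.
have /andP[tR0 tR1] := nd_theta normR; have /andP[tC0 tC1] := nd_theta normC.
have sR_n0 : 0 < enorm sR ^+ 2.
  rewrite enorm_sqr mxdot_gt0 //; apply: contraTneq sRC => ->.
  by rewrite -(scale0r (0 : 'cV[R]_n)) mxdotZl mul0r ltxx.
have sC_n0 : 0 < enorm sC ^+ 2.
  rewrite enorm_sqr mxdot_gt0 //; apply: contraTneq sRC => ->.
  by rewrite -(scale0r (0 : 'cV[R]_n)) mxdotZr mul0r ltxx.
move=> c Xi.
have c_gt0 : [/\ 0 < c1 c, 0 < c2 c, 0 < c3 c, 0 < c4 c & 0 < c5 c] /\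
    [/\ 0 < c6 c, 0 < c7 c, 0 < c8 c, 0 < c9 c & 0 < c10 c].
  have dR := norm_data_delta_gt0 normR n_gt0.
  have dC := norm_data_delta_gt0 normC n_gt0.
  rewrite /c /cpp_coefs /=; do 2!split; positivity.
have eta2 : 0 < eta - 2 * C2 * eta ^+ 2.
  have h : 0 < 2 * C2 by rewrite mulr_gt0.
  move: eta_lt; rewrite -(ltr_pM2l h) divff ?gt_eqF // => h2.
  have -> : eta - 2 * C2 * eta ^+ 2 = eta * (1 - 2 * C2 * eta) by ring.
  by rewrite mulr_gt0 // subr_gt0.
exists (sup Xi); split=> //.
- exact: threshold_has_sup.
- exact: sup_threshold_gt0.
move=> gamma gamma_gt0 gamma_lt; rewrite !le_min => /and3P[gamma1 gammaB gammaA].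
move=> alpha X0 X Y U Xh Yh beta alpha_ge0 ahE ab_gt0 ah_ab cpp d A rho.
have beta_gt0 : 0 < beta by rewrite mulr_gt0 ?exprn_gt0.
(* the square of the second bound on [gamma] *)
have beta_le1 : beta <= 1.
  have := lerXn2r 2 (ltW gamma_gt0 : gamma \in Num.nneg) (powR_ge0 _ _) gammaB.
  rewrite -(powR_mulrn 2 (powR_ge0 beta' _)) -powRrM mulNr mulVf ?pnatr_eq0 //.
  by rewrite powR_inv1 ?(ltW beta'_gt0) // => h; rewrite /beta -ler_pdivlMl // mulr1.
have ah_gt0 : 0 < alpha_hat alpha by rewrite ahE mulr_gt0 ?exprn_gt0.
have ah_le : alpha_hat alpha * (mu + L) * mxdot sR sC <= 2 * n%:R.
  have den : 0 < alpha' * (mu + L) * mxdot sR sC.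
    by do 2![apply: mulr_gt0 => //]; apply: addr_gt0.
  have := lerXn2r 3 (ltW gamma_gt0 : gamma \in Num.nneg) (powR_ge0 _ _) gammaA.
  rewrite -(powR_mulrn 3 (powR_ge0 (2 * n%:R / _) _)) -powRrM mulVf ?pnatr_eq0 //.
  rewrite powRr1; last by rewrite divr_ge0 ?ltW // mulr_gt0.
  by rewrite ler_pdivlMr // ahE; lra.
have beta01 : 0 < beta <= 1 by rewrite beta_gt0.
have gamma01 : 0 < gamma <= 1 by rewrite gamma_gt0.
have eta01 : 0 < eta <= 1 by rewrite eta_gt0.
(* [c1 alpha_hat <= 1] because [w >= n / sR.sC] and [2 mu <= mu + L] in the
   bound on the cube of [gamma] *)
have A_ge0 : forall i j, 0 <= A i j.
  apply: rateA_ge0 => //.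
  - rewrite /c /= mulrAC ler_pdivrMr // mul1r.
    apply: le_trans w_ge; rewrite ler_pdivlMr //.
    have : alpha_hat alpha * (2 * mu) * mxdot sR sC <=
        alpha_hat alpha * (mu + L) * mxdot sR sC.
      rewrite ler_wpM2r ?(ltW sRC) // ler_wpM2l ?(ltW ah_gt0) //; lra.
    lra.
  - by rewrite mulr_ile1 // ltW.
  - by rewrite mulr_ile1 // ltW.
have A_irr : forall i j, connect [rel x y | 0 < A x y] i j.
  exact: rateA_irreducible.
have [r [v0 [r0 v00 Av0]]] := perron_exists A_ge0 A_irr.
have rhoE : rho = r by exact: spectral_radius_perron Av0.
have rho_lt1 : rho < 1.
  rewrite rhoE.
  have [u [u0 uA]] := below_threshold n_gt0 C2_gt0 tR0 tC0 c_gt0 alpha'_gt0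
    beta'_gt0 eta_gt0 eta2 gamma_gt0 gamma_lt.
  apply: (perron_lt1 A_ge0 v00 Av0 u0) => i; rewrite /A ahE; exact: uA.
have rho_ge0 : 0 <= rho by rewrite rhoE.
have dE k i : d k i = (mean_errors xs sR sC TR TC P X Y U k i 0)%:E.
  exact: (error_vectorE xs f_smooth sR sC TR TC compressP seedP cpp).
have e_ge0 := mean_errors_ge0 xs sR sC TR TC P X Y U.
have stepE := mean_errors_step mu_gt0 muL f_diff f_convex f_smooth xs_min net
  sR_eig sC_eig sR_sum sC_sum normR normC w_gt0 beta01 gamma01 eta01 alpha_ge0
  ab_gt0 ah_ab ah_le compressP seedP cpp.
have lastE := mean_errors_last mu_gt0 muL f_diff f_smooth xs_min net
  normR normC w compressP seedP cpp.
move: (mean_errors _ _ _ _ _ _ _ _ _) dE e_ge0 stepE lastE => e dE e_ge0 stepE lastE.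
(* the errors at time 0 are finite, so that [sigma] is a real number *)
have sigmaP v : perron_vector A v -> exists s : R, sigma (d 0%N) v = s%:E /\
    forall k i, e k i 0 <= s * rho ^+ k * v i 0.
  move=> [v_gt0 Av].
  have term i : (d 0%N i * ((v i 0)^-1)%:E)%E = (e 0%N i 0 / v i 0)%:E by rewrite dE.
  have le_sigma (i : 'I_5) : (i < 4)%N ->
      ((e 0%N i 0 / v i 0)%:E <= sigma (d 0%N) v)%E.
    move=> i4; rewrite -term /sigma.
    exact: (le_bigmax_cond -oo%E (fun i => d 0%N i * ((v i 0)^-1)%:E)%E i4).
  have sigma_le : (sigma (d 0%N) v <= (\sum_i e 0%N i 0 / v i 0)%:E)%E.
    apply: bigmax_le => [|i _]; first exact: leNye.
    rewrite term lee_fin (bigD1 i) //= lerDl sumr_ge0 // => j _.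
    by rewrite divr_ge0 // ltW.
  have sfin : sigma (d 0%N) v \is a fin_num.
    rewrite fin_numElt (le_lt_trans sigma_le) ?ltry // andbT.
    by apply: lt_le_trans (le_sigma ord0 isT); exact: ltNyr.
  exists (fine (sigma (d 0%N) v)); split; first by rewrite fineK.
  have le_s (i : 'I_5) : (i < 4)%N -> e 0%N i 0 / v i 0 <= fine (sigma (d 0%N) v).
    by move=> i4; rewrite -lee_fin fineK //; exact: le_sigma.
  apply: (eigenvector_domination A_ge0 v_gt0 Av) => //.
  - by rewrite rho_ge0 ltW.
  - by apply: le_trans (le_s ord0 isT); rewrite divr_ge0 // ltW.
  - by rewrite mxE.
  - by move=> i i4; rewrite -ler_pdivrMr //; exact: le_s.
have perron0 : perron_vector A v0 by split=> //; rewrite -/rho rhoE.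
have linear i : converges_linearly_to_0 (fun k => d k i).
  have [s [_ le_s]] := sigmaP v0 perron0.
  exists (s * v0 i 0), rho; split=> // k.
  by rewrite dE gee0_abs ?lee_fin // mulrAC.
split=> //.
  exists v0; split=> // v [v_gt0 Av].
  have Av0' : A *m v0 = rho *: v0 by rewrite rhoE.
  exact: (perron_unique A_ge0 A_irr rho_ge0 v00 Av0' Av).
move=> v /sigmaP [s [-> le_s]] k.
by rewrite !dE -!EFinM !lee_fin ![v _ 0 * _]mulrC !mulrA.
Qed.
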